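(* Let the setting, notation and assumptions (A1)–(A5) be as in the context; that is, suppose the nuisance space $\mathcal G$ is equipped with either the norm $\|\cdot\|_\infty$ or the norm $\|\cdot\|_2$ on functions, that (A1)–(A5) hold, and that $$k\left(g_n+U^5\,k\sqrt{\frac{2\log (2p)}{n}}+3\,d\,U^3\sqrt{\frac{\log(2p)}{n}}\right)=o(1).$$ Then, for $n$ and $C$ large enough and with the penalty chosen as $$\lambda=C\left(\sqrt{\frac{\log p}{n}}+B_0\,g_n+g_n^2\right),$$ the estimator $\widehat\theta=\arg\min_{\theta\in\mathbb R^p}\widehat Q(\theta,\widehat g)+\lambda\|\theta\|_1$ satisfies $$\|\widehat\theta-\theta_0\|_2=O_P(\sqrt k\,\lambda),\qquad \|\widehat\theta-\theta_0\|_1=O_P(k\,\lambda).$$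
   Context: Setting. $W_1,\dots,W_n$ are i.i.d. copies of a data vector $W\in\mathcal W\subseteq\mathbb R^{\dim W}$; $Z$ is a subvector of $W$ with support $\mathcal Z$. Asymptotics are as $n\to\infty$; $p=p_n$ and $k=k_n$ may grow, while $d$ and the constants below are fixed. $m(w,t,\gamma):\mathcal W\times\mathbb R\times\mathbb R^d\to\mathbb R$ is the moment function, $\Lambda(z,\gamma):\mathcal Z\times\mathbb R^d\to\mathbb R^p$ is a known index function whose coordinates $\Lambda_j$ have well-defined gradient and Hessian in $\gamma$, and $g_0:\mathcal Z\to\mathbb R^d$ is a nuisance function. The parameter $\theta_0\in\mathbb R^p$ satisfies $$\mathbb E\big[m(W,\Lambda(Z,\gamma)'\theta_0,\gamma)\big|_{\gamma=g_0(Z)}\,\big|\,Z=z\big]=0\quad\text{for all }z .$$ $T=\{j:\theta_{0,j}\ne0\}$ and $k=|T|$. Loss. $\ell(w,t,\gamma)$ solves $\frac{\partial}{\partial t}\ell(w,t,\gamma)=m(w,t,\gamma)$, $t\in\mathbb R$. Set $Q(\theta,g)=\mathbb E[\ell(W,\Lambda(Z,g(Z))'\theta,g(Z))]$ and $\widehat Q(\theta,g)=\frac1n\sum_{i=1}^n\ell(W_i,\Lambda(Z_i,g(Z_i))'\theta,g(Z_i))$. The first-stage estimate $\widehat g$ of $g_0$ is computed on an auxiliary sample independent of $W_1,\dots,W_n$. Norms. For vectors, $\|\cdot\|_1,\|\cdot\|_2,\|\cdot\|_\infty$ are the usual norms. For $g:\mathcal Z\to\mathbb R^d$: $\|g\|_2=(\mathbb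 E[\|g(Z)\|_1^2])^{1/2}$ and $\|g\|_\infty=\sup_{z\in\mathcal Z}\|g(z)\|_1$. The norm of a matrix or of a vector of derivatives denoted $\|\cdot\|_\infty$ is the largest absolute entry. Restricted set. $\mathcal C(T;3)=\{\nu\in\mathbb R^p:\|\nu_{T^c}\|_1\le 3\|\nu_T\|_1\}$, where $\nu_T$ (resp. $\nu_{T^c}$) agrees with $\nu$ on $T$ (resp. $T^c$) and is zero elsewhere; $\mathbb B=\{\theta\in\mathbb R^p:\theta=\theta_0+r\nu,\ r\in[0,1),\ \nu\in\mathcal C(T;3)\}$. Assumptions. (A1) Monotonicity: $t\mapsto m(w,t,\gamma)$ is non-decreasing for any $w\in\mathcal W$, $\gamma\in\Gamma$. (A2) Identification: there is a constant $C_{\min}>0$ such that the smallest eigenvalue of $\Sigma=\mathbb E[\Lambda(Z,g_0(Z))\Lambda(Z,g_0(Z))^T]$ is at least $C_{\min}$. (A3) There is a constant $B_{\min}>0$ such that $\inf_{\theta\in\mathbb B}\mathbb E[\nabla_t m(W,t,\gamma)|_{\gamma=g_0(Z),\,t=\Lambda(Z,\gamma)'\theta}\mid Z=z]\ge B_{\min}$ for all $z\in\mathcal Z$. (A4) Smooth and bounded design: $\mathcal W$ is an open bounded set containing the support of $W$, $\mathcal T$ is an open set containing the support of $\Lambda(Z,g_0(Z))'\theta_0$, $\Gamma$ is an open bounded set containing the support of $g(Z)$ for $g\in\mathcal G_n$ (these sets do not change with $n$), and there is a constant $U<\infty$ such that $\sup_{\theta\in\Theta}\|\theta\|_1\le U$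 ($\Theta$ the parameter space) and, for all $w\in\mathcal W$, $t\in\mathcal T$, $\gamma\in\Gamma$, each of $|m|,\ \|\nabla_\gamma m\|_\infty,\ |\nabla_t m|,\ \|\nabla_{\gamma t}m\|_\infty,\ \|\nabla_{\gamma\gamma}m\|_\infty,\ |\nabla_{tt}m|$ at $(w,t,\gamma)$ is at most $U$, and $|\Lambda_j(z,\gamma)|,\ \|\nabla_\gamma\Lambda_j(z,\gamma)\|_\infty,\ \|\nabla_{\gamma\gamma}\Lambda_j(z,\gamma)\|_\infty\le U$ for all $j\in\{1,\dots,p\}$. (A5) First-stage rate: there are sequences $\delta_n=o(1)$, $g_n=o(1)$ and sets $\mathcal G_n\subseteq\mathcal G$ with $g_0\in\mathcal G_n$, $\widehat g\in\mathcal G_n$ with probability at least $1-\delta_n$, and $\sup_{g\in\mathcal G_n}\|g-g_0\|\le g_n$, where $\|\cdot\|$ is the chosen function norm ($\|\cdot\|_\infty$ or $\|\cdot\|_2$). The constant $B_0$. $B_0\ge0$ is a constant such that, for some constant $B$, all $g\in\mathcal G_n$ and all $r\in[0,1)$, $$\Big\|D_0[g-g_0,\nabla_\theta Q(\theta_0,g_0)]+D_r^2[g-g_0,\nabla_\theta Q(\theta_0,g_0)]\Big\|_\infty\le B_0\|g-g_0\|+B\|g-g_0\|^2,$$ where $D_r[g-g_0,\cdot]=\frac{\partial}{\partial r}\nabla_\theta Q(\theta_0,r(g-g_0)+g_0)$, $D_0$ is its value at $r=0$, and $D_r^2[g-g_0,\cdot]=\frac{\partial^2}{\partial r^2}\nabla_\theta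 Q(\theta_0,r(g-g_0)+g_0)$. In particular one takes $B_0=0$ when the orthogonality condition $\frac{\partial}{\partial r}\nabla_\theta Q(\theta_0,r(g-g_0)+g_0)|_{r=0}=0$ holds.
   Formalization: Also assumes: p≥2 for large n; p→∞ along any n with θ_0=0; and, for the norm ‖·‖_2 only, that for large n and all g in G_n the path g_0+r(g−g_0), r in [0,1], and its index Λ'θ_0 stay a.s. in Γ and 𝒯. Without these the claim can fail. *)

(* Defs.v *)
From HB Require Import structures.
From mathcomp Require Import all_boot all_order all_algebra.
From mathcomp Require Import all_classical all_reals all_analysis.

Set Implicit Arguments.
Unset Strict Implicit.
Unset Printing Implicit Defensive.

Import Order.TTheory GRing.Theory Num.Theory.
Import numFieldNormedType.Exports.

Local Open Scope classical_set_scope.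
Local Open Scope ring_scope.

Notation bvec R n := (g_sigma_algebraType (@open 'rV[R]_n)).

Section Vectors.
Variables (R : realType) (n : nat).
Implicit Types (u v : 'rV[R]_n) (T : {set 'I_n}).

Definition dotv u v : R := \sum_j u ord0 j * v ord0 j.
Definition norm1 v : R := \sum_j `|v ord0 j|.
Definition norm2 v : R := Num.sqrt (\sum_j v ord0 j ^+ 2).

Definition vsupp v : {set 'I_n} := finset (fun j => v ord0 j != 0).
Definition vrestr T v : 'rV[R]_n :=
  \row_j (if j \in T then v ord0 j else 0).

Definition cone T (c : R) : set 'rV[R]_n :=
  [set v | norm1 (vrestr (finset.setC T) v) <= c * norm1 (vrestr T v)].

Definition cone_segments (theta0 : 'rV[R]_n) : set 'rV[R]_n :=
  [set theta | exists r v, [/\ 0 <= r < 1, cone (vsupp theta0) 3 v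
                             & theta = theta0 + r *: v]].

Definition pderiv (f : 'rV[R]_n -> R) (j : 'I_n) (x : 'rV[R]_n) : R :=
  'D_(delta_mx ord0 j : 'rV[R]_n) f x.
Definition pderivable (f : 'rV[R]_n -> R) (j : 'I_n) (x : 'rV[R]_n) : Prop :=
  derivable f x (delta_mx ord0 j : 'rV[R]_n).

End Vectors.

Section Probability.
Context d {Omega : measurableType d} {R : realType}.
Variable P : probability Omega R.

Definition law_support (T : topologicalType) (X : Omega -> T) : set T :=
  [set x | forall U : set T, open U -> U x -> (0 < P (X @^-1` U))%E].

Definition independent d1 d2 (T1 : measurableType d1) (T2 : measurableType d2)
    (X : Omega -> T1) (Y : Omega -> T2) : Prop :=
  forall A B, measurable A -> measurable B ->
    P (X @^-1` A `&` Y @^-1` B) = (P (X @^-1` A) * P (Y @^-1` B))%E.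

Definition iid_copies d1 (T : measurableType d1)
    (X : Omega -> T) (Xs : nat -> Omega -> T) : Prop :=
  (forall i A, measurable A -> P (Xs i @^-1` A) = P (X @^-1` A)) /\
  (forall n (A : nat -> set T), (forall i, measurable (A i)) ->
     fine (P (\bigcap_(i in `I_n) (Xs i @^-1` A i)))
     = \prod_(i < n) fine (P (Xs i @^-1` A i))).

(* kappa z is the law of X given Y = z. *)
Definition cond_law d1 d2 (T1 : measurableType d1) (T2 : measurableType d2)
    (X : Omega -> T1) (Y : Omega -> T2) (kappa : R.-pker T2 ~> T1) : Prop :=
  forall A B, measurable A -> measurable B ->
    P (X @^-1` A `&` Y @^-1` B) = (\int[P]_(w in Y @^-1` B) kappa (Y w) A)%E.

Definition bigO_in_prob (X : nat -> Omega -> R) (a : nat -> R) : Prop :=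
  forall eps : R, 0 < eps -> exists M : R, \forall n \near \oo,
    (P [set w | M * `|a n| < `|X n w| ]%R <= eps%:E)%E.

End Probability.

Inductive fun_norm := SupNorm | L2Norm.

(* Objects carrying an index n may change with n; the others are fixed.  [zsel]
   selects the coordinates of w that form the subvector z.  [g0] and the other
   nuisance functions are total, but only their values on the support of Z
   matter.  [kappa] is a version of the conditional law of W given Z. *)
Record model d (Omega : measurableType d) (R : realType)
    (P : probability Omega R) := Model {
  dimW : nat;
  dimZ : nat;
  dimG : nat;
  dimP : nat -> nat;
  zsel : 'I_dimZ -> 'I_dimW;
  W : {RV P >-> bvec R dimW};
  kappa : R.-pker (bvec R dimZ) ~> (bvec R dimW);
  mom : 'rV[R]_dimW -> R -> 'rV[R]_dimG -> R;
  loss : 'rV[R]_dimW -> R -> 'rV[R]_dimG -> R;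
  Lam : forall n, 'rV[R]_dimZ -> 'rV[R]_dimG -> 'rV[R]_(dimP n);
  theta0 : forall n, 'rV[R]_(dimP n);
  g0 : 'rV[R]_dimZ -> 'rV[R]_dimG;
  domW : set 'rV[R]_dimW;
  domT : set R;
  domG : set 'rV[R]_dimG
}.

Arguments zsel {d Omega R P} M : rename.
Arguments W {d Omega R P} M : rename.
Arguments kappa {d Omega R P} M : rename.
Arguments mom {d Omega R P} M : rename.
Arguments loss {d Omega R P} M : rename.
Arguments Lam {d Omega R P} M n : rename.
Arguments theta0 {d Omega R P} M n : rename.
Arguments g0 {d Omega R P} M : rename.
Arguments domW {d Omega R P} M : rename.
Arguments domT {d Omega R P} M : rename.
Arguments domG {d Omega R P} M : rename.

Section Model.
Context d {Omega : measurableType d} {R : realType} {P : probability Omega R}.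
Variable M : model P.

Let dW := dimW M.
Let dZ := dimZ M.
Let dG := dimG M.
Let p := dimP M.
Let nuis := 'rV[R]_dZ -> 'rV[R]_dG.

Definition zpart (w : 'rV[R]_dW) : 'rV[R]_dZ := colsub (zsel M) w.
Definition Wv (o : Omega) : 'rV[R]_dW := W M o.
Definition Z (o : Omega) : 'rV[R]_dZ := zpart (Wv o).
Definition suppZ : set 'rV[R]_dZ := law_support P Z.

Definition lin_index n (theta : 'rV[R]_(p n)) (g : nuis) (z : 'rV[R]_dZ) : R :=
  dotv (Lam M n z (g z)) theta.

Definition lossat n (theta : 'rV[R]_(p n)) (g : nuis) (w : 'rV[R]_dW) : R :=
  loss M w (lin_index theta g (zpart w)) (g (zpart w)).

Definition Q n (theta : 'rV[R]_(p n)) (g : nuis) : R :=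
  fine 'E_P[(fun o => lossat theta g (Wv o))].

Definition Qhat n (ws : nat -> 'rV[R]_dW) (theta : 'rV[R]_(p n)) (g : nuis)
  : R := n%:R^-1 * \sum_(i < n) lossat theta g (ws i).

Definition sparsity n : nat := #|vsupp (theta0 M n)|.

Definition fnorm (N : fun_norm) (g : nuis) : \bar R :=
  match N with
  | SupNorm => ereal_sup [set (norm1 (g z))%:E | z in suppZ]
  | L2Norm => 'N[P]_2%:E[(fun o => (norm1 (g (Z o)))%:E)]%E
  end.

Definition gpath (g : nuis) (r : R) : nuis :=
  fun z => r *: (g z - g0 M z) + g0 M z.

(* j-th coordinate of grad_theta Q(theta0, r (g - g0) + g0) *)
Definition gradQ_path n (g : nuis) (j : 'I_(p n)) (r : R) : R :=
  pderiv (fun theta => Q theta (gpath g r)) j (theta0 M n).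

Definition mom_t w t gam : R := derive1 (fun s => mom M w s gam) t.
Definition mom_g j w t gam : R := pderiv (mom M w t) j gam.
Definition mom_tt w t gam : R := derive1 (fun s => mom_t w s gam) t.
Definition mom_gt j w t gam : R := pderiv (mom_t w t) j gam.
Definition mom_gg i j w t gam : R := pderiv (mom_g j w t) i gam.

(* Standing regularity: Z is a subvector of W, kappa is the conditional law of
   W given Z, and m, l, Lambda are Borel. *)
Definition regular_model : Prop :=
  [/\ injective (zsel M),
      cond_law P (W M) (Z : Omega -> bvec R dZ) (kappa M),
      measurable_fun [set x : bvec R dW * R * bvec R dG | domW M x.1.1]
        (fun x => mom M x.1.1 x.1.2 x.2),
      measurable_fun [set x : bvec R dW * R * bvec R dG | domW M x.1.1]
        (fun x => loss M x.1.1 x.1.2 x.2)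
    & forall n, measurable_fun [set: bvec R dZ * bvec R dG]
        (fun x => Lam M n x.1 x.2 : bvec R (p n))].

Definition moment_condition : Prop :=
  forall n z, suppZ z ->
    (\int[kappa M z]_w (mom M w (lin_index (theta0 M n) (g0 M) z) (g0 M z))%:E
     = 0)%E.

Definition loss_primitive : Prop :=
  forall w (t : R) gam, domW M w ->
    is_derive t 1 (fun s => loss M w s gam) (mom M w t gam).

(* Q(theta, g) is a genuine expectation wherever it is used. *)
Definition Q_well_defined (Gn : nat -> set nuis) : Prop :=
  forall n (theta : 'rV[R]_(p n)) g r, Gn n g -> 0 <= r <= 1 ->
    P.-integrable [set: Omega]
      (EFin \o (fun o => lossat theta (gpath g r) (Wv o))).

Definition monotone_moment : Prop :=
  forall w gam, domW M w -> domG M gam ->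
    {homo (fun t => mom M w t gam) : s t / s <= t}.

Definition Sigma n : 'M[R]_(p n) :=
  \matrix_(i, j) fine 'E_P[(fun o => Lam M n (Z o) (g0 M (Z o)) ord0 i
                                     * Lam M n (Z o) (g0 M (Z o)) ord0 j)].

Definition identification (Cmin : R) : Prop :=
  0 < Cmin /\ forall n a, eigenvalue (Sigma n) a -> Cmin <= a.

Definition restricted_curvature (Bmin : R) : Prop :=
  [/\ 0 < Bmin,
      forall n theta w, cone_segments (theta0 M n) theta ->
        domW M w -> suppZ (zpart w) ->
        derivable (fun t => mom M w t (g0 M (zpart w)))
          (lin_index theta (g0 M) (zpart w)) 1
    & forall n z, suppZ z ->
        (Bmin%:E <= ereal_inf
           [set \int[kappa M z]_w
                  (mom_t w (lin_index theta (g0 M) z) (g0 M z))%:E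
           | theta in cone_segments (theta0 M n)])%E].

Definition bounded_design_sets (Gn : nat -> set nuis) : Prop :=
  [/\ open (domW M), bounded_set (domW M), law_support P Wv `<=` domW M
    & [/\ open (domT M),
      forall n, law_support P (fun o => lin_index (theta0 M n) (g0 M) (Z o))
                `<=` domT M,
      open (domG M), bounded_set (domG M)
    & forall n g, Gn n g -> law_support P (fun o => g (Z o)) `<=` domG M]].

Definition bounded_design_mom (U : R) : Prop :=
  forall w t gam, domW M w -> domT M t -> domG M gam ->
  [/\ derivable (fun s => mom M w s gam) t 1,
      derivable (fun s => mom_t w s gam) t 1,
      forall i, pderivable (mom M w t) i gam /\ pderivable (mom_t w t) i gam,
      forall i j, pderivable (mom_g j w t) i gam
    & [/\ `|mom M w t gam| <= U,
      forall i, `|mom_g i w t gam| <= U,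
      `|mom_t w t gam| <= U,
      forall i, `|mom_gt i w t gam| <= U
    & (forall i j, `|mom_gg i j w t gam| <= U) /\ `|mom_tt w t gam| <= U]].

Definition bounded_design_Lam (U : R) : Prop :=
  forall n z gam (j : 'I_(p n)), suppZ z -> domG M gam ->
  let L := fun gam' => Lam M n z gam' ord0 j in
  [/\ forall i, pderivable L i gam,
      forall i i', pderivable (pderiv L i) i' gam
    & [/\ `|L gam| <= U,
      forall i, `|pderiv L i gam| <= U
    & forall i i', `|pderiv (pderiv L i) i' gam| <= U]].

Definition bounded_design (Gn : nat -> set nuis)
    (Theta : forall n, set 'rV[R]_(p n)) (U : R) : Prop :=
  [/\ bounded_design_sets Gn,
      forall n, Theta n (theta0 M n) /\
                (forall theta, Theta n theta -> norm1 theta <= U),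
      bounded_design_mom U
    & bounded_design_Lam U].

(* bounded_design bounds m only for t in domT and gamma in domG, but domT is
   only required to contain the index at g0.  For the L2 norm the deviation
   g - g0 need not be uniformly small, so the path from (g0, index at g0) to
   (g, index at g) is required to stay where those bounds apply.  For the sup
   norm this follows, for large n, from the other hypotheses. *)
Definition L2_paths_in_domain (Gn : nat -> set nuis) : Prop :=
  \forall n \near \oo, forall g, Gn n g ->
    {ae P, forall o, forall r, 0 <= r <= 1 ->
       domG M (gpath g r (Z o)) /\
       domT M (lin_index (theta0 M n) (gpath g r) (Z o))}.

(* The event ghat in Gn need not be measurable: its inner probability is
   bounded from below. *)
Definition first_stage_rate (N : fun_norm) (G : set nuis) (Gn : nat -> set nuis)
    d' (S : nat -> measurableType d') (V : forall n, {RV P >-> S n})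
    (ghat : forall n, S n -> nuis) (delta gn : nat -> R) : Prop :=
  [/\ delta @ \oo --> 0, gn @ \oo --> 0,
      forall n, Gn n (g0 M) /\ Gn n `<=` G,
      forall n, exists2 E : set (S n),
        measurable E /\ E `<=` [set s | Gn n (ghat n s)] &
        ((1 - delta n)%:E <= P (V n @^-1` E))%E
    & forall n g, Gn n g -> (fnorm N (g \- g0 M)%R <= (gn n)%:E)%E].

Definition B0_condition (N : fun_norm) (Gn : nat -> set nuis) (B0 : R) : Prop :=
  0 <= B0 /\ exists B : R, forall n g (j : 'I_(p n)) r,
    Gn n g -> 0 <= r < 1 ->
    let f := gradQ_path g j in
    let D := fine (fnorm N (g \- g0 M)) in
    [/\ derivable f r 1, derivable (derive1 f) r 1
      & `|derive1 f 0 + derive1n 2 f r| <= B0 * D + B * D ^+ 2].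

Definition growth (U : R) (gn : nat -> R) : Prop :=
  let k n := (sparsity n)%:R : R in
  let lg n := ln (2 * (p n)%:R) : R in
  (fun n => k n * (gn n + U ^+ 5 * k n * Num.sqrt (2 * lg n / n%:R)
                   + 3 * dG%:R * U ^+ 3 * Num.sqrt (lg n / n%:R)))
  @ \oo --> 0.

Definition penalty (C B0 : R) (gn : nat -> R) (n : nat) : R :=
  C * (Num.sqrt (ln (p n)%:R / n%:R) + B0 * gn n + gn n ^+ 2).

Definition is_lasso n (ws : nat -> 'rV[R]_dW) (g : nuis) (lam : R)
    (theta : 'rV[R]_(p n)) : Prop :=
  forall theta' : 'rV[R]_(p n),
    Qhat ws theta g + lam * norm1 theta <=
    Qhat ws theta' g + lam * norm1 theta'.

(* Excludes two degenerate regimes in which the rate vanishes while the error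
   does not: log p = 0, and theta0 = 0 with p bounded. *)
Definition nondegenerate_rates : Prop :=
  (\forall n \near \oo, (1 < p n)%N) /\
  (forall b : nat, \forall n \near \oo,
     (0 < sparsity n)%N \/ (b <= p n)%N).

End Model.

Arguments Q_well_defined {d Omega R P} M Gn.
Arguments bounded_design {d Omega R P} M Gn Theta U.
Arguments L2_paths_in_domain {d Omega R P} M Gn.
Arguments first_stage_rate {d Omega R P} M N G Gn {d' S} V ghat delta gn.
Arguments B0_condition {d Omega R P} M N Gn B0.
Arguments is_lasso {d Omega R P} M n ws g lam theta.

(* Main.v *)
Require Import Defs.
From HB Require Import structures.
From mathcomp Require Import all_boot all_order all_algebra.
From mathcomp Require Import all_classical all_reals all_analysis.
From mathcomp Require Import measurable_realfun.
From mathcomp Require Import ring lra zify.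

Set Implicit Arguments.
Unset Strict Implicit.
Unset Printing Implicit Defensive.

Import Order.TTheory GRing.Theory Num.Theory.
Import numFieldNormedType.Exports HBNNSimple.

Local Open Scope classical_set_scope.
Local Open Scope ring_scope.

(** The estimator minimises a convex criterion: since m is non-decreasing in t, the
loss l is convex in its index argument, hence so is the empirical criterion in
theta.  Write nu for thetahat - theta0.  The usual argument for penalised
convex estimators then needs two facts, both for the estimated nuisance g.

The score is small.  The expected score E[Lambda_j m] at (theta0, g) equals the
path gradient of the population criterion at r = 1 ([gradient_is_score]).  The
design bounds make the score a C^{1,1} function of r along the segment from g0
to g, with constant proportional to the squared distance between g and g0, and
it vanishes at r = 0.  Two consequences of this second-difference control
([endpoint_bound]) trade the value at r = 1 for the first and second
derivatives at r = 0, which is exactly what the constant B0 controls; so every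
coordinate of the expected score is at most a multiple of B0 g_n + g_n^2
([score_mean]).  Conditionally on the auxiliary sample the observations are
still i.i.d., so a Hoeffding bound and a union over the p coordinates add a
multiple of sqrt(log p / n) ([score_event]).

The criterion is curved.  At one observation, with a the slope m_t at the
truth and x0 = Lambda(Z, g0)'nu, convexity and a Taylor expansion give
l(t + x) - l(t) - m(t) x >= (a - Bmin/2) x0^2 / 2 minus a multiple of
|nu|_1^2 min(1, |g - g0|), provided |nu|_1 is at most a fixed eta
([loss_curvature]).  On average the first part is at least a multiple of
Bmin Cmin |nu|_2^2 ([gram_mean_lower]); its fluctuation is controlled entrywise
by Hoeffding's bound, and the average of min(1, |g - g0|) by Markov's
inequality and the first-stage rate.  Both errors multiply |nu|_1^2, so they
are absorbed because |nu|_1^2 is at most a multiple of k |nu|_2^2, and the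
growth condition makes k times the errors small.

The bound |nu|_1^2 <= Q k |nu|_2^2 comes from the cone condition once
lambda/2 dominates the score, which has probability at least 1 - 2/p.  That is
only useful when p is large; when p stays below a bound depending on the
required probability, the trivial |nu|_1^2 <= p |nu|_2^2 does the same job and a
larger multiple of lambda bounds the score.  Rescaling nu onto a sphere of
radius proportional to sqrt k lambda, inside the region |nu|_1 <= eta, then
gives the rates ([lasso_error]).  If k = 0 the cone condition alone forces
nu = 0.

The derivative bounds on m hold for indices in the open set domT.  It contains
the support of the index at the truth for every n, but a distance from its
complement that does not depend on n needs an argument: the restricted
curvature identifies the index from the conditional moment, so it is
almost surely the same for all n ([ae_index_const]); its support is therefore
one compact subset of domT and keeps a fixed distance eta from the complement
([good_margin]). *)

(** * From local to global estimates on an interval *)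

Section RealAnalysis.
Context {R : realType}.

Lemma itv_continuous_of_bound (f : R -> R) (a b : R) :
  (forall r, a <= r <= b -> exists2 e, 0 < e & exists L, forall s,
     a <= s <= b -> `|s - r| < e -> `|f s - f r| <= L * `|s - r|) ->
  {within `[a, b], continuous f}.
Proof.
move=> H; apply/subspace_continuousP => r /=; rewrite in_itv /= => rab.
have [e e0 [L HL]] := H r rab.
apply/cvgrPdist_le => eps eps0.
have L0 : 0 < `|L| + 1 by rewrite ltr_wpDl.
pose dl := Num.min e (eps / (`|L| + 1)).
have dl0 : 0 < dl by rewrite lt_min e0 divr_gt0.
apply/nbhs_ballP; exists dl => //= s.
rewrite /ball /= => rs; rewrite in_itv /= => sab.
rewrite distrC in rs; rewrite lt_min in rs; case/andP: rs => rs1 rs2.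
rewrite distrC; apply: le_trans (HL s sab rs1) _.
rewrite ltr_pdivlMr // in rs2.
have := ler_norm L; have := normr_ge0 (s - r); nra.
Qed.

(** The slack L' > L makes e (f s - f a) - L' (s - a) locally decreasing to the
    right of every point, so its maximum over the interval sits at a. *)
Lemma local_lipschitz (f : R -> R) (L a b : R) : a <= b ->
  (forall r, a <= r <= b -> exists2 e, 0 < e & forall s,
     a <= s <= b -> `|s - r| < e -> `|f s - f r| <= L * `|s - r|) ->
  `|f b - f a| <= L * (b - a).
Proof.
move=> ab H.
have key (e : R) : `|e| = 1 -> e * (f b - f a) <= L * (b - a).
  move=> e1; apply/ler_addgt0Pl => eps eps0.
  pose L' := L + eps / (b - a + 1).
  have ba0 : 0 < b - a + 1 by lra.
  have LL : L < L' by rewrite ltrDl divr_gt0.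
  pose u s := e * (f s - f a) - L' * (s - a).
  have [|c] := @EVT_max R u a b ab.
    apply: itv_continuous_of_bound => r rab.
    have [dl dl0 Hd] := H r rab; exists dl => //; exists (L + `|L'|) => s sab sr.
    have -> : u s - u r = e * (f s - f r) - L' * (s - r) by rewrite /u; ring.
    apply: le_trans (ler_normB _ _) _; rewrite !normrM e1 mul1r mulrDl lerD2r.
    exact: Hd.
  rewrite in_itv /= => cab cmax.
  have [ca|ca] := eqVneq c a.
    have := cmax b; rewrite in_itv /= ab lexx => /(_ isT).
    rewrite ca {2}/u !subrr !mulr0 subr0 /u => h.
    apply: (@le_trans _ _ (L' * (b - a))); first by lra.
    rewrite /L' mulrDl addrC lerD2r mulrAC ler_pdivrMr //; nra.
  have ac : a < c by case/andP: cab => h _; rewrite lt_neqAle eq_sym ca.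
  (* A point slightly to the left of the maximiser c contradicts maximality. *)
  have [dl dl0 Hd] := H c cab.
  pose s := c - Num.min (dl / 2) (c - a).
  have mn : 0 < Num.min (dl / 2) (c - a) by rewrite lt_min divr_gt0 //= subr_gt0.
  have m1 : Num.min (dl / 2) (c - a) <= dl / 2 by rewrite ge_min lexx.
  have m2 : Num.min (dl / 2) (c - a) <= c - a by rewrite ge_min lexx orbT.
  case/andP: cab => ac' cb.
  have sab : a <= s <= b by rewrite /s; apply/andP; split; lra.
  have sc : `|s - c| < dl.
    by rewrite /s ltr_norml; apply/andP; split; lra.
  have := Hd s sab sc.
  have := cmax s; rewrite in_itv /= sab => /(_ isT).
  have E : u s - u c = e * (f s - f c) - L' * (s - c) by rewrite /u; ring.
  have : `|e * (f s - f c)| = `|f s - f c| by rewrite normrM e1 mul1r.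
  have : `|s - c| = c - s by rewrite distrC ger0_norm // /s; lra.
  move=> -> E2 h1 h2; rewrite -E2 ler_norml in h2; case/andP: h2 => h2 _.
  have cs : 0 < c - s by rewrite /s; lra.
  have : (L' - L) * (c - s) <= 0 by nra.
  by rewrite pmulr_lle0 // subr_le0 leNgt LL.
have := key 1 (normr1 _); rewrite mul1r => h1.
have := key (-1) ltac:(by rewrite normrN normr1); rewrite mulN1r => h2.
by rewrite ler_norml; apply/andP; split; lra.
Qed.

(** Subtracting the chord and L x (1 - x) with L > K leaves a function whose second
    differences are positive near every interior point; such a function has no interior
    maximum, and it vanishes at both ends.  The slope a may depend on the point in an
    arbitrary way. *)
Lemma second_difference (f : R -> R) (K : R) : 0 <= K ->
  (forall r, 0 <= r <= 1 -> exists2 e, 0 < e & exists a, forall s,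
     0 <= s <= 1 -> `|s - r| < e -> `|f s - f r - a * (s - r)| <= K * (s - r) ^+ 2) ->
  forall x, 0 <= x <= 1 ->
  `|f x - (1 - x) * f 0 - x * f 1| <= K * (x * (1 - x)).
Proof.
move=> K0 H.
have key (e : R) : `|e| = 1 -> forall x, 0 <= x <= 1 ->
    e * (f x - (1 - x) * f 0 - x * f 1) <= K * (x * (1 - x)).
  move=> e1 x x01; apply/ler_addgt0Pl => eps eps0.
  (* The strict inequality K < L is what excludes an interior maximum. *)
  pose L := K + eps.
  pose u s := e * (f s - (1 - s) * f 0 - s * f 1) - L * (s * (1 - s)).
  have [|c] := @EVT_max R u 0 1 ler01.
    apply: itv_continuous_of_bound => r rab.
    have [dl dl0 [a Hd]] := H r rab; exists (Num.min dl 1); first by rewrite lt_min dl0 /=.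
    exists (K + `|a| + `|f 0 - f 1| + L) => s sab; rewrite lt_min => /andP[sr sr1].
    have -> : u s - u r = e * ((f s - f r - a * (s - r)) + a * (s - r) + (f 0 - f 1) * (s - r))
        - L * ((s - r) * (1 - s - r)) by rewrite /u; ring.
    apply: le_trans (ler_normB _ _) _; rewrite !normrM e1 mul1r.
    apply: (@le_trans _ _ (K * `|s - r| + `|a| * `|s - r| + `|f 0 - f 1| * `|s - r| + `|L| * (`|s - r| * 1))).
      apply: lerD.
        apply: le_trans (ler_normD _ _) _; rewrite normrM lerD2r.
        apply: le_trans (ler_normD _ _) _; rewrite normrM lerD2r.
        apply: le_trans (Hd s sab sr) _; rewrite ler_wpM2l // -real_normK ?num_real //.
        by rewrite expr2 ler_piMl // ltW.
      do 2![apply: ler_wpM2l => //]; case/andP: sab rab => ? ? /andP[? ?].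
      by rewrite ler_norml; apply/andP; split; lra.
    rewrite (@ger0_norm _ L) ?addr_ge0 ?(ltW eps0) //; lra.
  rewrite in_itv /= => cab cmax.
  have uc0 : u c <= 0.
    have [c0|c0] := eqVneq c 0; first by rewrite c0 /u; lra.
    have [c1|c1] := eqVneq c 1; first by rewrite c1 /u; lra.
    case/andP: (cab) => c0' c1'.
    have {}c0 : 0 < c by rewrite lt_neqAle eq_sym c0.
    have {}c1 : c < 1 by rewrite lt_neqAle c1.
    have [dl dl0 [a Hd]] := H c cab.
    (* A symmetric step around the maximiser that stays in [0, 1]. *)
    pose h := Num.min (dl / 2) (Num.min c (1 - c)).
    have h0 : 0 < h by rewrite !lt_min divr_gt0 //= c0 subr_gt0.
    have h1 : h <= dl / 2 by rewrite /h ge_min lexx.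
    have h2 : h <= c by rewrite /h ge_min [X in _ || X]ge_min lexx orbT.
    have h3 : h <= 1 - c by rewrite /h ge_min [X in _ || X]ge_min lexx !orbT.
    have p01 : 0 <= c + h <= 1 by apply/andP; split; lra.
    have m01 : 0 <= c - h <= 1 by apply/andP; split; lra.
    have := Hd _ p01; have := Hd _ m01.
    rewrite (_ : c - h - c = - h); last by ring.
    rewrite (_ : c + h - c = h); last by ring.
    rewrite normrN ger0_norm ?(ltW h0) // => /(_ ltac:(lra)) Hm /(_ ltac:(lra)) Hp.
    have := cmax (c + h); rewrite in_itv /= p01 => /(_ isT) up.
    have := cmax (c - h); rewrite in_itv /= m01 => /(_ isT) um.
    pose A := f (c - h) - f c - a * - h; pose B := f (c + h) - f c - a * h.
    have E : u (c + h) + u (c - h) - 2 * u c = e * (A + B) + 2 * L * h ^+ 2.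
      by rewrite /u /A /B; ring.
    have E2 : `|e * (A + B)| <= 2 * K * h ^+ 2.
      rewrite normrM e1 mul1r; apply: le_trans (ler_normD _ _) _.
      by rewrite /A /B; move: Hm Hp; rewrite sqrrN; lra.
    have h20 : 0 < h ^+ 2 by rewrite exprn_gt0.
    rewrite ler_norml in E2; case/andP: E2 => E2 _.
    have : eps * h ^+ 2 <= 0 by rewrite /L in E; nra.
    by rewrite pmulr_lle0 // leNgt eps0.
  have := cmax x; rewrite in_itv /= x01 => /(_ isT) ux.
  have : u x <= 0 by apply: le_trans ux uc0.
  case/andP: x01 => x0 x1.
  have : x * (1 - x) <= 1 by nra.
  have : 0 <= x * (1 - x) by apply: mulr_ge0; lra.
  by rewrite /u /L; nra.
move=> x x01.
have := key 1 (normr1 _) x x01; rewrite mul1r => h1.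
have := key (-1) ltac:(by rewrite normrN normr1) x x01; rewrite mulN1r => h2.
by rewrite ler_norml; apply/andP; split; lra.
Qed.

(** The mean value theorem without an order between the endpoints, as increments of
    the index have no sign. *)
Lemma mvt_between (f df : R -> R) (a b : R) :
  (forall x, Num.min a b <= x <= Num.max a b -> is_derive x 1 f (df x)) ->
  exists2 c, Num.min a b <= c <= Num.max a b & f b - f a = df c * (b - a).
Proof.
wlog ab : a b / a <= b.
  move=> W; case/orP: (le_total a b) => [ab|ba]; first exact: W.
  rewrite minC maxC => H; have [c cab E] := W b a ba H; exists c => //.
  by rewrite -[LHS]opprB E -mulrN opprB.
rewrite (min_idPl ab) (max_idPr ab) => H.
have [||c] := @MVT_segment R f df a b ab.
- by move=> x; rewrite in_itv /= => /andP[ax xb]; apply: H; rewrite !ltW.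
- apply: derivable_within_continuous => x; rewrite in_itv /= => xab.
  by case: (H x xab).
by rewrite in_itv /= => cab E; exists c.
Qed.

End RealAnalysis.

(** * Increments controlled by partial derivatives *)

Section Vec.
Context {R : realType} {n : nat}.
Implicit Types x y z v : 'rV[R]_n.

Lemma norm1_ge0 v : 0 <= norm1 v.
Proof. exact: sumr_ge0. Qed.

Lemma norm1_coord v j : `|v ord0 j| <= norm1 v.
Proof. by rewrite /norm1 (bigD1 j) //= lerDl sumr_ge0. Qed.

Lemma norm1Z (a : R) v : norm1 (a *: v) = `|a| * norm1 v.
Proof. by rewrite /norm1 mulr_sumr; apply: eq_bigr => j _; rewrite !mxE normrM. Qed.

Lemma norm1N v : norm1 (- v) = norm1 v.
Proof. by rewrite -scaleN1r norm1Z normrN normr1 mul1r. Qed.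

Lemma norm1D u v : norm1 (u + v) <= norm1 u + norm1 v.
Proof. by rewrite /norm1 -big_split; apply: ler_sum => j _; rewrite mxE; exact: ler_normD. Qed.

Lemma dotv_bound (u v : 'rV[R]_n) c : (forall j, `|u ord0 j| <= c) ->
  `|dotv u v| <= c * norm1 v.
Proof.
move=> uc; apply: le_trans (ler_norm_sum _ _ _) _; rewrite /norm1 mulr_sumr.
by apply: ler_sum => j _; rewrite normrM ler_wpM2r.
Qed.

Lemma dotvDr (u v w : 'rV[R]_n) : dotv u (v + w) = dotv u v + dotv u w.
Proof. by rewrite /dotv -big_split; apply: eq_bigr => j _; rewrite mxE mulrDr. Qed.

Lemma dotvZr (u v : 'rV[R]_n) a : dotv u (a *: v) = a * dotv u v.
Proof. by rewrite /dotv mulr_sumr; apply: eq_bigr => j _; rewrite mxE mulrCA. Qed.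

Lemma dotvBl (u v w : 'rV[R]_n) : dotv (u - v) w = dotv u w - dotv v w.
Proof.
rewrite /dotv -sumrB; apply: eq_bigr => j _; by rewrite !mxE mulrBl.
Qed.

Lemma dotv_delta (u : 'rV[R]_n) j : dotv u (delta_mx ord0 j) = u ord0 j.
Proof.
rewrite /dotv (bigD1 j) //= mxE !eqxx mulr1 big1 ?addr0 // => i ij.
by rewrite mxE (negbTE ij) andbF mulr0.
Qed.

(** The box spanned by x and y, rather than the segment: moving from x to y one
    coordinate at a time stays in the box, where bounds on partial derivatives apply. *)
Definition hull x y : set 'rV[R]_n := [set z | forall i,
  Num.min (x ord0 i) (y ord0 i) <= z ord0 i <= Num.max (x ord0 i) (y ord0 i)].

Lemma hull_l x y : hull x y x.
Proof. by move=> i; rewrite ge_min lexx le_max lexx. Qed.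

Lemma hull_r x y : hull x y y.
Proof. by move=> i; rewrite ge_min lexx orbT le_max lexx orbT. Qed.

Lemma hull_trans x y z : hull x y z -> hull x z `<=` hull x y.
Proof.
move=> h w wz i; have := h i; have := wz i.
rewrite !ge_min !le_max => /andP[/orP a1 /orP a2] /andP[/orP b1 /orP b2].
apply/andP; split; apply/orP.
  by case: a1 => a1; [left|case: b1 => b1; [left|right]; apply: le_trans a1].
by case: a2 => a2; [left|case: b2 => b2; [left|right]; apply: le_trans b2].
Qed.

Lemma hull_norm1 x y z : hull x y z -> norm1 (z - x) <= norm1 (y - x).
Proof.
move=> h; apply: ler_sum => i _; have := h i; rewrite !mxE.
by case: (leP (x ord0 i) (y ord0 i)) => xy /andP[a b]; [rewrite !ger0_norm; lra|rewrite !ler0_norm; lra].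
Qed.

Lemma hull_ball x y z e : 0 < e -> norm1 (y - x) < e -> hull x y z -> ball x e z.
Proof.
move=> e0 xye /hull_norm1 h.
suff H j : `|x ord0 j - z ord0 j| < e by split => // i j; rewrite ord1; exact: H.
apply: le_lt_trans xye; rewrite distrC; apply: le_trans h.
by have := norm1_coord (z - x) j; rewrite !mxE.
Qed.

Lemma is_derive_line (f : 'rV[R]_n -> R) x v (s : R) : derivable f (x + s *: v) v ->
  is_derive s 1 (fun r => f (x + r *: v)) ('D_v f (x + s *: v)).
Proof.
move=> df.
have E : (fun h : R => h^-1 *: (((fun r => f (x + r *: v)) \o shift s) (h *: 1) - f (x + s *: v))) =
         (fun h => h^-1 *: ((f \o shift (x + s *: v)) (h *: v) - f (x + s *: v))).
  apply/funext => h; congr (_ *: (_ - _)) => /=; congr f.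
  by rewrite -[h *: 1]/(h * 1) mulr1 scalerDl addrCA.
by split; rewrite /derivable /derive E.
Qed.

(** Telescope over the path that changes one coordinate at a time, and apply the
    mean value theorem to each step. *)
Lemma hull_expand (f : 'rV[R]_n -> R) (a : 'I_n -> R) (e : R) x y :
  (forall z, hull x y z -> forall i, pderivable f i z /\ `|pderiv f i z - a i| <= e) ->
  `|f y - f x - \sum_i a i * (y - x) ord0 i| <= e * norm1 (y - x).
Proof.
move=> H.
(* The first k coordinates have been moved from x to y. *)
pose z (k : nat) : 'rV[R]_n := \row_j (if (j < k)%N then y ord0 j else x ord0 j).
have z0 : z 0%N = x by apply/rowP => j; rewrite mxE.
have zn : z n = y by apply/rowP => j; rewrite mxE ltn_ord.
have zS (k : 'I_n) : z k.+1 = z k + (y - x) ord0 k *: delta_mx ord0 k.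
  apply/rowP => j; rewrite !mxE eqxx /=.
  have [->|jk] := eqVneq j k; first by rewrite ltnS leqnn ltnn mulr1 addrC subrK.
  rewrite mulr0 addr0 ltnS leq_eqVlt.
  by rewrite -[X in X || _]/(j == k) (negbTE jk).
have E : f y - f x = \sum_(k < n) (f (z k.+1) - f (z k)).
  by rewrite -{1}zn -{1}z0 -(telescope_sumr (fun k => f (z k)) (leq0n n)) big_mkord.
rewrite E -sumrB; apply: le_trans (ler_norm_sum _ _ _) _.
rewrite /norm1 mulr_sumr; apply: ler_sum => k _.
pose h := (y - x) ord0 k.
have zh (s : R) : Num.min 0 h <= s <= Num.max 0 h -> hull x y (z k + s *: delta_mx ord0 k).
  move=> sh i; rewrite !mxE eqxx /=.
  have [->|ik] := eqVneq i k; last first.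
    by rewrite mulr0 addr0; case: ifP => _; [exact: hull_r|exact: hull_l].
  rewrite ltnn mulr1; move: sh; rewrite /h !mxE.
  by case: (leP (x ord0 k) (y ord0 k)) => xy; case: (leP 0 _) => ? /andP[? ?]; lra.
have [|c cI Ec] := @mvt_between R (fun s => f (z k + s *: delta_mx ord0 k))
  (fun s => pderiv f k (z k + s *: delta_mx ord0 k)) 0 h.
  by move=> s sI; apply: is_derive_line; have [] := H _ (zh s sI) k.
move: Ec; rewrite scale0r addr0 subr0 -zS => ->.
rewrite -/h -mulrBl normrM ler_wpM2r //.
by have [] := H _ (zh c cI) k.
Qed.

Lemma hull_lipschitz (f : 'rV[R]_n -> R) (U : R) x y :
  (forall z, hull x y z -> forall i, pderivable f i z /\ `|pderiv f i z| <= U) ->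
  `|f y - f x| <= U * norm1 (y - x).
Proof.
move=> H; have := @hull_expand f (fun _ => 0) U x y.
rewrite [\sum_i _]big1 ?subr0; last by move=> i _; rewrite mul0r.
by apply => z zh i; rewrite subr0; exact: H.
Qed.

Lemma hull_taylor (f : 'rV[R]_n -> R) (U : R) x y : 0 <= U ->
  (forall z, hull x y z -> forall i, pderivable f i z) ->
  (forall z, hull x y z -> forall i j, pderivable (pderiv f i) j z /\ `|pderiv (pderiv f i) j z| <= U) ->
  `|f y - f x - \sum_i pderiv f i x * (y - x) ord0 i| <= U * norm1 (y - x) ^+ 2.
Proof.
move=> U0 H1 H2; rewrite expr2 mulrA; apply: hull_expand => z zh i; split; first exact: H1.
apply: le_trans (@hull_lipschitz _ U x z _) _.
  by move=> w wz j; apply: H2; apply: hull_trans wz.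
by rewrite ler_wpM2l // hull_norm1.
Qed.

End Vec.

Section Joint.
Context {R : realType} {n : nat}.
Variables (m : R -> 'rV[R]_n -> R) (U : R).
Let mt t g := derive1 (fun s => m s g) t.
Variables (t t' : R) (g g' : 'rV[R]_n).
Hypothesis U0 : 0 <= U.
Let inI s := Num.min t t' <= s <= Num.max t t'.
Hypothesis Hdt : forall s w, inI s -> hull g g' w -> derivable (fun s => m s w) s 1.
Hypothesis Hdtt : forall s w, inI s -> hull g g' w ->
  derivable (fun s => mt s w) s 1 /\ `|derive1 (fun s => mt s w) s| <= U.
Hypothesis Hdg : forall s w i, inI s -> hull g g' w ->
  pderivable (m s) i w /\ `|pderiv (m s) i w| <= U.
Hypothesis Hdgt : forall s w i, inI s -> hull g g' w ->
  pderivable (mt s) i w /\ `|pderiv (mt s) i w| <= U.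
Hypothesis Hdgg : forall s w i j, inI s -> hull g g' w ->
  pderivable (pderiv (m s) i) j w /\ `|pderiv (pderiv (m s) i) j w| <= U.
Hypothesis Hbt : forall s w, inI s -> hull g g' w -> `|mt s w| <= U.

Lemma inI_l : inI t. Proof. by rewrite /inI ge_min le_max lexx. Qed.
Lemma inI_r : inI t'. Proof. by rewrite /inI ge_min le_max lexx !orbT. Qed.

Lemma inI_le s : inI s -> `|s - t| <= `|t' - t|.
Proof.
rewrite /inI; case: (leP t t') => tt /andP[a b].
  by rewrite !ger0_norm; lra.
by rewrite !ler0_norm; lra.
Qed.

Lemma inI_sub s s' : inI s -> Num.min t s <= s' <= Num.max t s -> inI s'.
Proof.
rewrite /inI; case: (leP t t') => tt /andP[a b]; case: (leP t s) => ts /andP[c e]; lra.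
Qed.

Lemma joint_mt_lipschitz s : inI s ->
  `|mt s g' - mt t g| <= U * (`|s - t| + norm1 (g' - g)).
Proof.
move=> sI.
have -> : mt s g' - mt t g = (mt s g' - mt t g') + (mt t g' - mt t g) by ring.
apply: le_trans (ler_normD _ _) _; rewrite mulrDr; apply: lerD.
  have [|c cI ->] := @mvt_between R (fun s => mt s g') (fun s => derive1 (fun s => mt s g') s) t s.
    move=> r rI; rewrite derive1E; apply: derivableP.
    by have [] := Hdtt (inI_sub sI rI) (hull_r g g').
  rewrite normrM ler_wpM2r //.
  by have [] := Hdtt (inI_sub sI cI) (hull_r g g').
by apply: hull_lipschitz => z zh i; apply: Hdgt => //; exact: inI_l.
Qed.

Lemma joint_lipschitz : `|m t' g' - m t g| <= U * (`|t' - t| + norm1 (g' - g)).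
Proof.
have -> : m t' g' - m t g = (m t' g' - m t g') + (m t g' - m t g) by ring.
apply: le_trans (ler_normD _ _) _; rewrite mulrDr; apply: lerD.
  have [|c cI ->] := @mvt_between R (fun s => m s g') (fun s => mt s g') t t'.
    move=> r rI; rewrite /mt derive1E; apply: derivableP.
    by apply: Hdt => //; exact: hull_r.
  by rewrite normrM ler_wpM2r // Hbt //; exact: hull_r.
by apply: hull_lipschitz => z zh i; apply: Hdg => //; exact: inI_l.
Qed.

(** Expand in t at fixed g', then in g at fixed t; m_t at the intermediate point is
    compared with m_t at (t, g) through the bounds on m_tt and on the mixed derivatives. *)
Lemma joint_taylor :
  `|m t' g' - m t g - (mt t g * (t' - t) + \sum_i pderiv (m t) i g * (g' - g) ord0 i)|
    <= U * (`|t' - t| + norm1 (g' - g)) ^+ 2.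
Proof.
have [|c cI E] := @mvt_between R (fun s => m s g') (fun s => mt s g') t t'.
  move=> r rI; rewrite /mt derive1E; apply: derivableP.
  by apply: Hdt => //; exact: hull_r.
have -> : m t' g' - m t g - (mt t g * (t' - t) + \sum_i pderiv (m t) i g * (g' - g) ord0 i) =
  (mt c g' - mt t g) * (t' - t) + (m t g' - m t g - \sum_i pderiv (m t) i g * (g' - g) ord0 i).
  by rewrite mulrBl -E; ring.
apply: le_trans (ler_normD _ _) _; rewrite normrM.
have h1 : `|mt c g' - mt t g| <= U * (`|t' - t| + norm1 (g' - g)).
  apply: le_trans (joint_mt_lipschitz cI) _.
  by rewrite ler_wpM2l // lerD2r inI_le.
have h2 : `|m t g' - m t g - \sum_i pderiv (m t) i g * (g' - g) ord0 i| <= U * norm1 (g' - g) ^+ 2.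
  apply: hull_taylor => // z zh i; [|move=> j].
    by have [] := Hdg i inI_l zh.
  by apply: Hdgg => //; exact: inI_l.
apply: le_trans (lerD (ler_wpM2r (normr_ge0 _) h1) h2) _.
have := normr_ge0 (t' - t); have := norm1_ge0 (g' - g); set a := `|_|; set b := norm1 _ => b0 a0.
rewrite -mulrA -mulrDr ler_wpM2l //.
have ab : 0 <= a * b by exact: mulr_ge0.
rewrite !expr2; lra.
Qed.

End Joint.

(** * Endpoint derivatives from second differences *)

Section OneSided.
Context {R : realType}.

Lemma derive_quotient (f : R -> R) (x : R) : derivable f x 1 ->
  forall e, 0 < e -> exists2 dl, 0 < dl & forall h, `|h| < dl -> h != 0 ->
    `|f (x + h) - f x - derive1 f x * h| <= e * `|h|.
Proof.
move=> df e e0.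
have dfc : h^-1 *: ((f \o shift x) (h *: 1) - f x) @[h --> 0^'] --> derive1 f x.
  by rewrite derive1E; exact: df.
have /cvgrPdist_le /(_ e e0) := dfc.
move=> /nbhs_ballP[dl /= dl0 H]; exists dl => // h hdl h0.
have := H h; rewrite /ball /= sub0r normrN => /(_ hdl h0).
rewrite /= -[h *: 1]/(h * 1) mulr1.
rewrite [h + x]addrC.
have -> : f (x + h) - f x - derive1 f x * h = - (derive1 f x - h^-1 *: (f (x + h) - f x)) * h.
  by rewrite -[h^-1 *: _]/(h^-1 * _); field.
by rewrite normrM normrN => ?; rewrite ler_wpM2r.
Qed.

(** The chord bound says that every difference quotient at 0 is within K of c. *)
Lemma right_slope_bound (f : R -> R) (c K : R) : derivable f 0 1 -> f 0 = 0 ->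
  (forall x, 0 < x < 1 -> `|f x - x * c| <= K * x) -> `|derive1 f 0 - c| <= K.
Proof.
move=> df f0 H; apply/ler_addgt0Pl => e e0.
have [dl dl0 Hd] := derive_quotient df e0.
pose h := Num.min (dl / 2) (2^-1 : R).
have h0 : 0 < h by rewrite lt_min divr_gt0 //= invr_gt0.
have h1 : h <= dl / 2 by rewrite /h ge_min lexx.
have h2 : h <= 2^-1 by rewrite /h ge_min lexx orbT.
have := Hd h; rewrite add0r f0 subr0 ger0_norm ?(ltW h0) // gt_eqF // => /(_ ltac:(lra) isT) A.
have := H h ltac:(by apply/andP; split => //; lra) => B.
rewrite -(ler_pM2r h0) -{1}(ger0_norm (ltW h0)) -normrM.
have -> : (derive1 f 0 - c) * h = (f h - h * c) - (f h - derive1 f 0 * h) by ring.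
apply: le_trans (ler_normB _ _) _; lra.
Qed.

(** After subtracting its second-order Taylor polynomial, f is o(h^2) at 0 from the
    right, and for the polynomial f(h/2) - f(h)/2 is exactly -f''(0) h^2 / 8.  Only
    one-sided information at 0 enters, because the path condition stops at r = 0. *)
Lemma second_derivative_bound (f : R -> R) (K : R) :
  (forall r, 0 <= r < 1 -> derivable f r 1) -> derivable (derive1 f) 0 1 -> f 0 = 0 ->
  (forall h, 0 < h < 1 -> `|f (h / 2) - f h / 2| <= K * h ^+ 2 / 4) ->
  `|derive1 (derive1 f) 0| <= 2 * K.
Proof.
move=> df ddf f0 H; apply/ler_addgt0Pl => e e0.
pose a := derive1 f 0; pose b := derive1 (derive1 f) 0.
have e60 : 0 < e / 6 by rewrite divr_gt0.
have [dl dl0 Hd] := derive_quotient ddf e60.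
(* The Taylor remainder; its derivative is small compared with s near 0. *)
pose v s := f s - (a * s + b / 2 * s ^+ 2).
have v0 : v 0 = 0 by rewrite /v f0; ring.
have vb h : 0 < h -> h < dl -> h < 1 -> `|v h| <= e / 6 * h ^+ 2.
  move=> h0 hd h1.
  have [|c] := @mvt_between R v (fun s => derive1 f s - (a + b * s)) 0 h.
    rewrite (min_idPl (ltW h0)) (max_idPr (ltW h0)) => x /andP[x0 xh].
    have dfx : derivable f x 1 by apply: df; apply/andP; split => //; lra.
    have dx : is_derive x 1 f (derive1 f x) by rewrite derive1E; exact: derivableP.
    have da : is_derive x 1 (a \*: (id : R -> R)) (a *: 1) by exact: is_deriveZ.
    have dx2 : is_derive x 1 ((id : R -> R) ^+ 2) ((2%:R * x ^+ 1) *: 1) by exact: is_deriveX.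
    have db : is_derive x 1 ((b / 2) \*: ((id : R -> R) ^+ 2)) ((b / 2) *: ((2%:R * x ^+ 1) *: 1)) by exact: is_deriveZ.
    have dd := is_deriveB dx (is_deriveD da db).
    have -> : derive1 f x - (a + b * x) = derive1 f x - (a *: 1 + (b / 2) *: ((2%:R * x ^+ 1) *: 1)).
      rewrite -[a *: 1]/(a * 1) -[_ *: (_ *: 1)]/(b / 2 * ((2%:R * x ^+ 1) * 1)) expr1; by field.
    have -> : v = f - (a \*: (id : R -> R) + (b / 2) \*: ((id : R -> R) ^+ 2)); last exact: dd.
    by apply/funext => s; rewrite /v.
  rewrite (min_idPl (ltW h0)) (max_idPr (ltW h0)) v0 !subr0 => /andP[c0 ch] ->.
  rewrite normrM (ger0_norm (ltW h0)) expr2 mulrA ler_wpM2r ?(ltW h0) //.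
  have [->|cn] := eqVneq c 0.
    by rewrite /a mulr0 addr0 subrr normr0 mulr_ge0 // ltW.
  have := Hd c; rewrite add0r (ger0_norm c0) cn => /(_ ltac:(lra) isT).
  rewrite -/a -/b opprD addrA => /le_trans; apply.
  by rewrite ler_wpM2l // ltW.
pose h := Num.min (dl / 2) (2^-1 : R).
have h0 : 0 < h by rewrite lt_min divr_gt0 //= invr_gt0.
have h1 : h <= dl / 2 by rewrite /h ge_min lexx.
have h2 : h <= 2^-1 by rewrite /h ge_min lexx orbT.
have A := vb h h0 ltac:(lra) ltac:(lra).
have B := vb (h / 2) ltac:(lra) ltac:(lra) ltac:(lra).
have C := H h ltac:(by apply/andP; split => //; lra).
have h20 : 0 < h ^+ 2 / 8 by rewrite divr_gt0 // exprn_gt0.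
rewrite -/b -(ler_pM2r h20) -{1}(ger0_norm (ltW h20)) -normrM.
have -> : b * (h ^+ 2 / 8) = v (h / 2) - v h / 2 - (f (h / 2) - f h / 2).
  by rewrite /v; field.
apply: le_trans (ler_normB _ _) _.
apply: (@le_trans _ _ (`|v (h / 2)| + `|v h / 2| + `|f (h / 2) - f h / 2|)).
  by rewrite lerD2r; exact: ler_normB.
have -> : `|v h / 2| = `|v h| / 2 by rewrite normrM [`|2^-1|]ger0_norm // invr_ge0.
move: A B C; rewrite exprMn; lra.
Qed.

(** With c = f 1: the first hypothesis on f puts f'(0) within K of f 1, the second
    gives |f''(0)| <= 2 K, and the last one bounds their sum.  This converts a bound on the
    derivatives at 0 into a bound on the value at 1. *)
Lemma endpoint_bound (f : R -> R) (c K X : R) :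
  (forall r, 0 <= r < 1 -> derivable f r 1) -> derivable (derive1 f) 0 1 -> f 0 = 0 ->
  (forall x, 0 < x < 1 -> `|f x - x * c| <= K * x) ->
  (forall h, 0 < h < 1 -> `|f (h / 2) - f h / 2| <= K * h ^+ 2 / 4) ->
  `|derive1 f 0 + derive1 (derive1 f) 0| <= X ->
  `|c| <= X + 3 * K.
Proof.
move=> df ddf f0 H1 H2 H3.
have A := right_slope_bound (df 0 ltac:(by rewrite lexx ltr01)) f0 H1.
have B := second_derivative_bound df ddf f0 H2.
have -> : c = (derive1 f 0 + derive1 (derive1 f) 0) - derive1 (derive1 f) 0 - (derive1 f 0 - c) by ring.
apply: le_trans (ler_normB _ _) _.
have := ler_normB (derive1 f 0 + derive1 (derive1 f) 0) (derive1 (derive1 f) 0); lra.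
Qed.

End OneSided.

(** * The score along a segment of nuisance values *)

(** The second-order constant of gamma |-> Lambda_j(gamma) m(Lambda(gamma)'theta, gamma)
    when all the factors and their derivatives, and |theta|_1, are bounded by U.  The three
    summands come from expanding m, from expanding Lambda_j, and from the product of the two
    first-order increments. *)
Definition path_const {R : realType} (U : R) : R :=
  U * (U ^+ 3 + U * (U ^+ 2 + 1) ^+ 2) + U * U + U * (U * (U ^+ 2 + 1)).

Section Path.
Context {R : realType} {n p : nat}.
Variables (L : 'rV[R]_n -> 'rV[R]_p) (m : R -> 'rV[R]_n -> R) (theta : 'rV[R]_p) (U : R).
Variables (G : set 'rV[R]_n) (T : set R).
Hypothesis U0 : 0 <= U.
Hypothesis thU : norm1 theta <= U.
Hypothesis HL : forall g, G g -> forall j, let l := fun g => L g ord0 j in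
  [/\ forall i, pderivable l i g, forall i i', pderivable (pderiv l i) i' g
    & [/\ `|l g| <= U, forall i, `|pderiv l i g| <= U
    & forall i i', `|pderiv (pderiv l i) i' g| <= U]].

Lemma L_lip j g g' : hull g g' `<=` G -> `|L g' ord0 j - L g ord0 j| <= U * norm1 (g' - g).
Proof.
move=> hG; apply: (@hull_lipschitz _ _ (fun g => L g ord0 j)) => z /hG zG i.
by have [h1 _ [_ h2 _]] := HL zG j.
Qed.

Lemma L_taylor j g g' : hull g g' `<=` G ->
  `|L g' ord0 j - L g ord0 j - \sum_i pderiv (fun g => L g ord0 j) i g * (g' - g) ord0 i|
  <= U * norm1 (g' - g) ^+ 2.
Proof.
move=> hG; apply: (@hull_taylor _ _ (fun g => L g ord0 j)) => // z /hG zG i.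
  by have [h1 _ _] := HL zG j.
by move=> k; have [_ h1 [_ _ h2]] := HL zG j.
Qed.

Let tt g := dotv (L g) theta.

(** The second factor U is the bound on |theta|_1, not on a derivative. *)
Lemma index_lip g g' : hull g g' `<=` G -> `|tt g' - tt g| <= U ^+ 2 * norm1 (g' - g).
Proof.
move=> hG; rewrite /tt -dotvBl; apply: le_trans (dotv_bound _ (c := U * norm1 (g' - g)) _) _.
  by move=> j; rewrite !mxE; exact: L_lip.
have -> : U ^+ 2 * norm1 (g' - g) = U * norm1 (g' - g) * U by ring.
by rewrite ler_wpM2l // mulr_ge0 // norm1_ge0.
Qed.

Let dL j g (v : 'rV[R]_n) := \sum_i pderiv (fun g => L g ord0 j) i g * v ord0 i.

Lemma index_taylor g g' : hull g g' `<=` G ->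
  `|tt g' - tt g - \sum_j dL j g (g' - g) * theta ord0 j| <= U ^+ 2 * norm1 (g' - g) ^+ 2.
Proof.
move=> hG.
have -> : tt g' - tt g - \sum_j dL j g (g' - g) * theta ord0 j =
  \sum_j (L g' ord0 j - L g ord0 j - dL j g (g' - g)) * theta ord0 j.
  by rewrite /tt /dotv -!sumrB; apply: eq_bigr => j _; rewrite -!mulrBl.
apply: le_trans (ler_norm_sum _ _ _) _.
apply: (@le_trans _ _ (\sum_j (U * norm1 (g' - g) ^+ 2) * `|theta ord0 j|)).
  by apply: ler_sum => j _; rewrite normrM ler_wpM2r //; exact: L_taylor.
rewrite -mulr_sumr -/(norm1 theta).
have -> : U ^+ 2 * norm1 (g' - g) ^+ 2 = U * norm1 (g' - g) ^+ 2 * U by ring.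
by rewrite ler_wpM2l // mulr_ge0 // sqr_ge0.
Qed.

Let mt t g := derive1 (fun s => m s g) t.
Hypothesis Hm : forall t g, T t -> G g ->
  [/\ derivable (fun s => m s g) t 1,
      derivable (fun s => mt s g) t 1,
      forall i, pderivable (m t) i g /\ pderivable (mt t) i g,
      forall i j, pderivable (pderiv (m t) j) i g
    & [/\ `|m t g| <= U,
      forall i, `|pderiv (m t) i g| <= U,
      `|mt t g| <= U,
      forall i, `|pderiv (mt t) i g| <= U
    & (forall i j, `|pderiv (pderiv (m t) j) i g| <= U) /\ `|derive1 (fun s => mt s g) t| <= U]].

Definition inseg (t t' : R) : set R := [set s | Num.min t t' <= s <= Num.max t t'].

Lemma m_lip t t' g g' : inseg t t' `<=` T -> hull g g' `<=` G ->
  `|m t' g' - m t g| <= U * (`|t' - t| + norm1 (g' - g)).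
Proof.
move=> hT hG; apply: joint_lipschitz => //.
- by move=> s w /hT sT /hG wG; have [] := Hm sT wG.
- move=> s w i /hT sT /hG wG; have [_ _ Hd _ [_ Hb _ _ _]] := Hm sT wG.
  by split; [exact: (Hd i).1|exact: (Hb i)].
- by move=> s w /hT sT /hG wG; have [_ _ _ _ []] := Hm sT wG.
Qed.

Lemma mt_lip t t' g g' : inseg t t' `<=` T -> hull g g' `<=` G ->
  `|mt t' g' - mt t g| <= U * (`|t' - t| + norm1 (g' - g)).
Proof.
move=> hT hG; apply: (@joint_mt_lipschitz R n m U t t' g g').
- by move=> s w /hT sT /hG wG; have [_ h _ _ [_ _ _ _ []]] := Hm sT wG.
- move=> s w i /hT sT /hG wG; have [_ _ Hd _ [_ _ _ Hb _]] := Hm sT wG.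
  by split; [exact: (Hd i).2|exact: (Hb i)].
- exact: inI_r.
Qed.

Lemma m_taylor t t' g g' : inseg t t' `<=` T -> hull g g' `<=` G ->
  `|m t' g' - m t g - (mt t g * (t' - t) + \sum_i pderiv (m t) i g * (g' - g) ord0 i)|
    <= U * (`|t' - t| + norm1 (g' - g)) ^+ 2.
Proof.
move=> hT hG; apply: joint_taylor => //.
- by move=> s w /hT sT /hG wG; have [] := Hm sT wG.
- by move=> s w /hT sT /hG wG; have [_ h _ _ [_ _ _ _ []]] := Hm sT wG.
- move=> s w i /hT sT /hG wG; have [_ _ Hd _ [_ Hb _ _ _]] := Hm sT wG.
  by split; [exact: (Hd i).1|exact: (Hb i)].
- move=> s w i /hT sT /hG wG; have [_ _ Hd _ [_ _ _ Hb _]] := Hm sT wG.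
  by split; [exact: (Hd i).2|exact: (Hb i)].
- by move=> s w i j /hT sT /hG wG; have [_ _ _ h [_ _ _ _ [+ _]]] := Hm sT wG.
Qed.

Let phi j g := L g ord0 j * m (tt g) g.

Let dphi j g v := dL j g v * m (tt g) g +
  L g ord0 j * (mt (tt g) g * (\sum_k dL k g v * theta ord0 k) + \sum_i pderiv (m (tt g)) i g * v ord0 i).

(** Product rule with remainder: expand Lambda_j and m separately, then pair
    first-order increments. *)
Lemma phi_taylor j g g' : hull g g' `<=` G -> inseg (tt g) (tt g') `<=` T ->
  `|phi j g' - phi j g - dphi j g (g' - g)| <= path_const U * norm1 (g' - g) ^+ 2.
Proof.
move=> hG hT.
have D0 := norm1_ge0 (g' - g).
have gG : G g by apply: hG; exact: hull_l.
have tT : T (tt g) by apply: hT; rewrite /inseg /= ge_min le_max lexx.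
have a1 := L_lip j hG; have a2 := L_taylor j hG; have a3 := index_lip hG.
have a4 := index_taylor hG; have a5 := m_lip hT hG; have a6 := m_taylor hT hG.
have [_ _ _ _ [a7 _ a8 _ _]] := Hm tT gG.
have [_ _ [a9 _ _]] := HL gG j.
rewrite -/(dL j g (g' - g)) in a2.
move: a1 a2 a3 a4 a5 a6 a7 a8 a9; rewrite /phi /dphi.
set D := norm1 _ in D0 *; set dl := dL j g _; set dt := \sum_k _; set dm := \sum_i _.
set t := tt g; set t' := tt g'; set l := L g ord0 j; set l' := L g' ord0 j.
set M := m t g; set M' := m t' g'; set mm := mt t g.
move=> a1 a2 a3 a4 a5 a6 a7 a8 a9.
have b5 : `|M' - M| <= U * (U ^+ 2 + 1) * D.
  apply: le_trans a5 _; rewrite -mulrA ler_wpM2l // mulrDl mul1r lerD2r //.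
have b6 : `|M' - M - (mm * dt + dm)| <= (U ^+ 3 + U * (U ^+ 2 + 1) ^+ 2) * D ^+ 2.
  have -> : M' - M - (mm * dt + dm) = (M' - M - (mm * (t' - t) + dm)) + mm * (t' - t - dt) by ring.
  apply: le_trans (ler_normD _ _) _; rewrite addrC mulrDl; apply: lerD.
    rewrite normrM exprS -mulrA; apply: ler_pM => //.
  apply: le_trans a6 _; rewrite -mulrA ler_wpM2l // -exprMn ler_sqr ?nnegrE ?addr_ge0 //.
    by rewrite mulrDl mul1r lerD2r.
  by rewrite mulr_ge0 // addr_ge0 // sqr_ge0.
have -> : l' * M' - l * M - (dl * M + l * (mm * dt + dm)) =
  l * (M' - M - (mm * dt + dm)) + M * (l' - l - dl) + (l' - l) * (M' - M) by ring.
rewrite /path_const !mulrDl.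
apply: le_trans (ler_normD _ _) _; apply: lerD.
  apply: le_trans (ler_normD _ _) _; apply: lerD.
    by rewrite normrM -mulrA; apply: ler_pM.
  by rewrite normrM -mulrA; apply: ler_pM.
rewrite -mulrDl normrM.
have -> : U * (U * (U ^+ 2 + 1)) * D ^+ 2 = (U * D) * (U * (U ^+ 2 + 1) * D) by ring.
exact: ler_pM.
Qed.

Variables (g0 g1 : 'rV[R]_n).
Hypothesis oG : open G.
Hypothesis oT : open T.
Let gr (r : R) := r *: (g1 - g0) + g0.
Let D := norm1 (g1 - g0).

Lemma grB s r : gr s - gr r = (s - r) *: (g1 - g0).
Proof. by rewrite /gr opprD addrACA subrr addr0 scalerBl. Qed.

Lemma gr0 : gr 0 = g0. Proof. by rewrite /gr scale0r add0r. Qed.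
Lemma gr1 : gr 1 = g1. Proof. by rewrite /gr scale1r subrK. Qed.

(** A small box around a point of the segment stays in the open set G, whereas the box
    spanned by the two endpoints need not: this is why only local expansions are available
    along the path. *)
Lemma path_hull (r : R) : G (gr r) -> exists2 e, 0 < e & forall s, `|s - r| < e -> hull (gr r) (gr s) `<=` G.
Proof.
move=> Gr; have /nbhs_ballP[e /= e0 eG] : nbhs (gr r) G by exact: open_nbhs_nbhs.
have D0 : 0 <= D := norm1_ge0 _.
exists (e / (D + 1)); first by rewrite divr_gt0 // ltr_wpDl.
move=> s; rewrite ltr_pdivlMr ?ltr_wpDl // => sr z zh; apply: eG.
apply: hull_ball zh => //; rewrite grB norm1Z -/D.
by apply: le_lt_trans sr; rewrite ler_wpM2l // lerDl.
Qed.

Hypothesis pG : forall r, 0 <= r <= 1 -> G (gr r).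

Lemma path_index_lip : `|tt g1 - tt g0| <= U ^+ 2 * D.
Proof.
have := @local_lipschitz R (fun r => tt (gr r)) (U ^+ 2 * D) 0 1 ler01 _.
rewrite /= gr0 gr1 subr0 mulr1; apply => r r01.
have [e e0 H] := path_hull (pG r01); exists e => // s s01 sr.
apply: le_trans (index_lip (H s sr)) _.
by rewrite grB norm1Z -/D mulrCA mulrC.
Qed.

Hypothesis pT : forall r, 0 <= r <= 1 -> T (tt (gr r)).

(** The expansion [phi_taylor] holds near each point of the segment with the same
    constant, which is what [second_difference] asks for. *)
Lemma path_second_difference j x : 0 <= x <= 1 ->
  `|phi j (gr x) - (1 - x) * phi j g0 - x * phi j g1| <= path_const U * D ^+ 2 * (x * (1 - x)).
Proof.
have D0 : 0 <= D := norm1_ge0 _.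
have K0 : 0 <= path_const U.
  by rewrite /path_const !(addr_ge0, mulr_ge0, exprn_ge0, sqr_ge0).
rewrite -[in X in _ - X - _]gr0 -[in X in _ - _ - X]gr1.
apply: (@second_difference R (fun x => phi j (gr x)) (path_const U * D ^+ 2)).
  by rewrite mulr_ge0 // sqr_ge0.
move=> r r01.
have [e e0 H] := path_hull (pG r01).
have /nbhs_ballP[e' /= e'0 eT] : nbhs (tt (gr r)) T by apply: open_nbhs_nbhs; split => //; exact: pT.
have UD0 : 0 < U ^+ 2 * D + 1 by rewrite ltr_wpDl // mulr_ge0 // sqr_ge0.
exists (Num.min e (e' / (U ^+ 2 * D + 1))); first by rewrite lt_min e0 divr_gt0.
exists (dphi j (gr r) (g1 - g0)) => s s01; rewrite lt_min => /andP[sr1 sr2].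
have hG := H s sr1.
have hT : inseg (tt (gr r)) (tt (gr s)) `<=` T.
  move=> t tI; apply: eT; rewrite /ball /=; rewrite ltr_pdivlMr // in sr2.
  apply: le_lt_trans sr2; rewrite distrC; apply: (le_trans (inI_le tI)).
  apply: le_trans (index_lip hG) _.
  rewrite grB norm1Z -/D mulrDr mulr1 mulrCA lerDl //.
have := phi_taylor j hG hT.
rewrite grB norm1Z -/D.
have -> : path_const U * (`|s - r| * D) ^+ 2 = path_const U * D ^+ 2 * (s - r) ^+ 2.
  by rewrite exprMn real_normK ?num_real //; ring.
rewrite (_ : dphi j (gr r) ((s - r) *: (g1 - g0)) = dphi j (gr r) (g1 - g0) * (s - r)) //.
have dLZ k a v : dL k (gr r) (a *: v) = dL k (gr r) v * a.
  by rewrite /dL mulr_suml; apply: eq_bigr => i _; rewrite mxE mulrCA mulrC.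
rewrite /dphi dLZ.
have -> : \sum_k dL k (gr r) ((s - r) *: (g1 - g0)) * theta ord0 k =
  (\sum_k dL k (gr r) (g1 - g0) * theta ord0 k) * (s - r).
  by rewrite mulr_suml; apply: eq_bigr => k _; rewrite dLZ mulrAC.
have -> : \sum_i pderiv (m (tt (gr r))) i (gr r) * ((s - r) *: (g1 - g0)) ord0 i =
  (\sum_i pderiv (m (tt (gr r))) i (gr r) * (g1 - g0) ord0 i) * (s - r).
  by rewrite mulr_suml; apply: eq_bigr => k _; rewrite mxE mulrCA mulrC.
by ring.
Qed.

End Path.

(** * Supports of laws and Borel vectors *)

Section Support.
Context d {Omega : measurableType d} {R : realType} (P : probability Omega R).

Lemma law_support_closed (T : topologicalType) (X : Omega -> T) :
  closed (law_support P X).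
Proof.
rewrite -[law_support P X]setCK; apply: open_closedC.
rewrite openE => x nx; have /existsNP[V /not_implyP[oV /not_implyP[Vx nPV]]] := nx.
rewrite /interior nbhsE; exists V; first by split.
by move=> y Vy /(_ V oV Vy).
Qed.

(** The complement of the support is covered by the null balls centred in a
    countable dense set. *)
Lemma law_support_ae (T : normedModType R) (D : nat -> T) (X : Omega -> T) :
  (forall U, open U -> measurable (X @^-1` U)) ->
  (forall x e, 0 < e -> exists i, ball x e (D i)) ->
  {ae P, forall o, law_support P X (X o)}.
Proof.
move=> mX dD.
pose B i k := ball (D i) (k.+1%:R^-1 : R).
pose N i k : set Omega := if P (X @^-1` B i k) == 0%E then X @^-1` B i k else set0.
have nN i : P.-negligible (\bigcup_k N i k).
  apply: negligible_bigcup => k; rewrite /N; case: eqP => PB; last exact: negligible_set0.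
  exists (X @^-1` B i k); split => //; apply: mX; exact: ball_open.
apply: negligibleS (negligible_bigcup nN) => o /= /existsNP[V /not_implyP[oV /not_implyP[VX nPV]]].
have /nbhs_ballP[e /= e0 eV] : nbhs (X o) V by exact: open_nbhs_nbhs.
have e20 : 0 < e / 2 by rewrite divr_gt0.
have [k ke] : exists k : nat, k.+1%:R^-1 < e / 2.
  have := near_infty_natSinv_lt (PosNum e20) => -[k _ /(_ k)/(_ (leqnn _))] /= h.
  by exists k.
have [i Di] := dD (X o) k.+1%:R^-1 ltac:(by rewrite invr_gt0).
exists i => //; exists k => //; rewrite /N.
have PB : P (X @^-1` B i k) = 0%E.
  apply/eqP; rewrite eq_le measure_ge0 andbT.
  apply: (@le_trans _ _ (P (X @^-1` V))); last by rewrite leNgt; exact/negP.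
  apply: le_measure; rewrite ?inE; [apply: mX; exact: ball_open|exact: mX|].
  move=> o' /= Bo'; apply: eV.
  apply: (@le_ball _ _ _ (k.+1%:R^-1 + k.+1%:R^-1)).
    by rewrite (splitr e) lerD// ltW.
  exact: ball_triangle Di Bo'.
by rewrite PB eqxx /B /=; exact: ball_sym.
Qed.

End Support.

Lemma rV_ballP (R : realType) n (x y : 'rV[R]_n) e : 0 < e ->
  ball x e y <-> forall j, `|x ord0 j - y ord0 j| < e.
Proof.
move=> e0; split => [[_ h] j|h]; first exact: h.
by split => // i j; rewrite !ord1; exact: h.
Qed.

Lemma rV_dense_seq (R : realType) n : exists D : nat -> 'rV[R]_n,
  forall x e, 0 < e -> exists i, ball x e (D i).
Proof.
exists (fun i => if unpickle i is Some q then map_mx ratr (q : 'rV[rat]_n) else 0).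
move=> x e e0.
have H j : exists q : rat, `|x ord0 j - ratr q| < e.
  have [] := @dense_rat R (ball (x ord0 j) e) _ _.
  - by exists (x ord0 j); exact: ballxx.
  - exact: ball_open.
  - by move=> y [yb [q _ qy]]; exists q; rewrite qy; exact: yb.
exists (pickle (\row_j sval (cid (H j)) : 'rV[rat]_n)); rewrite pickleK.
apply/rV_ballP => // j; rewrite !mxE; exact: svalP (cid (H j)).
Qed.

Lemma R_dense_seq (R : realType) : exists D : nat -> R,
  forall x e, 0 < e -> exists i, ball x e (D i).
Proof.
have [D h] := rV_dense_seq R 1.
exists (fun i => D i ord0 ord0) => x e e0.
have [i /(rV_ballP _ _ e0)/(_ ord0)] := h (\row_j x) e e0.
by rewrite mxE => ?; exists i.
Qed.

Section MeasBvec.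
Context {R : realType}.

Lemma measurable_open_bvec n (U : set 'rV[R]_n) : open U ->
  measurable (U : set (bvec R n)).
Proof. by move=> oU; exact: sub_sigma_algebra. Qed.

Lemma continuous_bvec_measurable n (f : 'rV[R]_n -> R) :
  continuous f -> measurable_fun setT (f : bvec R n -> R).
Proof.
move=> cf; apply: (measurability _ (measurable_realfun.RGenOpens.measurableE R)).
move=> _ [_ [a [b ->] <-]]; rewrite setTI.
by apply: measurable_open_bvec; move/continuousP : cf; apply; exact: interval_open.
Qed.

Lemma coord_measurable n (j : 'I_n) :
  measurable_fun setT (fun x : bvec R n => (x : 'rV[R]_n) ord0 j).
Proof. by apply: continuous_bvec_measurable; exact: coord_continuous. Qed.

(** Open sets are countable unions of balls around a dense sequence, and balls for
    the sup norm are boxes. *)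
Lemma bvec_measurableP d (T : measurableType d) n (D : set T) (mD : measurable D) (f : T -> bvec R n) :
  (forall j, measurable_fun D (fun x => (f x : 'rV[R]_n) ord0 j)) ->
  measurable_fun D f.
Proof.
move=> mf.
apply: (@measurability _ _ _ (bvec R n) D f (@open 'rV[R]_n)); first by [].
move=> _ [U oU <-].
have [q hq] := rV_dense_seq R n.
pose B i k : set 'rV[R]_n := ball (q i) (k.+1%:R^-1 : R).
pose C i k := if `[< B i k `<=` U >] then B i k else set0.
have -> : U = \bigcup_i \bigcup_k C i k.
  apply/seteqP; split => [x Ux|x [i _ [k _]]]; last first.
    by rewrite /C; case: asboolP => // BU; exact: BU.
  have /nbhs_ballP[e /= e0 eV] : nbhs x U by exact: open_nbhs_nbhs.
  have e20 : 0 < e / 2 by rewrite divr_gt0.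
  have [k ke] : exists k : nat, k.+1%:R^-1 < e / 2.
    have := near_infty_natSinv_lt (PosNum e20) => -[k _ /(_ k)/(_ (leqnn _))] /= h.
    by exists k.
  have [i Di] := hq x k.+1%:R^-1 ltac:(by rewrite invr_gt0).
  exists i => //; exists k => //; rewrite /C; case: asboolP => [_|]; first exact: ball_sym.
  case=> y By; apply: eV.
  apply: (@le_ball _ _ _ (k.+1%:R^-1 + k.+1%:R^-1)).
    by rewrite (splitr e) lerD// ltW.
  exact: ball_triangle Di By.
rewrite preimage_bigcup setI_bigcupr; apply: bigcup_measurable => i _.
rewrite preimage_bigcup setI_bigcupr; apply: bigcup_measurable => k _.
rewrite /C; case: asboolP => _; last by rewrite preimage_set0 setI0.
have k0 : 0 < k.+1%:R^-1 :> R by rewrite invr_gt0.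
have -> : D `&` f @^-1` B i k = D `&` \bigcap_j (D `&` (fun x => (f x : 'rV[R]_n) ord0 j) @^-1`
      (ball ((q i) ord0 j) (k.+1%:R^-1 : R))).
  apply/seteqP; split => x [Dx h]; split => //.
    by move=> j _; split => //; move/(rV_ballP _ _ k0) : h => /(_ j).
  by apply/(rV_ballP _ _ k0) => j; have [] := h j I.
apply: measurableI => //; apply: fin_bigcap_measurable => //.
move=> j _; apply: mf => //; apply: measurable_realfun.open_measurable; exact: ball_open.
Qed.

End MeasBvec.

(** * Integrals of nonnegative functions and laws *)

(** Every nonnegative measurable function is the increasing limit of simple functions,
    which are combinations of indicators. *)
Lemma nonneg_measurable_ind d (T : measurableType d) (R : realType)
    (Pr : (T -> \bar R) -> Prop) :
  (forall A, measurable A -> Pr (fun x => (\1_A x)%:E)) ->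
  (forall (f : T -> \bar R) (a : R), 0 <= a -> measurable_fun setT f -> (forall x, 0 <= f x)%E ->
     Pr f -> Pr (fun x => a%:E * f x)%E) ->
  (forall f g : T -> \bar R, measurable_fun setT f -> (forall x, 0 <= f x)%E ->
     measurable_fun setT g -> (forall x, 0 <= g x)%E ->
     Pr f -> Pr g -> Pr (fun x => f x + g x)%E) ->
  (forall f : nat -> T -> \bar R, (forall n, measurable_fun setT (f n)) ->
     (forall n x, 0 <= f n x)%E ->
     (forall x, {homo (fun n => f n x) : n m / (n <= m)%N >-> (n <= m)%E}) ->
     (forall n, Pr (f n)) -> Pr (fun x => limn (fun n => f n x))) ->
  forall f : T -> \bar R, measurable_fun setT f -> (forall x, 0 <= f x)%E -> Pr f.
Proof.
move=> P1 PZ PD PL f mf f0.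
pose g n := nnsfun_approx measurableT mf n.
have fE : f = (fun x => limn (fun n => (g n x)%:E)).
  apply/funext => x; apply/esym/cvg_lim => //.
  by apply: cvg_nnsfun_approx.
have mg n : measurable_fun setT (fun x => (g n x)%:E) by apply/measurable_EFinP.
rewrite fE; apply: PL => //.
- by move=> n x; rewrite lee_fin.
- move=> x n m nm; rewrite lee_fin.
  by have /lefP := nd_nnsfun_approx measurableT mf nm; apply.
move=> n.
set h := g n.
have -> : (fun x => (h x)%:E) = (fun x => (\sum_(i <- finmap.enum_fset (fset_set (range h)))
   (i * \1_(h @^-1` [set i]) x))%:E).
  apply/funext => x; congr (_%:E).
  by rewrite {1}(fimfunE h) fsbig_finite.
set s := fset_set (range h).
rewrite -/s.
have s0 i : i \in finmap.enum_fset s -> 0 <= i.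
  by rewrite in_fset_set // inE => -[x _ <-].
have mi i : measurable (h @^-1` [set i]) by [].
elim: (finmap.enum_fset s) s0 => [|i r IH] s0.
  have -> : (fun x => (\sum_(i <- [::]) i * \1_(h @^-1` [set i]) x)%:E) =
    (fun x : T => (\1_(@set0 T) x)%:E) :> (T -> \bar R).
    by apply/funext => x; rewrite big_nil indic0.
  exact: P1.
have s0' j : j \in r -> 0 <= j by move=> jr; apply: s0; rewrite in_cons jr orbT.
have m1 j : measurable_fun setT (fun x => (\1_(h @^-1` [set j]) x : R)).
  exact: measurable_indic.
have -> : (fun x => (\sum_(j <- i :: r) j * \1_(h @^-1` [set j]) x)%:E) =
  (fun x => i%:E * (\1_(h @^-1` [set i]) x)%:E + (\sum_(j <- r) j * \1_(h @^-1` [set j]) x)%:E)%E.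
  by apply/funext => x; rewrite big_cons EFinD EFinM.
apply: PD.
- apply: measurable_funeM; exact/measurable_EFinP.
- by move=> x; rewrite -EFinM lee_fin mulr_ge0 // s0 // mem_head.
- apply/measurable_EFinP; apply: measurable_sum => j; exact: measurable_funM.
- move=> x; rewrite lee_fin big_seq sumr_ge0 // => j jr; rewrite mulr_ge0 // s0' //.
- apply: PZ; first by apply: s0; rewrite mem_head.
  + exact/measurable_EFinP.
  + by move=> x; rewrite lee_fin.
  + exact: P1.
- exact: IH.
Qed.

(** Change of variables for the measure with density g: the identity for indicators
    determines it for all nonnegative functions.  With g = 1 it compares two laws; with g a
    product of the other factors it gives factorisation of expectations. *)
Lemma weighted_law d1 d2 (O : measurableType d1) (T : measurableType d2) (R : realType)
    (m : {measure set O -> \bar R}) (nu : {measure set T -> \bar R})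
    (g : O -> R) (X : O -> T) (c : R) :
  measurable_fun setT g -> (forall o, 0 <= g o) -> measurable_fun setT X -> 0 <= c ->
  (forall A, measurable A -> \int[m]_o ((g o)%:E * (\1_A (X o))%:E) = c%:E * nu A)%E ->
  forall f : T -> \bar R, measurable_fun setT f -> (forall x, 0 <= f x)%E ->
  (\int[m]_o ((g o)%:E * f (X o)) = c%:E * \int[nu]_x f x)%E.
Proof.
move=> mg g0 mX c0 H.
apply: (@nonneg_measurable_ind _ T R
  (fun f => \int[m]_o ((g o)%:E * f (X o)) = c%:E * \int[nu]_x f x)%E).
- by move=> A mA; rewrite H // integral_indic // setIT.
- move=> f a a0 mf f0 IH.
  under eq_integral do rewrite muleCA.
  rewrite (@ge0_integralZl _ _ _ m) //; [|by apply: emeasurable_funM; [exact/measurable_EFinP|exact: measurableT_comp]|by move=> x _; rewrite mule_ge0 ?lee_fin].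
  by rewrite IH ge0_integralZl // muleCA.
- move=> f h mf f0 mh h0 IHf IHh.
  under eq_integral do rewrite ge0_muleDr //.
  rewrite (@ge0_integralD _ _ _ m) //; [|by move=> x _; rewrite mule_ge0 ?lee_fin|by apply: emeasurable_funM; [exact/measurable_EFinP|exact: measurableT_comp]|by move=> x _; rewrite mule_ge0 ?lee_fin|by apply: emeasurable_funM; [exact/measurable_EFinP|exact: measurableT_comp]].
  by rewrite IHf IHh (@ge0_integralD _ _ _ nu) // [RHS]ge0_muleDr //; exact: integral_ge0.
- move=> f mf f0 ndf IH.
  have mgf n : measurable_fun setT (fun o => (g o)%:E * f n (X o))%E.
    by apply: emeasurable_funM; [exact/measurable_EFinP|exact: measurableT_comp].
  have cf x : cvgn (fun n => f n x).
    by apply: ereal_nondecreasing_is_cvgn => n k nk; exact: ndf.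
  have -> : (\int[m]_o ((g o)%:E * limn (fun n => f n (X o))) =
      \int[m]_o (limn (fun n => (g o)%:E * f n (X o))))%E.
    apply: eq_integral => o _; apply/esym/cvg_lim => //.
    by apply: cvgeZl => //; exact: cf.
  rewrite (@monotone_convergence _ _ _ m) //; [|by move=> n x _; rewrite mule_ge0 ?lee_fin|by move=> x _ a b ab; rewrite lee_wpmul2l ?lee_fin // ndf].
  rewrite (@monotone_convergence _ _ _ nu) //.
  under eq_fun do rewrite IH.
  apply/cvg_lim => //; apply: cvgeZl => //.
  apply: ereal_nondecreasing_is_cvgn => a b ab.
  by apply: ge0_le_integral => // x _; exact: ndf.
Qed.

(** The integrand is arbitrary: a restriction to a set of full measure is needed for
    the slope m_t, which is not known to be measurable in w.  The lower approximations by
    simple functions can be multiplied by the indicator of A. *)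
Lemma integral_full_set d (T : measurableType d) (R : realType)
    (mu : {measure set T -> \bar R}) (f : T -> \bar R) (A : set T) :
  measurable A -> mu (~` A) = 0%E ->
  (\int[mu]_x f x = \int[mu]_(x in A) f x)%E.
Proof.
move=> mA A0.
have H (g : T -> \bar R) : (forall x, 0 <= g x)%E ->
  ereal_sup [set sintegral mu (h : {nnsfun T >-> R}) |
      h in [set h : {nnsfun T >-> R} | forall x, ((h x)%:E <= g x)%E]] =
  ereal_sup [set sintegral mu (h : {nnsfun T >-> R}) |
      h in [set h : {nnsfun T >-> R} | forall x, ((h x)%:E <= (g \_ A) x)%E]].
  move=> g0; apply/eqP; rewrite eq_le; apply/andP; split; last first.
    apply: le_ereal_sup => _ [h hg <-]; exists h => // x.
    by apply: le_trans (hg x) _; rewrite patchE; case: ifP.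
  apply: ub_ereal_sup => _ [h hg <-]; apply: ereal_sup_ubound.
  exists (proj_nnsfun h mA).
    move=> x /=; rewrite patchE /= mindicE; case: ifP => xA.
      by rewrite mulr1; exact: hg.
    by rewrite mulr0.
  rewrite -!integralT_nnsfun; apply: ae_eq_integral => //.
  - by apply/measurable_EFinP.
  - by apply/measurable_EFinP.
  exists (~` A); split => //; first exact: measurableC.
  move=> x /=; apply: contra_not => Ax _.
  by rewrite mindicE mem_set // mulr1.
rewrite /integral.
have -> : ((f \_ [set: T])^\+)%E = (f^\+)%E by rewrite patch_setT.
have -> : ((f \_ [set: T])^\-)%E = (f^\-)%E by rewrite patch_setT.
by rewrite (H (f^\+)%E) // (H (f^\-)%E) // funepos_restrict funeneg_restrict.
Qed.

(** * Deviations of averages of independent copies *)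

Section IID.
Context d {O : measurableType d} {R : realType} (P : probability O R).
Context d1 (T : measurableType d1) (X : O -> T) (Xs : nat -> O -> T).
Hypothesis mX : measurable_fun setT X.
Hypothesis mXs : forall i, measurable_fun setT (Xs i).
Hypothesis iidX : iid_copies P X Xs.

(** The independence hypothesis is the product rule on rectangles, that is for
    products of indicators.  Replace indicators by general factors one at a time, j being the
    number of factors already replaced; [weighted_law] does one replacement. *)
Lemma iid_expectation_prod (F : nat -> T -> R) (m : nat -> R) n :
  (forall i, measurable_fun setT (F i)) -> (forall i x, 0 <= F i x) ->
  (forall i, \int[P]_o (F i (X o))%:E = (m i)%:E)%E ->
  (\int[P]_o (\prod_(i < n) F i (Xs i o))%:E = (\prod_(i < n) m i)%:E)%E.
Proof.
have mpre (Y : O -> T) (A : set T) : measurable_fun setT Y -> measurable A -> measurable (Y @^-1` A).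
  by move=> mY mA; rewrite -[_ @^-1` _]setTI; exact: mY.
suff H j : forall (F : nat -> T -> R) (m : nat -> R),
  (forall i, measurable_fun setT (F i)) -> (forall i x, 0 <= F i x) ->
  (forall i, \int[P]_o (F i (X o))%:E = (m i)%:E)%E ->
  (forall i, (j <= i)%N -> exists2 A, measurable A & F i = \1_A) ->
  (\int[P]_o (\prod_(i < n) F i (Xs i o))%:E = (\prod_(i < n) m i)%:E)%E.
  move=> mF F0 Fm.
  pose F' i := if (i < n)%N then F i else (\1_setT : T -> R).
  pose m' i := if (i < n)%N then m i else 1.
  have := H n F' m'.
  under eq_integral do under eq_bigr do rewrite /F' ltn_ord.
  under eq_bigr do rewrite /m' ltn_ord.
  apply.
  - by move=> i; rewrite /F'; case: ifP => // _; exact: measurable_indic.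
  - by move=> i x; rewrite /F'; case: ifP => // _.
  - move=> i; rewrite /F' /m'; case: ifP => // _.
    rewrite (eq_integral (cst 1%E)); last by move=> x _; rewrite indicT.
    rewrite integral_cst // mul1e; exact: probability_setT.
  - by move=> i ni; rewrite /F' ltnNge ni /=; exists setT.
elim: j => [|j IH] {}F {}m mF F0 Fm FA.
  have /choice[A HA] : forall i, exists A, measurable A /\ F i = \1_A.
    by move=> i; have [A mA FE] := FA i (leq0n i); exists A.
  have mE i : m i = fine (P (Xs i @^-1` A i)).
    rewrite iidX.1; last exact: (HA i).1.
    have := Fm i; rewrite (HA i).2.
    have -> : (\int[P]_o (\1_(A i) (X o))%:E = P (X @^-1` A i))%E.
      transitivity (\int[P]_o (\1_(X @^-1` A i) o)%:E)%E.
        by apply: eq_integral => o _; rewrite !indicE.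
      by rewrite integral_indic // ?setIT //; apply: mpre => //; exact: (HA i).1.
    by move=> ->.
  under [in RHS]eq_bigr do rewrite mE.
  rewrite -(iidX.2 n A); last by move=> i; exact: (HA i).1.
  have mI : measurable (\bigcap_(i in `I_n) (Xs i @^-1` A i)).
    by apply: fin_bigcap_measurable => // i _; apply: mpre => //; exact: (HA i).1.
  rewrite fineK ?fin_num_measure //.
  have -> : P (\bigcap_(i in `I_n) (Xs i @^-1` A i)) = (\int[P]_o (\1_(\bigcap_(i in `I_n) (Xs i @^-1` A i)) o)%:E)%E.
    by rewrite integral_indic // setIT.
  apply: eq_integral => o _; congr (_%:E).
  rewrite indicE; case: (boolP (o \in _)); rewrite ?inE => oI.
    rewrite big1 // => i _; rewrite (HA i).2 indicE mem_set //; exact: (oI i (ltn_ord i)).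
  move/negP : oI; rewrite inE => /existsNP[i /not_implyP[iN nA]].
  rewrite (bigD1 (Ordinal iN)) //= (HA i).2 indicE memNset // mul0r.
  by [].
have [nj|jn] := leqP n j.
  pose F' i := if (i < n)%N then F i else (\1_setT : T -> R).
  pose m' i := if (i < n)%N then m i else 1.
  have := IH F' m'.
  under eq_integral do under eq_bigr do rewrite /F' ltn_ord.
  under eq_bigr do rewrite /m' ltn_ord.
  apply.
  - by move=> i; rewrite /F'; case: ifP => // _; exact: measurable_indic.
  - by move=> i x; rewrite /F'; case: ifP => // _.
  - move=> i; rewrite /F' /m'; case: ifP => // _.
    rewrite (eq_integral (cst 1%E)); last by move=> x _; rewrite indicT.
    rewrite integral_cst // mul1e; exact: probability_setT.
  - by move=> i ji; rewrite /F' ltnNge (leq_trans nj ji) /=; exists setT.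
pose jo := Ordinal jn.
pose g o := \prod_(i < n | i != jo) F i (Xs i o).
pose c := \prod_(i < n | i != jo) m i.
have m0 i : 0 <= m i by rewrite -lee_fin -Fm integral_ge0 // => o _; rewrite lee_fin.
have mg : measurable_fun setT g.
  rewrite /g; under eq_fun do rewrite -big_filter.
  by apply: measurable_prod => i _; apply: measurableT_comp.
have g0 o : 0 <= g o by apply: prodr_ge0.
have c0 : 0 <= c by apply: prodr_ge0 => i _.
have WA A : measurable A ->
    (\int[P]_o ((g o)%:E * (\1_A (Xs j o))%:E) = c%:E * pushforward P X A)%E.
  move=> mA.
  pose F' i := if i == j then (\1_A : T -> R) else F i.
  pose m' i := if i == j then fine (P (X @^-1` A)) else m i.
  have -> : (c%:E * pushforward P X A)%E = (\prod_(i < n) m' i)%:E.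
    rewrite (bigD1 jo) //= {1}/m' eqxx EFinM fineK ?fin_num_measure //; last exact: mpre.
    rewrite muleC; congr (_ * _%:E)%E; apply: eq_bigr => i ij.
    by rewrite /m' -[X in _ == X]/(val jo) val_eqE (negbTE ij).
  rewrite -(IH F').
    apply: eq_integral => o _; rewrite -EFinM (bigD1 jo) //= {1}/F' eqxx mulrC.
    congr (_ * _)%:E; apply: eq_bigr => i ij.
    by rewrite /F' -[X in _ == X]/(val jo) val_eqE (negbTE ij).
  + by move=> i; rewrite /F'; case: ifP => // _; exact: measurable_indic.
  + by move=> i x; rewrite /F'; case: ifP => // _.
  + move=> i; rewrite /F' /m'; case: ifP => // _.
    rewrite fineK ?fin_num_measure //; last exact: mpre.
    transitivity (\int[P]_o (\1_(X @^-1` A) o)%:E)%E.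
      by apply: eq_integral => o _; rewrite !indicE.
    by rewrite integral_indic // ?setIT //; apply: mpre.
  + move=> i ji; rewrite /F'; case: eqP => [_|/eqP ij]; first by exists A.
    by apply: FA; rewrite ltn_neqAle eq_sym ij.
have mFj : measurable_fun setT (EFin \o F j) by exact/measurable_EFinP.
have Fj0 x : (0 <= (EFin \o F j) x)%E by rewrite lee_fin.
have := @weighted_law _ _ O T R P (pushforward P X) g (Xs j) c.
move=> /(_ mX mg g0 (mXs j) c0 WA _ mFj Fj0).
rewrite ge0_integral_pushforward // preimage_setT.
rewrite [X in (_ * X)%E](_ : _ = (m j)%:E) -?EFinM; last exact: Fm.
move=> WL.
rewrite (bigD1 jo) //= mulrC -/c -WL.
by apply: eq_integral => o _; rewrite (bigD1 jo) //= mulrC EFinM.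
Qed.

Lemma expR_quadratic (x : R) : `|x| <= 1 -> expR x <= 1 + x + 2 * x ^+ 2.
Proof.
rewrite ler_norml => /andP[x1 x2].
have h : 0 < 1 - x / 2 by lra.
have e1 : 1 - x / 2 <= expR (- (x / 2)) by apply: le_trans (expR_ge1Dx _); rewrite lexx.
have ex : expR x * expR (- (x / 2)) ^+ 2 = 1.
  by rewrite expr2 -!expRD -[RHS]expR0; congr expR; lra.
have e2 : (1 - x / 2) ^+ 2 <= expR (- (x / 2)) ^+ 2.
  by rewrite ler_sqr ?nnegrE ?expR_ge0 // ltW.
have e3 : expR x * (1 - x / 2) ^+ 2 <= 1.
  by rewrite -[leRHS]ex ler_wpM2l // expR_ge0.
have e4 : 1 <= (1 + x + 2 * x ^+ 2) * (1 - x / 2) ^+ 2.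
  have -> : (1 + x + 2 * x ^+ 2) * (1 - x / 2) ^+ 2 = 1 + x ^+ 2 * ((1 - x) * (5 / 2 - x)) / 2.
    by field.
  rewrite lerDl divr_ge0 // mulr_ge0 ?sqr_ge0 // mulr_ge0 //; lra.
have h2 : 0 < (1 - x / 2) ^+ 2 by rewrite exprn_gt0.
by rewrite -(ler_pM2r h2); apply: le_trans e3 e4.
Qed.

(** The linear term of [expR_quadratic] integrates to 0. *)
Lemma mgf_bound (h : T -> R) (c s : R) :
  measurable_fun setT h -> (forall x, `|h x| <= c) ->
  (\int[P]_o (h (X o))%:E = 0)%E -> 0 <= s -> s * c <= 1 ->
  exists2 m : R, (\int[P]_o (expR (s * h (X o)))%:E = m%:E)%E
    & 0 <= m <= expR (2 * s ^+ 2 * c ^+ 2).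
Proof.
move=> mh hc h0 s0 sc.
have mhX : measurable_fun setT (h \o X) by exact: measurableT_comp.
have shc o : `|s * h (X o)| <= 1.
  by rewrite normrM ger0_norm //; apply: le_trans sc; rewrite ler_wpM2l.
have ih : P.-integrable setT (EFin \o (h \o X)).
  apply: measurable_bounded_integrable => //; first by rewrite (le_lt_trans (probability_le1 _ _)) ?ltry.
  exists c; split; first exact: num_real.
  by move=> M cM o _; apply: le_trans (hc _) (ltW cM).
have me : measurable_fun setT (fun o => expR (s * h (X o))).
  by apply: measurableT_comp => //; apply: measurable_funM.
set b := 1 + 2 * s ^+ 2 * c ^+ 2.
have le1 : (\int[P]_o (expR (s * h (X o)))%:E <= \int[P]_o ((cst b o)%:E + s%:E * (h (X o))%:E))%E.
  apply: le_integral => //.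
  - apply: measurable_bounded_integrable => //; first by rewrite (le_lt_trans (probability_le1 _ _)) ?ltry.
    exists (expR 1); split; first exact: num_real.
    move=> M cM o _; apply: le_trans (ltW cM); rewrite ger0_norm ?expR_ge0 // ler_expR.
    exact: le_trans (ler_norm _) (shc _).
  - apply: integrableD => //; first exact: finite_measure_integrable_cst.
    exact: integrableZl.
  move=> o _; rewrite -EFinM -EFinD lee_fin; apply: le_trans (expR_quadratic (shc o)) _.
  rewrite /b /= addrAC lerD2r lerD2l -mulrA ler_wpM2l // exprMn ler_wpM2l ?sqr_ge0 //.
  rewrite -real_normK ?num_real // ler_sqr ?nnegrE //.
  exact: le_trans (normr_ge0 _) (hc (X o)).
have E2 : (\int[P]_o ((cst b o)%:E + s%:E * (h (X o))%:E) = b%:E)%E.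
  rewrite integralD //; [|exact: finite_measure_integrable_cst|exact: integrableZl].
  rewrite integralZl // h0 mule0 adde0.
  transitivity (b%:E * P setT)%E; first exact: (@integral_cst _ _ _ P setT measurableT b%:E).
  by rewrite probability_setT mule1.
rewrite E2 in le1.
have ge0 : (0 <= \int[P]_o (expR (s * h (X o)))%:E)%E.
  by apply: integral_ge0 => o _; rewrite lee_fin expR_ge0.
exists (fine (\int[P]_o (expR (s * h (X o)))%:E)%E).
  by rewrite fineK // ge0_fin_numE // (le_lt_trans le1) ?ltry.
rewrite fine_ge0 //=.
rewrite -lee_fin fineK; last by rewrite ge0_fin_numE // (le_lt_trans le1) ?ltry.
by apply: le_trans le1 _; rewrite lee_fin; exact: expR_ge1Dx.
Qed.

End IID.

Section Hoeff.
Context d {O : measurableType d} {R : realType} (P : probability O R).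
Context d1 (T : measurableType d1) (X : O -> T) (Xs : nat -> O -> T).
Hypothesis mX : measurable_fun setT X.
Hypothesis mXs : forall i, measurable_fun setT (Xs i).
Hypothesis iidX : iid_copies P X Xs.

Lemma probability_lty (A : set O) : measurable A -> (P A < +oo)%E.
Proof. by move=> mA; rewrite (le_lt_trans (probability_le1 _ _)) ?ltry. Qed.

Lemma prob_integral_cst (r : \bar R) : (\int[P]_o (cst r o) = r)%E.
Proof.
transitivity (r * P setT)%E; first exact: (@integral_cst _ _ _ P setT measurableT r).
by rewrite probability_setT mule1.
Qed.

Lemma bounded_int (h : O -> R) c : measurable_fun setT h -> (forall o, `|h o| <= c) ->
  P.-integrable setT (EFin \o h).
Proof.
move=> mh hc; apply: measurable_bounded_integrable => //; first exact: probability_lty.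
exists c; split; first exact: num_real.
by move=> M cM o _; apply: le_trans (hc _) (ltW cM).
Qed.

Lemma measurable_level (g : O -> R) t : measurable_fun setT g -> measurable [set o | t <= g o].
Proof.
move=> mg; rewrite [X in measurable X](_ : _ = g @^-1` `[t, +oo[%classic).
  by rewrite -[X in measurable X]setTI; apply: mg.
by apply/seteqP; split => o /=; rewrite in_itv /= andbT.
Qed.

Lemma measurable_sumXs (h : T -> R) n : measurable_fun setT h ->
  measurable_fun setT (fun o => \sum_(i < n) h (Xs i o)).
Proof. by move=> mh; apply: measurable_sum => i; apply: measurableT_comp. Qed.

(** Exponential Markov inequality with parameter s = t / (4 c^2).  The moment bound
    needs s c <= 1, i.e. t <= 4 c; beyond that the event is empty. *)
Lemma hoeffding_one (h : T -> R) (c t : R) n : (0 < n)%N -> 0 < c -> 0 < t ->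
  measurable_fun setT h -> (forall x, `|h x| <= c) ->
  (\int[P]_o (h (X o))%:E = 0)%E ->
  (P [set o | n%:R * t <= \sum_(i < n) h (Xs i o)]%R <= (expR (- (n%:R * t ^+ 2 / (8 * c ^+ 2))))%:E)%E.
Proof.
move=> n0 c0 t0 mh hc h0.
have nR : 0 < n%:R :> R by rewrite ltr0n.
have mS := measurable_sumXs n mh.
have mB : measurable [set o | n%:R * t <= \sum_(i < n) h (Xs i o)] by exact: measurable_level.
have [tc|tc] := ltP (4 * c) t.
  rewrite [X in P X](_ : _ = set0) ?measure0 ?lee_fin ?expR_ge0 //.
  apply/seteqP; split => // o /=; apply/negP; rewrite -ltNge.
  apply: (@le_lt_trans _ _ (\sum_(i < n) c)).
    by apply: ler_sum => i _; apply: le_trans (ler_norm _) (hc _).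
  rewrite sumr_const card_ord -[c *+ n]mulr_natl ltr_pM2l //; lra.
(* The minimiser of 2 s^2 c^2 - s t over s. *)
pose s := t / (4 * c ^+ 2).
have c20 : 0 < c ^+ 2 by rewrite exprn_gt0.
have s0 : 0 < s by rewrite divr_gt0 // mulr_gt0.
have sc : s * c <= 1.
  have -> : s * c = t / (4 * c) by rewrite /s; field; rewrite gt_eqF.
  by rewrite ler_pdivrMr ?mul1r // mulr_gt0.
have [m hm /andP[m0 mle]] := mgf_bound mX mh hc h0 (ltW s0) sc.
have me : measurable_fun setT (fun x => expR (s * h x)).
  by apply: measurableT_comp => //; apply: measurable_funM.
have := @iid_expectation_prod _ _ _ P _ T X Xs mX mXs iidX (fun _ x => expR (s * h x)) (fun _ => m) n (fun _ => me) (fun _ x => expR_ge0 _) (fun _ => hm).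
rewrite prodr_const card_ord => HE.
have le1 : ((expR (s * (n%:R * t)))%:E * P [set o | n%:R * t <= \sum_(i < n) h (Xs i o)]%R <= (m ^+ n)%:E)%E.
  have mi : measurable_fun setT (fun o => (\1_[set o | n%:R * t <= \sum_(i < n) h (Xs i o)] o : R)%:E).
    by apply/measurable_EFinP; exact: measurable_indic.
  rewrite -HE.
  have -> : ((expR (s * (n%:R * t)))%:E * P [set o | n%:R * t <= \sum_(i < n) h (Xs i o)]%R =
    \int[P]_o ((expR (s * (n%:R * t)))%:E * (\1_[set o | n%:R * t <= \sum_(i < n) h (Xs i o)]%R o)%:E))%E.
    rewrite ge0_integralZl ?lee_fin ?expR_ge0 //; first by rewrite integral_indic ?setIT.
  apply: ge0_le_integral => //.
  - exact: measurable_funeM.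
  - apply/measurable_EFinP; apply: measurable_prod => i _.
    by apply: (measurableT_comp me).
  move=> o _; rewrite -EFinM lee_fin -expR_sum -mulr_sumr indicE.
  case: (boolP (o \in _)) => ho; last by rewrite mulr0 expR_ge0.
  by rewrite mulr1 ler_expR ler_wpM2l ?(ltW s0) //; move: ho; rewrite inE.
have le2 : m ^+ n <= expR (n%:R * (2 * s ^+ 2 * c ^+ 2)).
  by rewrite mulrC expRM_natr; apply: lerXn2r; rewrite ?nnegrE ?expR_ge0.
have e0 : 0 < expR (s * (n%:R * t)) by exact: expR_gt0.
have Pf : P [set o | n%:R * t <= \sum_(i < n) h (Xs i o)]%R \is a fin_num.
  by rewrite fin_num_measure.
rewrite -(fineK Pf) -EFinM lee_fin in le1.
rewrite -(fineK Pf) lee_fin -(ler_pM2l e0); apply: (le_trans le1); apply: (le_trans le2).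
rewrite -expRD ler_expR le_eqVlt; apply/orP; left; apply/eqP; rewrite /s; field.
by rewrite gt_eqF.
Qed.

Lemma hoeffding (h : T -> R) (c mu t : R) n : (0 < n)%N -> 0 < c -> 0 < t ->
  measurable_fun setT h -> (forall x, `|h x| <= c) ->
  (\int[P]_o (h (X o))%:E = mu%:E)%E ->
  (P [set o | t <= `|n%:R^-1 * \sum_(i < n) h (Xs i o) - mu|]%R
    <= (2 * expR (- (n%:R * t ^+ 2 / (32 * c ^+ 2))))%:E)%E.
Proof.
move=> n0 c0 t0 mh hc hmu.
have nR : 0 < n%:R :> R by rewrite ltr0n.
have mhX : measurable_fun setT (h \o X) by exact: measurableT_comp.
have ih : P.-integrable setT (EFin \o (h \o X)).
  by apply: (@bounded_int _ c) => // o; exact: hc.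
have muc : `|mu| <= c.
  rewrite -lee_fin -[(`|mu|%:E)]/(`|mu%:E|)%E -hmu.
  apply: le_trans (le_abse_integral _ _ _) _ => //; first by apply/measurable_EFinP.
  apply: (@le_trans _ _ (\int[P]_o (cst c%:E o))%E).
    apply: ge0_le_integral => //.
    - by apply: measurableT_comp => //; apply/measurable_EFinP.
    - by move=> o _; rewrite lee_fin; exact: hc.
  by rewrite prob_integral_cst.
have key (e : R) : `|e| = 1 ->
    (P [set o | (n%:R * t)%R <= \sum_(i < n) (e * (h (Xs i o) - mu))]%R
      <= (expR (- (n%:R * t ^+ 2 / (32 * c ^+ 2))))%:E)%E.
  move=> e1.
  have -> : 32 * c ^+ 2 = 8 * (2 * c) ^+ 2 by ring.
  apply: (@hoeffding_one (fun x => e * (h x - mu))) => //; first by rewrite mulr_gt0.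
  - by apply: measurable_funM => //; apply: measurable_funB.
  - move=> x; rewrite normrM e1 mul1r (le_trans (ler_normB _ _)) //.
    by have := hc x; lra.
  rewrite (eq_integral (fun o => e%:E * ((h (X o))%:E - (cst mu o)%:E)))%E //.
  rewrite integralZl //; last first.
    by apply: integrableB => //; exact: finite_measure_integrable_cst.
  rewrite integralB //; last exact: finite_measure_integrable_cst.
  rewrite hmu.
  have -> : (\int[P]_x (cst mu x)%:E = mu%:E)%E.
    exact: (prob_integral_cst mu%:E).
  by rewrite subee // mule0.
have mA (e : R) : measurable [set o | (n%:R * t)%R <= \sum_(i < n) (e * (h (Xs i o) - mu))]%R.
  apply: measurable_level; apply: (measurable_sumXs (h := fun x => e * (h x - mu))).
  by apply: measurable_funM => //; apply: measurable_funB.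
rewrite [X in P X](_ : [set o | t <= `|n%:R^-1 * \sum_(i < n) h (Xs i o) - mu|]%R =
  [set o | (n%:R * t)%R <= \sum_(i < n) (1 * (h (Xs i o) - mu))]%R `|`
  [set o | (n%:R * t)%R <= \sum_(i < n) (-1 * (h (Xs i o) - mu))]%R); last first.
  have E o : n%:R^-1 * \sum_(i < n) h (Xs i o) - mu = n%:R^-1 * \sum_(i < n) (h (Xs i o) - mu).
    rewrite sumrB mulrBr sumr_const card_ord -[mu *+ n]mulr_natl mulrA mulVf ?gt_eqF // mul1r //.
  have H (y : R) : (t <= n%:R^-1 * y) = (n%:R * t <= y).
    by rewrite mulrC ler_pdivlMr // mulrC.
  apply/seteqP; split => o /=; rewrite E -!mulr_sumr mulN1r mul1r.
    rewrite ler_normr H -mulrN H => /orP[|]; [by left|by right].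
  rewrite ler_normr H -mulrN H.
  by move=> [->|->] //; rewrite orbT.
apply: le_trans (measureU2 P (mA 1) (mA (-1))) _.
have -> : 2 * expR (- (n%:R * t ^+ 2 / (32 * c ^+ 2))) = expR (- (n%:R * t ^+ 2 / (32 * c ^+ 2))) + expR (- (n%:R * t ^+ 2 / (32 * c ^+ 2))) by ring.
rewrite EFinD; apply: leeD.
  by apply: (key 1); rewrite normr1.
by apply: (key (-1)); rewrite normrN normr1.
Qed.

(** Expectations are additive whatever the dependence, so only the common law of the
    copies matters. *)
Lemma markov_average (h : T -> R) (e tau : R) n : (0 < n)%N -> 0 < tau ->
  measurable_fun setT h -> (forall x, 0 <= h x) ->
  (\int[P]_o (h (X o))%:E <= e%:E)%E ->
  (P [set o | tau <= n%:R^-1 * \sum_(i < n) h (Xs i o)]%R <= (e / tau)%:E)%E.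
Proof.
move=> n0 tau0 mh h0 he.
have nR : 0 < n%:R :> R by rewrite ltr0n.
have mS := measurable_sumXs n mh.
set B := [set o | _].
have mB : measurable B by apply: measurable_level; exact: measurable_funM.
have Ei i : (\int[P]_o (h (Xs i o))%:E = \int[P]_o (h (X o))%:E)%E.
  have H (Y : O -> T) : measurable_fun setT Y -> (forall A, measurable A -> P (Y @^-1` A) = P (X @^-1` A)) ->
      (\int[P]_o (h (Y o))%:E = 1%:E * \int[pushforward P X]_x (h x)%:E)%E.
    move=> mY YX.
    have := @weighted_law _ _ O T R P (pushforward P X) (cst 1) Y 1.
    move=> /(_ mX (measurable_cst _) (fun _ => ler01) mY ler01 _ (EFin \o h)).
    move=> <-.
    - by apply: eq_integral => o _; rewrite mul1e.
    - move=> A mA; rewrite mul1e.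
      under eq_integral do rewrite mul1e.
      transitivity (\int[P]_o (\1_(Y @^-1` A) o)%:E)%E.
        by apply: eq_integral => o _; rewrite !indicE.
      have mYA : measurable (Y @^-1` A) by rewrite -[_ @^-1` _]setTI; exact: mY.
      rewrite integral_indic // setIT; exact: YX.
    - exact/measurable_EFinP.
    - by move=> x; rewrite lee_fin.
  by rewrite (H (Xs i)) ?(H X) //; exact: iidX.1.
have ES : (\int[P]_o (\sum_(i < n) h (Xs i o))%:E <= (n%:R * e)%:E)%E.
  under eq_integral do rewrite -sumEFin.
  rewrite ge0_integral_sum //; last 2 first.
  - by move=> i; apply/measurable_EFinP; apply: measurableT_comp.
  - by move=> i o _; rewrite lee_fin.
  rewrite mulr_natl -[n in (e *+ n)]card_ord -sumr_const -sumEFin.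
  by apply: lee_sum => i _; rewrite Ei.
have le1 : ((n%:R * tau)%:E * P B <= (n%:R * e)%:E)%E.
  apply: le_trans ES.
  have mi : measurable_fun setT (fun o => (\1_B o : R)%:E).
    by apply/measurable_EFinP; exact: measurable_indic.
  have nt0 : 0 <= n%:R * tau by rewrite mulr_ge0 // ltW.
  have -> : ((n%:R * tau)%:E * P B = \int[P]_o ((n%:R * tau)%:E * (\1_B o)%:E))%E.
    rewrite ge0_integralZl ?lee_fin //; first by rewrite integral_indic ?setIT.
  apply: ge0_le_integral => //.
  - by move=> o _; rewrite mule_ge0 ?lee_fin.
  - exact: measurable_funeM.
  - exact/measurable_EFinP.
  move=> o _; rewrite -EFinM lee_fin indicE.
  case: (boolP (o \in _)) => ho; last by rewrite mulr0 sumr_ge0.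
  rewrite mulr1; move: ho; rewrite inE /B /= => ho.
  by rewrite mulrC -ler_pdivlMr // mulrC.
have Pf : P B \is a fin_num by rewrite fin_num_measure.
move: le1; rewrite -(fineK Pf) -EFinM !lee_fin -mulrA ler_pM2l // => h1.
by rewrite ler_pdivlMr // mulrC.
Qed.

End Hoeff.

(** * Events that also depend on an independent variable *)

Section Indep.
Context d {O : measurableType d} {R : realType} (P : probability O R).
Context d1 (S : measurableType d1) d2 (T : measurableType d2).

(** Under independence the joint law is the product of the marginals, and its mass
    on B is the average over v of the mass of the section at v. *)
Lemma independent_section_bound (V : {RV P >-> S}) (Y : {RV P >-> T}) (E : set S)
    (B : set (S * T)) (e : R) :
  independent P V Y -> measurable E -> measurable B -> 0 <= e ->
  (forall v, E v -> (P (Y @^-1` xsection B v) <= e%:E)%E) ->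
  (P [set o | E (V o) /\ B (V o, Y o)] <= e%:E)%E.
Proof.
move=> ind mE mB e0 H.
pose VY : O -> S * T := fun o => (V o, Y o).
have mVY : measurable_fun setT VY by apply: measurable_fun_pair.
pose F := [the {RV P >-> (S * T)%type} of mfun_Sub (mem_set mVY)].
pose A := B `&` (E `*` setT).
have mA : measurable A by apply: measurableI => //; exact: measurableX.
have := @product_measure_unique _ _ S T R (distribution P V) (distribution P Y) (distribution P F) _ A mA.
rewrite [X in _ -> _ = X](_ : _ = P [set o | E (V o) /\ B (V o, Y o)]); last first.
  by congr (P _); apply/seteqP; split => o /=; rewrite /A /VY /=; [move=> [] ? [] //|move=> []].
move=> <-; last first.
  by move=> C D mC mD; exact: ind.
rewrite /product_measure1 /=.
apply: (@le_trans _ _ (\int[distribution P V]_x (cst e%:E x))%E).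
  apply: ge0_le_integral => //.
  - exact: measurable_fun_xsection.
  move=> v _; have [Ev|nEv] := pselect (E v).
    apply: le_trans (H v Ev); apply: le_measure; rewrite ?inE.
    + exact: (measurable_xsection v mA).
    + exact: (measurable_xsection v mB).
    + by move=> o /=; rewrite /xsection /= !inE => -[].
  have -> : xsection A v = set0; last by rewrite measure0 lee_fin.
  by apply/seteqP; split => y //; rewrite /xsection /= inE => -[_ []].
by rewrite (prob_integral_cst (distribution P V)).
Qed.

End Indep.

(** * Disintegration along the conditional law *)

Section Disintegration.
Context d {O : measurableType d} {R : realType} (P : probability O R).
Context d1 d2 (TW : measurableType d1) (TZ : measurableType d2).
Variables (W : O -> TW) (Y : O -> TZ) (kap : R.-pker TZ ~> TW).
Hypothesis mW : measurable_fun setT W.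
Hypothesis mY : measurable_fun setT Y.
Hypothesis HC : cond_law P W Y kap.

(** Both this fact and [disintegration] hold for indicators by the definition of a
    conditional law, and extend by [nonneg_measurable_ind]. *)
Lemma kernel_integral_measurable (F : TW -> \bar R) : measurable_fun setT F -> (forall w, 0 <= F w)%E ->
  measurable_fun setT (fun o => \int[kap (Y o)]_w F w)%E.
Proof.
move=> mF F0; apply: (measurableT_comp (f := fun z => \int[kap z]_w F w)%E) => //.
apply: measurable_fun_integral_kernel => // U mU; exact: measurable_kernel.
Qed.

Lemma disintegration (F : TW -> \bar R) : measurable_fun setT F -> (forall w, 0 <= F w)%E ->
  (\int[P]_o F (W o) = \int[P]_o \int[kap (Y o)]_w F w)%E.
Proof.
move: F; apply: nonneg_measurable_ind.
- move=> A mA; have := HC mA (measurableT : measurable [set: TZ]).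
  rewrite preimage_setT setIT => H.
  under [RHS]eq_integral do rewrite integral_indic // setIT.
  rewrite -H.
  transitivity (\int[P]_o (\1_(W @^-1` A) o)%:E)%E.
    by apply: eq_integral => o _; rewrite !indicE.
  by rewrite integral_indic // ?setIT // -[_ @^-1` _]setTI; exact: mW.
- move=> f a a0 mf f0 IH.
  rewrite (@ge0_integralZl _ _ _ P) //; last exact: measurableT_comp.
  under [RHS]eq_integral do rewrite ge0_integralZl //.
  rewrite [RHS]ge0_integralZl //; first by rewrite IH.
    exact: kernel_integral_measurable.
  by move=> o _; apply: integral_ge0.
- move=> f h mf f0 mh h0 IHf IHh.
  rewrite (@ge0_integralD _ _ _ P) //; [|exact: measurableT_comp|exact: measurableT_comp].
  under [RHS]eq_integral do rewrite ge0_integralD //.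
  rewrite [RHS]ge0_integralD //; first by rewrite IHf IHh.
  + by move=> o _; apply: integral_ge0.
  + exact: kernel_integral_measurable.
  + by move=> o _; apply: integral_ge0.
  + exact: kernel_integral_measurable.
- move=> f mf f0 ndf IH.
  rewrite (@monotone_convergence _ _ _ P) //; last by move=> n; exact: measurableT_comp.
  under [RHS]eq_integral do rewrite monotone_convergence //.
  rewrite [RHS]monotone_convergence //.
  + by congr (limn _); apply/funext => n; exact: IH.
  + by move=> n; exact: kernel_integral_measurable.
  + by move=> n o _; apply: integral_ge0.
  + by move=> o _ a b ab; apply: ge0_le_integral => // w _; exact: ndf.
Qed.

(** The integral over the event Y in B of kap (Y o) A vanishes, and its integrand is
    nonnegative. *)
Lemma kernel_ae_null (A : set TW) (B : set TZ) : measurable A -> measurable B ->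
  P (W @^-1` A `&` Y @^-1` B) = 0%E -> {ae P, forall o, B (Y o) -> kap (Y o) A = 0%E}.
Proof.
move=> mA mB; rewrite HC // => H.
have mYB : measurable (Y @^-1` B) by rewrite -[_ @^-1` _]setTI; exact: mY.
have mk : measurable_fun (Y @^-1` B) (fun o => kap (Y o) A).
  apply: measurable_funTS; apply: (measurableT_comp (f := kap ^~ A)) => //; exact: measurable_kernel.
have [+ _] := (@ae_eq_integral_abs _ _ _ P _ mYB _ mk).
apply.
by under eq_integral do rewrite gee0_abs //.
Qed.

Lemma kernel_bounded_integrable (F : TW -> R) (C : R) z : measurable_fun setT F -> (forall w, `|F w| <= C) ->
  (kap z).-integrable setT (EFin \o F).
Proof.
move=> mF FC; apply: measurable_bounded_integrable => //.
  by rewrite (@prob_kernel _ _ _ _ _ kap z) ltry.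
exists C; split; first exact: num_real.
by move=> M' cM w _; apply: le_trans (FC _) (ltW cM).
Qed.

Lemma kernel_cst (C : R) z : (\int[kap z]_w (cst C w)%:E = C%:E)%E.
Proof.
transitivity (C%:E * kap z setT)%E; first exact: (@integral_cst _ _ _ (kap z) setT measurableT C%:E).
by rewrite (@prob_kernel _ _ _ _ _ kap z) mule1.
Qed.

(** Adding the bound C makes the function nonnegative. *)
Lemma disintegration_bounded (F : TW -> R) (C : R) : measurable_fun setT F -> (forall w, `|F w| <= C) ->
  (\int[P]_o (F (W o))%:E = \int[P]_o \int[kap (Y o)]_w (F w)%:E)%E /\
  measurable_fun setT (fun o => \int[kap (Y o)]_w (F w)%:E)%E.
Proof.
move=> mF FC.
have FCge w : 0 <= F w + C by have := FC w; rewrite ler_norml => /andP[? _]; lra.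
have mFC : measurable_fun setT (fun w => (F w + C)%:E).
  by apply/measurable_EFinP; apply: measurable_funD.
have E z : (\int[kap z]_w (F w + C)%:E = \int[kap z]_w (F w)%:E + C%:E)%E.
  rewrite -[in RHS](kernel_cst C z) -integralD //.
  - exact: kernel_bounded_integrable FC.
  - by apply: (@kernel_bounded_integrable (cst C) `|C|) => // w.
have E' z : (\int[kap z]_w (F w)%:E = \int[kap z]_w (F w + C)%:E - C%:E)%E.
  by rewrite E addeK.
have mk : measurable_fun setT (fun o => \int[kap (Y o)]_w (F w)%:E)%E.
  under eq_fun do rewrite E'.
  apply: emeasurable_funB => //; apply: kernel_integral_measurable => // w; by rewrite lee_fin.
split => //.
have H := disintegration mFC ltac:(by move=> w; rewrite lee_fin).
have iF : P.-integrable setT (EFin \o (F \o W)).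
  by apply: (@bounded_int _ _ _ P _ C); [exact: measurableT_comp|move=> o; exact: FC].
have C1 : (\int[P]_o (F (W o) + C)%:E = \int[P]_o (F (W o))%:E + C%:E)%E.
  rewrite -[in RHS](prob_integral_cst P C%:E) -integralD //.
  exact: finite_measure_integrable_cst.
have bk o : (`|\int[kap (Y o)]_w (F w)%:E| <= C%:E)%E.
  apply: le_trans (le_abse_integral _ _ _) _ => //; first by apply/measurable_EFinP.
  rewrite -(kernel_cst C (Y o)); apply: ge0_le_integral => //.
  - by apply: measurableT_comp => //; apply/measurable_EFinP.
  - exact/measurable_EFinP.
  - by move=> w _; rewrite lee_fin; exact: FC.
have ik : P.-integrable setT (fun o => \int[kap (Y o)]_w (F w)%:E)%E.
  apply: (@le_integrable _ _ _ P _ _ _ (cst C%:E)) => //; last exact: finite_measure_integrable_cst.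
  by move=> o _; apply: le_trans (bk o) _; rewrite /= lee_fin ler_norm.
have C2 : (\int[P]_o (\int[kap (Y o)]_w (F w)%:E + C%:E) = \int[P]_o (\int[kap (Y o)]_w (F w)%:E) + C%:E)%E.
  rewrite -[in RHS](prob_integral_cst P C%:E) -integralD //.
  exact: finite_measure_integrable_cst.
move: H; under [RHS]eq_integral do rewrite E.
rewrite C1 C2 => /(congr1 (fun x => x - C%:E)%E).
by rewrite !addeK.
Qed.

End Disintegration.

Section KernelSubvector.
Context d {O : measurableType d} {R : realType} (P : probability O R).
Context d1 (TW : measurableType d1) (nz : nat).
Variables (W : O -> TW) (f : TW -> bvec R nz) (kap : R.-pker (bvec R nz) ~> TW).
Hypothesis mW : measurable_fun setT W.
Hypothesis mf : measurable_fun setT f.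
Hypothesis HC : cond_law P W (f \o W) kap.

(** Given f(W), the variable W lies in the fibre of f.  It suffices to separate
    f w from f(W) by countably many sets: half-spaces with rational thresholds, for each of
    which the kernel is null on the wrong side. *)
Lemma kernel_concentrated : {ae P, forall o, kap (f (W o)) (~` [set w | f w = f (W o)]) = 0%E}.
Proof.
have mY : measurable_fun setT (f \o W) by exact: measurableT_comp.
pose c j (z : bvec R nz) : R := (z : 'rV[R]_nz) ord0 j.
have mc j : measurable_fun setT (c j) by exact: coord_measurable.
(* Rational half-spaces in each coordinate. *)
pose Bz (j : 'I_nz) (q : rat) := c j @^-1` [set x : R | x < ratr q].
have mBz j q : measurable (Bz j q).
  rewrite -[Bz j q]setTI; apply: mc => //.
  rewrite (_ : [set x | x < ratr q] = `]-oo, ratr q[%classic); first exact: measurable_itv.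
  by apply/seteqP; split => x /=; rewrite in_itv.
pose A j q := f @^-1` Bz j q.
have mA j q : measurable (A j q) by rewrite -[A j q]setTI; exact: mf.
have N1 j q : {ae P, forall o, Bz j q (f (W o)) -> kap (f (W o)) (~` A j q) = 0%E}.
  apply: (kernel_ae_null mY HC) => //; first exact: measurableC.
  rewrite [X in P X](_ : _ = set0) ?measure0 //.
  by apply/seteqP; split => // o [].
have N2 j q : {ae P, forall o, (~` Bz j q) (f (W o)) -> kap (f (W o)) (A j q) = 0%E}.
  apply: (kernel_ae_null mY HC) => //; first exact: measurableC.
  rewrite [X in P X](_ : _ = set0) ?measure0 //.
  by apply/seteqP; split => // o [].
have N3 : {ae P, forall o, forall jq : 'I_nz * rat, (Bz jq.1 jq.2 (f (W o)) -> kap (f (W o)) (~` A jq.1 jq.2) = 0%E) /\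
   ((~` Bz jq.1 jq.2) (f (W o)) -> kap (f (W o)) (A jq.1 jq.2) = 0%E)}.
  have := @ae_foralln _ _ _ P (fun i o => forall jq : 'I_nz * rat, pickle jq = i ->
    (Bz jq.1 jq.2 (f (W o)) -> kap (f (W o)) (~` A jq.1 jq.2) = 0%E) /\
   ((~` Bz jq.1 jq.2) (f (W o)) -> kap (f (W o)) (A jq.1 jq.2) = 0%E)).
  move=> H; apply: filterS (H _) => [x hx jq|i]; first exact: (hx (pickle jq)).
  case E : (unpickle i : option ('I_nz * rat)) => [jq|]; last first.
    by apply: nearW => o jq Ei; rewrite -Ei pickleK in E.
  apply: filterS2 (N1 jq.1 jq.2) (N2 jq.1 jq.2) => o h1 h2 jq' Ei.
  by rewrite -Ei pickleK in E; move: E => [->].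
apply: filterS N3 => o H.
set z := f (W o) in H *.
pose C (i : nat) : set TW := if (unpickle i : option ('I_nz * rat)) is Some jq then
  (if c jq.1 z < ratr jq.2 then ~` A jq.1 jq.2 else A jq.1 jq.2) else set0.
have C0 i : kap z (C i) = 0%E.
  rewrite /C; case: (unpickle i) => [jq|]; last exact: measure0.
  case: ifP => h; first by apply: (H jq).1.
  by apply: (H jq).2; rewrite /Bz /=; apply/negP; rewrite h.
have mC i : measurable (C i).
  rewrite /C; case: (unpickle i) => [jq|] //; case: ifP => _ //; exact: measurableC.
have sub : (~` [set w | f w = z]) `<=` \bigcup_i C i.
  move=> w /= fwz.
  have /existsNP[j /eqP jn] : ~ forall j, c j (f w) = c j z.
    by move=> h; apply: fwz; apply/rowP => j; exact: h.
  have : (c j (f w) < c j z) || (c j z < c j (f w)) by rewrite -neq_lt.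
  move=> /orP[] /rat_in_itvoo[q]; rewrite in_itv /= => /andP[q1 q2]; exists (pickle (j, q)) => //; rewrite /C pickleK /=.
    by rewrite ltNge (ltW q2).
  by rewrite q1 /A /Bz /=; apply/negP; rewrite -leNgt ltW.
apply/eqP; rewrite eq_le measure_ge0 andbT.
have mE : measurable [set w | f w = z].
  rewrite [X in measurable X](_ : _ = \bigcap_j ((fun w => c j (f w)) @^-1` [set c j z])).
    apply: fin_bigcap_measurable => // j _.
    by rewrite -[X in measurable X]setTI; apply: (measurableT_comp (mc j) mf).
  apply/seteqP; split => w /=; first by move=> h j _ /=; rewrite h.
  by move=> h; apply/rowP => j; exact: (h j I).
have := @measure_sigma_subadditive _ _ _ (kap z) (~` [set w | f w = z]) C mC (measurableC mE) sub.
by rewrite eseries0 // => i _ _; exact: C0.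
Qed.

End KernelSubvector.

(** * Quadratic forms, margins, clipping *)

Section MinEigen.
Context {R : realType} {n : nat}.
Implicit Types u v x : 'rV[R]_n.

Lemma continuous_fsum (I : Type) (r : seq I) (F : I -> 'rV[R]_n -> R) :
  (forall i, continuous (F i)) -> continuous (fun x => \sum_(i <- r) F i x).
Proof.
move=> cF; elim: r => [|i r IH].
  by under eq_fun do rewrite big_nil; exact: cst_continuous.
by under eq_fun do rewrite big_cons; move=> x; apply: continuousD; [exact: cF|exact: IH].
Qed.

Definition bilin (A : 'M[R]_n) u v := \sum_i \sum_j u ord0 i * A i j * v ord0 j.

Lemma bilin_line (A : 'M[R]_n) x u (t : R) : A^T = A ->
  bilin A (x + t *: u) (x + t *: u) = bilin A x x + 2 * t * bilin A x u + t ^+ 2 * bilin A u u.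
Proof.
move=> sA.
have sym : bilin A u x = bilin A x u.
  rewrite /bilin exchange_big; apply: eq_bigr => i _; apply: eq_bigr => j _.
  have AT k l : A k l = A l k by rewrite -{1}sA mxE.
  by rewrite /= AT; ring.
have -> : bilin A (x + t *: u) (x + t *: u) = bilin A x x + t * bilin A x u + t * bilin A u x + t ^+ 2 * bilin A u u.
  rewrite /bilin !mulr_sumr -!big_split; apply: eq_bigr => i _ /=.
  rewrite !mulr_sumr -!big_split; apply: eq_bigr => j _ /=.
  by rewrite !mxE; ring.
by rewrite sym; ring.
Qed.

(** The quadratic form attains its minimum over the unit sphere, and the minimiser
    is an eigenvector: otherwise a small move along some direction u would decrease the
    Rayleigh quotient. *)
Lemma min_eigenvalue_quadratic (A : 'M[R]_n) (c : R) : A^T = A ->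
  (forall a, eigenvalue A a -> c <= a) ->
  forall v, c * (\sum_j v ord0 j ^+ 2) <= bilin A v v.
Proof.
move=> sA HA v.
pose N u := \sum_j u ord0 j ^+ 2.
have NZ (a : R) u : N (a *: u) = a ^+ 2 * N u.
  by rewrite /N mulr_sumr; apply: eq_bigr => j _; rewrite mxE exprMn.
have qZ (a : R) u : bilin A (a *: u) (a *: u) = a ^+ 2 * bilin A u u.
  rewrite /bilin mulr_sumr; apply: eq_bigr => i _; rewrite mulr_sumr; apply: eq_bigr => j _.
  by rewrite !mxE; ring.
have N0 u : 0 <= N u by apply: sumr_ge0 => j _; exact: sqr_ge0.
have cc j : continuous (fun u : 'rV[R]_n => u ord0 j) by exact: coord_continuous.
have cN : continuous N.
  by apply: continuous_fsum => j x; under eq_fun do rewrite expr2; apply: continuousM; exact: cc.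
have cq : continuous (fun u => bilin A u u).
  apply: continuous_fsum => i; apply: continuous_fsum => j x.
  apply: (@continuousM _ _ (fun u : 'rV[R]_n => u ord0 i * A i j) (fun u => u ord0 j)); last exact: cc.
  apply: (@continuousM _ _ (fun u : 'rV[R]_n => u ord0 i) (fun=> A i j)); first exact: cc.
  exact: cst_continuous.
have [v0|vn] := eqVneq v 0.
  rewrite v0 /bilin [X in c * X]big1 ?mulr0; last by move=> j _; rewrite mxE expr0n.
  by rewrite big1 // => i _; rewrite big1 // => j _; rewrite !mxE mulr0.
have Npos u : u != 0 -> 0 < N u.
  move=> un; rewrite lt_neqAle N0 andbT eq_sym; apply: contra un => /eqP Nu.
  apply/eqP/rowP => j; rewrite mxE; apply/eqP; rewrite -sqrf_eq0.
  by apply/eqP; apply: (psumr_eq0P _ Nu) => // i _; exact: sqr_ge0.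
pose Sph : set 'rV[R]_n := [set u | N u = 1].
have nrm u : u != 0 -> Sph ((Num.sqrt (N u))^-1 *: u).
  move=> un; have Nu := Npos u un; rewrite /Sph /= NZ exprVn sqr_sqrtr ?ltW // mulVf //.
  by rewrite gt_eqF.
have cS : compact Sph.
  apply: bounded_closed_compact.
    exists 1; split; first exact: num_real.
    move=> M M1 u; rewrite /Sph /= => Nu.
    rewrite /Num.norm /= mx_normrE; apply/bigmax_leP; split => /=; first by rewrite ltW // (lt_trans ltr01).
    move=> [i j] _ /=; rewrite ord1; apply: le_trans (ltW M1).
    rewrite -(@ler_pXn2r _ 2) ?nnegrE // expr1n real_normK ?num_real // -Nu /N.
    by rewrite (bigD1 j) //= lerDl sumr_ge0 // => k _; exact: sqr_ge0.
  rewrite (_ : Sph = N @^-1` [set x | x = 1]) //.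
  by apply: closed_comp; [move=> u _; exact: cN|exact: closed_eq].
have [|x0] := @compact_EVT_min _ R (fun u => bilin A u u) Sph (ex_intro _ _ (nrm v vn)) cS.
- by apply: continuous_subspaceT.
rewrite inE => x0S x0min.
pose mu := bilin A x0 x0.
have H u : mu * N u <= bilin A u u.
  have [->|un] := eqVneq u 0.
    by rewrite -(scale0r u) qZ NZ expr0n /= !mul0r mulr0.
  have := x0min ((Num.sqrt (N u))^-1 *: u); rewrite inE => /(_ (nrm u un)).
  rewrite -/mu qZ exprVn sqr_sqrtr // => h.
  by rewrite -ler_pdivlMr ?Npos // mulrC.
have N1 : N x0 = 1 by [].
pose dt x u := \sum_j x ord0 j * u ord0 j.
have lin u : bilin A x0 u = mu * dt x0 u.
  (* The first-order variation al must vanish, since t al dominates t^2 be for small t. *)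
  pose al := bilin A x0 u - mu * dt x0 u; pose be := bilin A u u - mu * N u.
  have be0 : 0 <= be by rewrite subr_ge0.
  have Nl (t : R) : N (x0 + t *: u) = 1 + 2 * t * dt x0 u + t ^+ 2 * N u.
    transitivity (N x0 + 2 * t * dt x0 u + t ^+ 2 * N u); last by rewrite N1.
    rewrite /N /dt !mulr_sumr -!big_split; apply: eq_bigr => j _ /=.
    by rewrite !mxE; ring.
  have K (t : R) : 0 <= 2 * t * al + t ^+ 2 * be.
    have := H (x0 + t *: u); rewrite (bilin_line _ _ _ sA) Nl -/mu /al /be; lra.
  have al0 : al = 0.
    have [//|aln] := eqVneq al 0.
    have b1 : 0 < be + 1 by lra.
    have := K (- al / (be + 1)).
    have -> : 2 * (- al / (be + 1)) * al + (- al / (be + 1)) ^+ 2 * be =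
      - (al ^+ 2 * (be + 2) / (be + 1) ^+ 2) by field; rewrite gt_eqF.
    rewrite oppr_ge0 leNgt => /negP[].
    by rewrite divr_gt0 ?exprn_gt0 // mulr_gt0 //; [rewrite exprn_even_gt0|lra].
  by move: al0 => /eqP; rewrite subr_eq0 => /eqP.
have ev : eigenvalue A mu.
  apply/eigenvalueP; exists x0; last first.
    apply/eqP => x00; move: N1; rewrite x00 /N big1 => [/eqP|j _]; last by rewrite mxE expr0n.
    by rewrite eq_sym oner_eq0.
  apply/rowP => j; rewrite !mxE.
  have := lin (delta_mx ord0 j); rewrite /bilin /dt.
  under eq_bigr => i _.
    rewrite (bigD1 j) //= big1 => [|k kj]; last by rewrite mxE (negbTE kj) andbF mulr0.
    rewrite mxE !eqxx mulr1 addr0; over.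
  move=> ->; congr (_ * _); rewrite (bigD1 j) //= big1 => [|k kj]; last by rewrite mxE (negbTE kj) andbF mulr0.
  by rewrite mxE !eqxx mulr1 addr0.
apply: le_trans (H v); apply: ler_wpM2r (N0 v) _ _ _; exact: HA.
Qed.

End MinEigen.

(** A ball around x inside D leaves half of its radius to all points near x;
    compactness makes the radius uniform. *)
Lemma compact_margin (R : realType) (V : normedModType R) (K D : set V) :
  compact K -> open D -> K `<=` D ->
  exists2 eta : R, 0 < eta & forall x, K x -> ball x eta `<=` D.
Proof.
move=> cK oD KD.
have := (compact_near_coveringP K).1 cK _ (0^'+ : set_system R) (fun eta x => ball x eta `<=` D) _.
move=> /(_ _) H.
have : \forall eta \near (0^'+ : set_system R), K `<=` (fun x => ball x eta `<=` D).
  apply: H => x Kx.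
  have /nbhs_ballP[e /= e0 eD] : nbhs x D by apply: open_nbhs_nbhs; split => //; exact: KD.
  have e20 : 0 < e / 2 by rewrite divr_gt0.
  exists (ball x (e / 2), [set eta | eta < e / 2]); first split => /=.
  - exact: nbhsx_ballx.
  - exact: nbhs_right_lt.
  move=> [y eta] /= [xy etae] z yz; apply: eD.
  rewrite (splitr e); apply: ball_triangle xy _; apply: le_ball yz; exact: ltW.
move=> H1; have H2 : \forall eta \near (0^'+ : set_system R), 0 < eta by exact: nbhs_right_gt.
by have [eta [e0 eK]] := filter_ex (filterI H2 H1); exists eta.
Qed.

(** In the extended reals the difference of the integrals of the positive and the
    negative part vanishes only if both are finite.  This recovers the integrability that
    a conditional moment equal to 0 carries implicitly. *)
Lemma integral0_integrable d (T : measurableType d) (R : realType)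
    (mu : {measure set T -> \bar R}) (D : set T) (f : T -> \bar R) : measurable D -> measurable_fun D f ->
  (\int[mu]_(x in D) f x = 0)%E -> mu.-integrable D f.
Proof.
move=> mD mf; rewrite integralE => f0.
have p0 : (0 <= \int[mu]_(x in D) f^\+ x)%E by exact: integral_ge0.
have n0 : (0 <= \int[mu]_(x in D) f^\- x)%E by exact: integral_ge0.
apply/integrableP; split => //.
under eq_integral do rewrite -/((abse \o f) _) fune_abse.
rewrite ge0_integralD //; [|exact: measurable_funepos|exact: measurable_funeneg].
move: p0 n0 f0; case: (\int[mu]_(x in D) f^\+ x)%E => [r| |] //; case: (\int[mu]_(x in D) f^\- x)%E => [s| |] //.
by move=> _ _ _; rewrite -EFinD ltry.
Qed.

(** Clipping turns functions that satisfy a bound almost surely into functions that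
    satisfy it everywhere, without changing their law. *)
Definition clip {R : realType} (c x : R) : R := Num.max (- c) (Num.min c x).

Lemma clip_le {R : realType} (c x : R) : 0 <= c -> `|clip c x| <= c.
Proof.
move=> c0; rewrite ler_norml /clip le_max lexx ge_max ge_min lexx /= andbT; lra.
Qed.

Lemma clip_id {R : realType} (c x : R) : `|x| <= c -> clip c x = x.
Proof.
rewrite ler_norml /clip => /andP[a b]; rewrite (min_idPr b); exact/max_idPr.
Qed.

Lemma measurable_clip {R : realType} d (T : measurableType d) (f : T -> R) c :
  measurable_fun setT f -> measurable_fun setT (fun x => clip c (f x)).
Proof. by move=> mf; apply: measurable_maxr => //; apply: measurable_minr. Qed.

(** * Convex functions of one variable *)

Section ConvexQuotient.
Context {R : realType}.
Variables (F c : R -> R).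
Hypothesis dF : forall s : R, is_derive s 1 F (c s).
Hypothesis cmono : {homo c : x y / x <= y}.

Lemma mvt_le (a b : R) : a <= b -> exists2 x, a <= x <= b & F b - F a = c x * (b - a).
Proof.
move=> ab; have [x] := @mvt_between R F c a b (fun x _ => dF x).
by rewrite (min_idPl ab) (max_idPr ab); exists x.
Qed.

(** Difference quotients of a convex function at 0 lie between the chords over [-1, 0]
    and [0, 1]; this is the domination that allows differentiation under the expectation. *)
Lemma convex_quotient h : h != 0 -> `|h| <= 1 ->
  F 0 - F (-1) <= h^-1 * (F h - F 0) <= F 1 - F 0.
Proof.
move=> h0 h1.
have three (x y z : R) : x <= y -> y <= z -> (F y - F x) * (z - y) <= (F z - F y) * (y - x).
  move=> xy yz; have [a /andP[a1 a2] ->] := mvt_le xy; have [b /andP[b1 b2] ->] := mvt_le yz.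
  have := cmono (le_trans a2 b1) => cab.
  rewrite -!mulrA [(y - x) * _]mulrC; apply: ler_wpM2r => //.
  by rewrite mulr_ge0 ?subr_ge0.
rewrite ler_norml in h1; case/andP: h1 => h1 h2.
have [hp|hn|h00] := ltgtP h 0; last by rewrite h00 eqxx in h0.
- have i0 : h^-1 < 0 by rewrite invr_lt0.
  have A := three (-1) h 0 h1 (ltW hp).
  have B := three h 0 1 (ltW hp) ler01.
  have E : h^-1 * (F h - F 0) = (F 0 - F h) / (- h) by field.
  have h' : 0 < - h by rewrite oppr_gt0.
  rewrite E ler_pdivlMr // ler_pdivrMr //; apply/andP; split; lra.
- have A := three 0 h 1 (ltW hn) h2.
  have B := three (-1) 0 h ltac:(lra) (ltW hn).
  have E : h^-1 * (F h - F 0) = (F h - F 0) / h by rewrite mulrC.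
  rewrite E ler_pdivlMr // ler_pdivrMr //; apply/andP; split; lra.
Qed.

End ConvexQuotient.

(** * Penalised minimisers *)

Section Lasso.
Context {R : realType} {p : nat}.
Implicit Types (v : 'rV[R]_p).

Local Notation sq v := (\sum_j v ord0 j ^+ 2).

Lemma norm1_split (T : {set 'I_p}) v : norm1 v = norm1 (vrestr T v) + norm1 (vrestr (finset.setC T) v).
Proof.
rewrite /norm1 -big_split; apply: eq_bigr => j _ /=; rewrite !mxE inE.
by case: (j \in T); rewrite /= normr0 ?addr0 ?add0r.
Qed.

(** Cauchy-Schwarz, written as a sum of squares. *)
Lemma norm1_restr_sq (T : {set 'I_p}) v : norm1 (vrestr T v) ^+ 2 <= #|T|%:R * sq v.
Proof.
set k := #|T|%:R; set S := norm1 _.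
have SE : S = \sum_(j in T) `|v ord0 j|.
  rewrite /S /norm1 [RHS]big_mkcond; apply: eq_bigr => j _; rewrite mxE.
  by case: ifP => //; rewrite normr0.
have [k0|kn] := eqVneq k 0.
  have T0 : T = finset.set0 by apply/eqP; rewrite -cards_eq0 -(eqr_nat R) -/k k0.
  by rewrite SE T0 big_pred0 ?expr0n ?k0 ?mul0r // => j; rewrite inE.
have kp : 0 < k by rewrite lt_neqAle eq_sym kn /k ler0n.
have h : 0 <= \sum_(j in T) (`|v ord0 j| - S / k) ^+ 2 by apply: sumr_ge0 => j _; exact: sqr_ge0.
have E : \sum_(j in T) (`|v ord0 j| - S / k) ^+ 2 = \sum_(j in T) v ord0 j ^+ 2 - S ^+ 2 / k.
  transitivity (\sum_(j in T) (v ord0 j ^+ 2 - 2 * (S / k) * `|v ord0 j| + (S / k) ^+ 2)).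
    by apply: eq_bigr => j _; rewrite -[v ord0 j ^+ 2]real_normK ?num_real //; ring.
  rewrite big_split sumrB /= -mulr_sumr -SE sumr_const -[_ *+ #|T|]mulr_natl -/k; field => //.
have h2 : \sum_(j in T) v ord0 j ^+ 2 <= sq v.
  rewrite [leLHS]big_mkcond; apply: ler_sum => j _; case: ifP => // _; exact: sqr_ge0.
rewrite E subr_ge0 ler_pdivrMr // in h.
by apply: le_trans h _; rewrite mulrC ler_wpM2l // ltW.
Qed.

Lemma norm1_sq v : norm1 v ^+ 2 <= p%:R * sq v.
Proof.
have := norm1_restr_sq [set: 'I_p]%SET v; rewrite cardsT card_ord.
by have -> : vrestr [set: 'I_p]%SET v = v by apply/rowP => j; rewrite mxE inE.
Qed.

Variables (th0 : 'rV[R]_p) (Qf : 'rV[R]_p -> R) (s : 'I_p -> R) (lam S tau kap eta : R).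
Hypothesis lam0 : 0 < lam.
Hypothesis S0 : 0 <= S.
Hypothesis kap0 : 0 < kap.
Hypothesis Hs : forall j, `|s j| <= S.
Hypothesis H1 : forall v, \sum_j s j * v ord0 j <= Qf v.
Hypothesis H2 : forall v a, 0 <= a <= 1 -> Qf (a *: v) <= a * Qf v.
Hypothesis H3 : forall v, norm1 v <= eta ->
  \sum_j s j * v ord0 j + kap * sq v - tau * norm1 v ^+ 2 <= Qf v.
Variable v : 'rV[R]_p.
Hypothesis Hv : Qf v + lam * norm1 (th0 + v) <= lam * norm1 th0.

Lemma score_pairing (u : 'rV[R]_p) : `|\sum_j s j * u ord0 j| <= S * norm1 u.
Proof.
apply: le_trans (ler_norm_sum _ _ _) _; rewrite /norm1 mulr_sumr.
by apply: ler_sum => j _; rewrite normrM ler_wpM2r.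
Qed.

(** Convexity bounds the decrease of the criterion by S |v|_1, while the penalty
    increases by |v|_1 off the support of th0 and decreases at most by |v|_1 on it. *)
Lemma lasso_cone : S <= lam / 2 ->
  norm1 (vrestr (finset.setC (vsupp th0)) v) <= 3 * norm1 (vrestr (vsupp th0) v).
Proof.
move=> S2; set T := vsupp th0.
have a1 : norm1 th0 - norm1 (vrestr T v) + norm1 (vrestr (finset.setC T) v) <= norm1 (th0 + v).
  rewrite /norm1 -sumrB -big_split /=; apply: ler_sum => j _; rewrite !mxE !inE.
  case: eqP => [->|_] /=; first by rewrite normr0 subrr !add0r.
  rewrite normr0 addr0 lerBlDr; have := ler_normB (th0 ord0 j + v ord0 j) (v ord0 j).
  by rewrite addrK.
have a2 := score_pairing v; rewrite ler_norml in a2; case/andP: a2 => a2 _.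
have a3 := H1 v; have a4 := norm1_split T v.
have b0 := norm1_ge0 (vrestr T v); have b1 := norm1_ge0 (vrestr (finset.setC T) v).
have b2 : S * norm1 v <= lam / 2 * norm1 v by rewrite ler_wpM2r ?norm1_ge0.
rewrite a4 mulrDr in b2.
have b3 : lam * (norm1 th0 - norm1 (vrestr T v) + norm1 (vrestr (finset.setC T) v)) <= lam * norm1 (th0 + v).
  by rewrite ler_wpM2l // ltW.
rewrite a4 mulrDr in a2.
have : lam / 2 * (norm1 (vrestr (finset.setC T) v) - 3 * norm1 (vrestr T v)) <= 0.
  have key : forall (N0 N1 x y q sg l T' : R), - (T' * x + T' * y) <= sg -> sg <= q ->
      q + l * N1 <= l * N0 -> T' * x + T' * y <= l / 2 * (x + y) ->
      l * (N0 - x + y) <= l * N1 -> l / 2 * (y - 3 * x) <= 0 by move=> *; lra.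
  exact: key a2 a3 Hv b2 b3.
by rewrite pmulr_rle0 ?divr_gt0 // subr_le0.
Qed.

Lemma norm2_sqr (u : 'rV[R]_p) : norm2 u ^+ 2 = sq u.
Proof. by rewrite /norm2 sqr_sqrtr // sumr_ge0 // => j _; exact: sqr_ge0. Qed.

Lemma norm2Z (a : R) (u : 'rV[R]_p) : 0 <= a -> norm2 (a *: u) = a * norm2 u.
Proof.
move=> a0; rewrite /norm2.
have -> : \sum_j (a *: u) ord0 j ^+ 2 = a ^+ 2 * sq u.
  by rewrite mulr_sumr; apply: eq_bigr => j _; rewrite mxE exprMn.
by rewrite sqrtrM ?sqr_ge0 // sqrtr_sqr ger0_norm.
Qed.

(** If |v|_2 exceeded r, convexity would transfer the minimising inequality to the
    rescaled vector u of norm exactly r, which lies in the region where the quadratic lower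
    bound is available, and there the quadratic term would beat score and penalty. *)
Lemma lasso_radius (A L r : R) : 0 <= A -> norm1 v <= A * norm2 v -> A ^+ 2 * tau <= kap / 2 ->
  0 <= tau ->
  S + lam <= L * lam -> 2 * L * lam * A / kap < r -> A * r <= eta -> norm2 v <= r.
Proof.
move=> A0 vA At tau0 SL rL re; rewrite leNgt; apply/negP => vr.
have L0 : 0 <= L * lam by apply: le_trans SL; rewrite addr_ge0 // ltW.
have r0 : 0 < r.
  by apply: le_lt_trans rL; rewrite divr_ge0 ?(ltW kap0) // mulr_ge0 // -mulrA mulr_ge0.
have v0 : 0 < norm2 v by apply: lt_trans vr.
(* The factor that brings v to the sphere of radius r. *)
pose a := r / norm2 v.
have a01 : 0 <= a <= 1.
  by rewrite /a divr_ge0 ?(ltW r0) ?(ltW v0) //= ler_pdivrMr // mul1r ltW.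
case/andP: (a01) => a0 a1.
pose u := a *: v.
have u2 : norm2 u = r by rewrite /u norm2Z // /a divfK // gt_eqF.
have u1 : norm1 u <= A * r.
  rewrite /u norm1Z ger0_norm //; apply: le_trans (ler_wpM2l a0 vA) _.
  by rewrite mulrCA ler_wpM2l // /a divfK // gt_eqF.
have c1 := H3 (le_trans u1 re).
rewrite -norm2_sqr u2 in c1.
have c2 := H2 v a01; rewrite -/u in c2.
have c3 := score_pairing u; rewrite ler_norml in c3; case/andP: c3 => c3 _.
have c4 : lam * norm1 th0 - lam * norm1 (th0 + v) <= lam * norm1 v.
  rewrite -mulrBr ler_wpM2l ?(ltW lam0) //.
  have := norm1D (th0 + v) (- v); rewrite norm1N addrK; lra.
have c5 : a * Qf v <= lam * norm1 u.
  rewrite /u norm1Z ger0_norm // mulrCA; apply: ler_wpM2l => //.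
  by apply: le_trans c4; have := Hv; lra.
have n0 := norm1_ge0 u.
have c6 : tau * norm1 u ^+ 2 <= kap / 2 * r ^+ 2.
  apply: (@le_trans _ _ (tau * (A * r) ^+ 2)).
    by rewrite ler_wpM2l // ler_sqr ?nnegrE // mulr_ge0 // ltW.
  by rewrite exprMn mulrA [tau * _]mulrC ler_wpM2r // sqr_ge0.
have c7 : kap / 2 * r ^+ 2 <= (S + lam) * norm1 u by lra.
have c8 : (S + lam) * norm1 u <= L * lam * (A * r) by apply: ler_pM => //; rewrite addr_ge0 // ltW.
have c9 : kap * r <= 2 * L * lam * A.
  rewrite -(ler_pM2r r0); move: c7 c8; rewrite expr2; lra.
by move: rL; rewrite ltr_pdivrMr // ltNge mulrC c9.
Qed.

End Lasso.

Section LassoError.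
Context {R : realType}.
Variables (p : nat) (th0 : 'rV[R]_p) (Qf : 'rV[R]_p -> R) (s : 'I_p -> R) (lam S : R).
Hypothesis lam0 : 0 < lam.
Hypothesis S0 : 0 <= S.
Hypothesis Hs : forall j, `|s j| <= S.
Hypothesis H1 : forall v : 'rV[R]_p, \sum_j s j * v ord0 j <= Qf v.
Hypothesis H2 : forall (v : 'rV[R]_p) a, 0 <= a <= 1 -> Qf (a *: v) <= a * Qf v.
Variable v : 'rV[R]_p.
Hypothesis Hv : Qf v + lam * norm1 (th0 + v) <= lam * norm1 th0.
Local Notation k := (#|vsupp th0|%:R : R).

Lemma lasso_zero_error : S <= lam / 2 -> #|vsupp th0| = 0%N -> norm1 v = 0 /\ norm2 v = 0.
Proof.
move=> S2 k0; have HT := lasso_cone lam0 Hs H1 Hv S2.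
have T0 : vsupp th0 = finset.set0 by apply/eqP; rewrite -cards_eq0; apply/eqP.
have z0 : norm1 (vrestr (vsupp th0) v) = 0.
  by rewrite /norm1 big1 // => j _; rewrite mxE T0 inE normr0.
have v1 : norm1 v = 0.
  apply/eqP; rewrite eq_le norm1_ge0 andbT (norm1_split (vsupp th0)).
  by rewrite z0 mulr0 in HT; rewrite z0 add0r.
split => //; rewrite /norm2 big1 ?sqrtr0 // => j _.
have := norm1_coord v j; rewrite v1.
by rewrite normr_le0 => /eqP ->; rewrite expr0n.
Qed.

(** In the cone |v|_1 is at most 4 times its part on the support. *)
Lemma lasso_norm_ratio : S <= lam / 2 -> norm1 v ^+ 2 <= 16 * k * norm2 v ^+ 2.
Proof.
move=> S2; have HT := lasso_cone lam0 Hs H1 Hv S2.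
have HS2 := norm1_restr_sq (vsupp th0) v; rewrite -norm2_sqr in HS2.
have HE := norm1_split (vsupp th0) v.
have y0 := norm1_ge0 (vrestr (vsupp th0) v); have z0 := norm1_ge0 v.
apply: (@le_trans _ _ (16 * norm1 (vrestr (vsupp th0) v) ^+ 2)); last by rewrite -mulrA ler_pM2l.
have h : norm1 v <= 4 * norm1 (vrestr (vsupp th0) v) by rewrite HE; move: HT; lra.
have -> : 16 * norm1 (vrestr (vsupp th0) v) ^+ 2 = (4 * norm1 (vrestr (vsupp th0) v)) ^+ 2 by ring.
by rewrite ler_sqr ?nnegrE // mulr_ge0.
Qed.

(** Applies [lasso_radius] with A = sqrt (Q k).  The summand 1 in r0 provides the
    strict inequality required there. *)
Lemma lasso_error (kap eta tau Q K : R) : 0 < kap -> 0 < Q -> (0 < #|vsupp th0|)%N -> 0 <= tau -> 0 <= K ->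
  (forall u : 'rV[R]_p, norm1 u <= eta ->
     \sum_j s j * u ord0 j + kap * (\sum_j u ord0 j ^+ 2) - tau * norm1 u ^+ 2 <= Qf u) ->
  Q * k * tau <= kap / 2 -> S <= K * lam -> norm1 v ^+ 2 <= Q * k * norm2 v ^+ 2 ->
  let r0 := 2 * (K + 1) * Num.sqrt Q / kap + 1 in
  Num.sqrt Q * r0 * (k * lam) <= eta ->
  norm2 v <= r0 * (Num.sqrt k * lam) /\ norm1 v <= Num.sqrt Q * r0 * (k * lam).
Proof.
move=> kap0 Q0 kn tau0 K0 H3 Qt SK vQ r0 re.
have k0 : 0 < k by rewrite ltr0n.
have sk0 : 0 < Num.sqrt k by rewrite sqrtr_gt0.
have sQ0 : 0 < Num.sqrt Q by rewrite sqrtr_gt0.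
have sQk : Num.sqrt (Q * k) = Num.sqrt Q * Num.sqrt k by rewrite sqrtrM // ltW.
have kk : Num.sqrt k * Num.sqrt k = k by rewrite -expr2 sqr_sqrtr // ltW.
have QkE : Num.sqrt (Q * k) ^+ 2 = Q * k by rewrite sqr_sqrtr // mulr_ge0 // ltW.
have vA : norm1 v <= Num.sqrt (Q * k) * norm2 v.
  rewrite -ler_sqr ?nnegrE ?norm1_ge0 ?mulr_ge0 ?sqrtr_ge0 //.
  by rewrite exprMn QkE.
have AE (r : R) : Num.sqrt (Q * k) * (r * (Num.sqrt k * lam)) = Num.sqrt Q * r * (k * lam).
  by rewrite sQk -[in RHS]kk; ring.
have sl : 0 < Num.sqrt k * lam by rewrite mulr_gt0.
have vr : norm2 v <= r0 * (Num.sqrt k * lam).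
  apply: (lasso_radius lam0 S0 kap0 Hs H2 H3 Hv (A := Num.sqrt (Q * k)) (L := K + 1)) => //.
  - by rewrite QkE.
  - by rewrite mulrDl mul1r lerD2r.
  - have -> : 2 * (K + 1) * lam * Num.sqrt (Q * k) / kap = (r0 - 1) * (Num.sqrt k * lam).
      by rewrite sQk /r0; field; rewrite gt_eqF.
    by rewrite mulrBl mul1r ltrBlDr ltrDl.
  - by rewrite AE.
split => //; apply: le_trans vA _.
by rewrite -AE ler_wpM2l // sqrtr_ge0.
Qed.

End LassoError.

Section TaylorLower.
Context {R : realType}.
Variables (l m dm : R -> R) (c : R).
Hypothesis dl : forall s : R, is_derive s (1:R) l (m s).

(** Mean value theorem and monotonicity of the derivative. *)
Lemma first_order_convex (t x : R) : {homo m : a b / a <= b} -> 0 <= l (t + x) - l t - m t * x.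
Proof.
move=> mm; have [y] := @mvt_between R l m t (t + x) (fun s _ => dl s).
rewrite addrAC subrr add0r => yI ->.
rewrite -mulrBl.
case: (leP 0 x) => x0.
  rewrite mulr_ge0 // subr_ge0 mm //; case/andP: yI => h _; apply: le_trans h.
  by rewrite le_min lexx lerDl x0.
rewrite mulr_le0 ?(ltW x0) // subr_le0 mm //; case/andP: yI => _ h; apply: le_trans h _.
by rewrite ge_max lexx gerDl ltW.
Qed.

(** Without its tangent and the parabola c (s - t)^2 / 2 the function l has, on the
    segment, a derivative of the sign of s - t; the mean value theorem concludes. *)
Lemma taylor_lower (t x : R) :
  (forall s, Num.min t (t + x) <= s <= Num.max t (t + x) -> is_derive s (1:R) m (dm s) /\ c <= dm s) ->
  c * x ^+ 2 / 2 <= l (t + x) - l t - m t * x.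
Proof.
move=> H.
have sub s s' : Num.min t (t + x) <= s <= Num.max t (t + x) ->
  Num.min t s <= s' <= Num.max t s -> Num.min t (t + x) <= s' <= Num.max t (t + x).
  case: (leP t (t + x)) => tx /andP[a b]; case: (leP t s) => ts /andP[e f]; lra.
have Hd s : Num.min t (t + x) <= s <= Num.max t (t + x) -> exists2 k, c <= k & m s - m t = k * (s - t).
  move=> sI; have [|y yI E] := @mvt_between R m dm t s; first by move=> y /(sub _ _ sI) /H [].
  by exists (dm y) => //; have [] := H y (sub _ _ sI yI).
pose h s := l s - (m t * s + c / 2 * (s - t) ^+ 2).
have dh s : is_derive s (1:R) h (m s - (m t + c * (s - t))).
  have d1 : is_derive s (1:R) (m t \*: (id : R -> R)) (m t *: (1:R)) by exact: is_deriveZ.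
  have d20 : is_derive s (1:R) ((id : R -> R) - cst t) (1 - 0).
    by apply: is_deriveB.
  have d2 : is_derive s (1:R) (((id : R -> R) - cst t) ^+ 2) ((2%:R * ((id : R -> R) - cst t) s ^+ 1) *: (1 - 0 : R)) by exact: is_deriveX.
  have d3 : is_derive s (1:R) ((c / 2) \*: (((id : R -> R) - cst t) ^+ 2)) ((c / 2) *: ((2%:R * ((id : R -> R) - cst t) s ^+ 1) *: (1 - 0 : R))) by exact: is_deriveZ.
  have dd := is_deriveB (dl s) (is_deriveD d1 d3).
  have E : m s - (m t *: (1:R) + (c / 2) *: ((2%:R * ((id : R -> R) - cst t) s ^+ 1) *: (1 - 0 : R))) = m s - (m t + c * (s - t)).
    rewrite -[m t *: 1]/(m t * 1) -[_ *: (_ *: _)]/(c / 2 * ((2%:R * (s - t) ^+ 1) * (1 - 0))) expr1; by field.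
  have -> : h = l - (m t \*: (id : R -> R) + (c / 2) \*: (((id : R -> R) - cst t) ^+ 2)).
    by apply/funext.
  by move: dd; rewrite E.
have [y yI] := @mvt_between R h _ t (t + x) (fun s _ => dh s).
rewrite /h [t + x - t]addrAC subrr add0r expr0n mulr0 addr0 => E.
have [k kc mk] := Hd y yI.
have : 0 <= (m y - (m t + c * (y - t))) * x.
  have -> : m y - (m t + c * (y - t)) = (k - c) * (y - t) by rewrite mulrBl -mk; ring.
  rewrite -mulrA mulr_ge0 ?subr_ge0 //.
  case: (leP 0 x) => x0.
    rewrite mulr_ge0 // subr_ge0; case/andP: yI => h1 _; apply: le_trans h1.
    by rewrite le_min lexx lerDl x0.
  rewrite mulr_le0 ?(ltW x0) // subr_le0; case/andP: yI => _ h1; apply: le_trans h1 _.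
  by rewrite ge_max lexx gerDl ltW.
by rewrite -E; lra.
Qed.

End TaylorLower.

(** * Unions, bounded variables, numerical tails *)

Section ProbTools.
Context d {O : measurableType d} {R : realType} (P : probability O R).

Lemma finite_union_bound (I : finType) (A : I -> set O) (e : R) :
  (forall i, measurable (A i)) -> (forall i, (P (A i) <= e%:E)%E) ->
  measurable [set o | exists i, A i o] /\ (P [set o | exists i, A i o] <= (#|I|%:R * e)%:E)%E.
Proof.
move=> mA PA.
have H (r : seq I) : measurable [set o | exists2 i, i \in r & A i o] /\
  (P [set o | exists2 i, i \in r & A i o] <= ((size r)%:R * e)%:E)%E.
  elim: r => [|i r [IHm IHP]].
    have -> : [set o | exists2 i, i \in [::] & A i o] = set0.
      by apply/seteqP; split => o //= [].
    by rewrite measure0 mul0r.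
  have -> : [set o | exists2 k, k \in i :: r & A k o] = A i `|` [set o | exists2 k, k \in r & A k o].
    apply/seteqP; split => o /=.
      by move=> [k]; rewrite in_cons => /orP[/eqP->|kr] Ak; [left|right; exists k].
    move=> [Ai|[k kr Ak]]; first by exists i; rewrite // mem_head.
    by exists k; rewrite // in_cons kr orbT.
  split; first exact: measurableU.
  apply: le_trans (measureU2 P (mA i) IHm) _.
  rewrite -[(size (i :: r))]/((size r).+1) -natr1 mulrDl mul1r EFinD [leRHS]addeC.
  exact: leeD (PA i) IHP.
have -> : [set o | exists i, A i o] = [set o | exists2 i, i \in enum I & A i o].
  apply/seteqP; split => o /= [i]; first by exists i; rewrite ?mem_enum.
  by move=> _ Ai; exists i.
by rewrite cardE; exact: H.
Qed.

Lemma ae_bounded_int (f : O -> R) c : measurable_fun setT f -> {ae P, forall o, `|f o| <= c} ->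
  P.-integrable setT (EFin \o f).
Proof.
move=> mf fc; apply/integrableP; split; first exact/measurable_EFinP.
apply: (@le_lt_trans _ _ (\int[P]_o (`|c|)%:E)%E).
  apply: ae_ge0_le_integral => //.
  - by apply: measurableT_comp => //; exact/measurable_EFinP.
  - apply: filterS fc => o h _ /=; rewrite lee_fin; exact: le_trans h (ler_norm _).
by rewrite (prob_integral_cst P (`|c|)%:E) ltry.
Qed.

Lemma Rintegral_lincomb (I : Type) (r : seq I) (a : I -> R) (f : I -> O -> R) :
  (forall i, P.-integrable setT (EFin \o f i)) ->
  P.-integrable setT (EFin \o (fun o => \sum_(i <- r) a i * f i o)) /\
  Rintegral P setT (fun o => \sum_(i <- r) a i * f i o) = \sum_(i <- r) a i * Rintegral P setT (f i).
Proof.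
move=> fi; elim: r => [|i r [IHi IHE]].
  rewrite big_nil; under eq_fun do rewrite big_nil; split.
    exact: (finite_measure_integrable_cst P 0 measurableT).
  rewrite /Rintegral integral0_eq // => x _; by rewrite big_nil.
have iz : P.-integrable setT (EFin \o (fun o => a i * f i o)).
  apply: (eq_integrable _ (fun o => (a i)%:E * (f i o)%:E)%E) => //; exact: (integrableZl measurableT _ (fi i)).
rewrite big_cons -IHE; under eq_fun do rewrite big_cons; split.
  by apply: (eq_integrable _ (fun o => (a i * f i o)%:E + (\sum_(i <- r) a i * f i o)%:E)%E) => //; exact: integrableD.
by rewrite RintegralD // RintegralZl.
Qed.

End ProbTools.

Section Tails.
Context {R : realType}.

Lemma three_quarters (e : R) : 3 / 4 * e = e / 4 + (e / 4 + e / 4).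
Proof. lra. Qed.

(** The crude decay 1/x suffices wherever a probability only has to be small, not
    summable. *)
Lemma expRN_le (x : R) : 0 < x -> expR (- x) <= x^-1.
Proof.
by move=> x0; rewrite expRN lef_pV2 ?posrE ?expR_gt0 //; have := expR_ge1Dx x; lra.
Qed.

(** The choice s = 1 makes the bound equal to 2 / p. *)
Lemma score_tail_large (p : nat) (eps : R) : 0 < eps -> 8 / eps <= p%:R ->
  p%:R * (2 * expR (- (2 * 1 ^+ 2 * ln p%:R))) <= eps / 4.
Proof.
move=> e0 pe; have p0 : 0 < p%:R :> R by apply: lt_le_trans pe; rewrite divr_gt0.
have -> : - (2 * 1 ^+ 2 * ln p%:R) = - ln p%:R + - ln p%:R :> R by ring.
rewrite expRD !expRN lnK ?posrE //.
have -> : p%:R * (2 * (p%:R^-1 * p%:R^-1)) = 2 * p%:R^-1 :> R by field; rewrite gt_eqF.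
rewrite ler_pdivrMr // in pe; rewrite ler_pdivrMr //; lra.
Qed.

(** For bounded p the probability is made small through the factor s instead, at
    the price of a larger multiple of the penalty. *)
Lemma score_tail_small (p b : nat) (eps s : R) : 0 < eps -> (1 < p)%N -> (p <= b)%N ->
  1 <= s -> 4 * b%:R / (eps * ln 2) <= s ->
  p%:R * (2 * expR (- (2 * s ^+ 2 * ln p%:R))) <= eps / 4.
Proof.
move=> e0 p1 pb s1 se.
have l2 : 0 < ln 2 :> R by rewrite ln_gt0 // ltr1n.
have lp : ln 2 <= ln p%:R :> R by rewrite ler_ln ?posrE ?ltr0n ?(ltn_trans _ p1) // ler_nat.
have x0 : 0 < 2 * s * ln 2 by rewrite !mulr_gt0 //; lra.
have b0 : 0 <= b%:R :> R by [].
have xx : 2 * s * ln 2 <= 2 * s ^+ 2 * ln p%:R.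
  have s20 : 0 <= 2 * s by lra.
  have ss : 2 * s <= 2 * s ^+ 2 by nra.
  exact: ler_pM s20 (ltW l2) ss lp.
apply: (@le_trans _ _ (b%:R * (2 * (2 * s * ln 2)^-1))).
  have ex0 : 0 <= 2 * expR (- (2 * s ^+ 2 * ln p%:R)) by rewrite mulr_ge0 // expR_ge0.
  apply: ler_pM => //; first by rewrite ler_nat.
  rewrite ler_pM2l //; apply: le_trans (expRN_le x0).
  by rewrite ler_expR lerN2.
rewrite ler_pdivrMr ?mulr_gt0 // in se.
have -> : b%:R * (2 * (2 * s * ln 2)^-1) = b%:R / (s * ln 2) by field; rewrite !gt_eqF //; lra.
rewrite ler_pdivrMr ?mulr_gt0 //; last by lra.
by move: se; rewrite [eps * ln 2]mulrC; nra.
Qed.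

(** The growth condition controls k^4 log(2p) / n, which is more than k^2 log(2p) / n:
    hence the exponent dominates (2 + h) log(2p) for any fixed h, the part 2 log(2p) pays for
    the p^2 entries and the rest gives exp(-h). *)
Lemma curvature_tail (p k n : nat) (c0 eps : R) : (0 < n)%N -> (0 < k)%N -> (0 < p)%N -> 0 < c0 -> 0 < eps ->
  1 <= ln (2 * p%:R) :> R ->
  k%:R ^+ 2 * Num.sqrt (2 * ln (2 * p%:R) / n%:R) <= Num.min 1 (2 * c0 / (2 + 4 / eps)) ->
  p%:R ^+ 2 * (2 * expR (- (c0 * (n%:R / k%:R ^+ 2)))) <= eps / 4.
Proof.
move=> n0 k0 p0 c00 e0 l1; set l := ln _ in l1 *; set h := 4 / eps; set e2 := Num.min _ _ => H.
have nR : 0 < n%:R :> R by rewrite ltr0n.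
have kR : 1 <= k%:R :> R by rewrite ler1n.
have pR : 0 < p%:R :> R by rewrite ltr0n.
have h0 : 0 < h by rewrite divr_gt0.
have l0 : 0 <= 2 * l / n%:R by rewrite divr_ge0 //; lra.
have H2 : k%:R ^+ 4 * (2 * l / n%:R) <= 2 * c0 / (2 + h).
  have y0 : 0 <= k%:R ^+ 2 * Num.sqrt (2 * l / n%:R) by rewrite mulr_ge0 ?sqrtr_ge0 ?exprn_ge0.
  have -> : k%:R ^+ 4 * (2 * l / n%:R) = (k%:R ^+ 2 * Num.sqrt (2 * l / n%:R)) ^+ 2.
    by rewrite exprMn sqr_sqrtr //; ring.
  move: H; rewrite le_min => /andP[a1 a2]; apply: le_trans a2.
  by rewrite expr2 ler_piMr.
have X : (2 + h) * l <= c0 * (n%:R / k%:R ^+ 2).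
  have k2 : 0 < k%:R ^+ 2 :> R by rewrite exprn_gt0 //; lra.
  rewrite mulrA ler_pdivlMr //.
  rewrite ler_pdivlMr in H2; last by lra.
  have H3 : k%:R ^+ 4 * l * (2 + h) <= c0 * n%:R.
    have := ler_wpM2r (ltW nR) H2.
    have -> : k%:R ^+ 4 * (2 * l / n%:R) * (2 + h) * n%:R = 2 * (k%:R ^+ 4 * l * (2 + h)) by field; rewrite gt_eqF.
    lra.
  apply: le_trans H3.
  have k24 : k%:R ^+ 2 <= k%:R ^+ 4 :> R by rewrite ler_weXn2l.
  have lh : 0 <= l * (2 + h) by rewrite mulr_ge0 //; lra.
  by have := ler_wpM2l lh k24; lra.
have step : expR (- (c0 * (n%:R / k%:R ^+ 2))) <= (2 * p%:R)^-1 * (2 * p%:R)^-1 * h^-1.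
  apply: (@le_trans _ _ (expR (- l + - l + - h))).
    rewrite ler_expR; have : h * 1 <= h * l by rewrite ler_wpM2l // ltW.
    move: X; lra.
  rewrite !expRD [expR (- l)]expRN /l lnK ?posrE ?mulr_gt0 //.
  by rewrite ler_pM2l ?expRN_le // mulr_gt0 // invr_gt0 mulr_gt0.
apply: (@le_trans _ _ (p%:R ^+ 2 * (2 * ((2 * p%:R)^-1 * (2 * p%:R)^-1 * h^-1)))).
  by rewrite ler_pM2l ?exprn_gt0 // ler_pM2l.
have -> : p%:R ^+ 2 * (2 * ((2 * p%:R)^-1 * (2 * p%:R)^-1 * h^-1)) = eps / 8.
  by rewrite /h; field; rewrite !gt_eqF.
lra.
Qed.

(** Whether p exceeds b decides which of the two ways of making the probability small
    is used; in both cases s is at most a constant that does not depend on p. *)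
Lemma score_tail (p b : nat) (eps : R) : 0 < eps -> (1 < p)%N -> 8 / eps <= b%:R ->
  let s2 := 1 + 4 * b%:R / (eps * ln 2) in
  exists s : R, [/\ 0 < s, s <= s2, p%:R * (2 * expR (- (2 * s ^+ 2 * ln p%:R))) <= eps / 4
    & s = 1 \/ (p <= b)%N].
Proof.
move=> e0 p1 bb s2.
have l2 : 0 < ln 2 :> R by rewrite ln_gt0 // ltr1n.
have s2' : 0 <= 4 * b%:R / (eps * ln 2) by rewrite divr_ge0 ?mulr_ge0 // ltW.
have s21 : 1 <= s2 by rewrite /s2; lra.
case: (leqP b p) => pb.
  exists 1; split => //; last by left.
  by apply: score_tail_large => //; apply: le_trans bb _; rewrite ler_nat.
exists s2; split => //; [lra| |by right; exact: ltnW].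
by apply: (@score_tail_small _ b) => //; [exact: ltnW|rewrite /s2; lra].
Qed.

(** tau1 is the allowed fluctuation of the Gram entries and tau2 that of the
    average nuisance error.  Both are of order 1/k because they multiply |nu|_1^2, which is
    of order k |nu|_2^2; Cq is the constant in front of tau2 in the curvature bound. *)
Lemma tuning_constants (kap Q k Cq : R) : 0 < kap -> 0 < Q -> 0 < k -> 0 <= Cq ->
  let tau1 := kap / (2 * Q * k) in let tau2 := kap / (4 * Q * k * (Cq + 1)) in
  [/\ 0 < tau1, 0 < tau2, Q * k * (tau1 / 2 + Cq * tau2) <= kap / 2,
    forall g e, k * g <= e * kap / (4 * Q * (Cq + 1)) -> g / tau2 <= e
  & forall n u, 0 < u -> n * tau1 ^+ 2 / (32 * u ^+ 2) = kap ^+ 2 / (128 * Q ^+ 2 * u ^+ 2) * (n / k ^+ 2)].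
Proof.
move=> kap0 Q0 k0 Cq0 tau1 tau2.
have c1 : 0 < Cq + 1 by lra.
have d1 : 0 < 2 * Q * k by rewrite !mulr_gt0.
have d2 : 0 < 4 * Q * k * (Cq + 1) by rewrite !mulr_gt0.
split; [exact: divr_gt0|exact: divr_gt0| | |].
- have -> : Q * k * (tau1 / 2 + Cq * tau2) = kap / 4 + kap / 4 * (Cq / (Cq + 1)).
    by rewrite /tau1 /tau2; field; rewrite !gt_eqF.
  have x1 : Cq / (Cq + 1) <= 1 by rewrite ler_pdivrMr // mul1r; lra.
  have : kap / 4 * (Cq / (Cq + 1)) <= kap / 4 * 1 by rewrite ler_wpM2l //; lra.
  lra.
- move=> g e h; rewrite /tau2 invf_div mulrA ler_pdivrMr //.
  move: h; rewrite ler_pdivlMr ?mulr_gt0 //; lra.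
move=> n u u0; rewrite /tau1; field; by rewrite !gt_eqF.
Qed.

End Tails.

(** * Almost sure properties of the design *)

Section Model.
Context d {Omega : measurableType d} {R : realType} {P : probability Omega R}.
Variable M : model P.
Variable Gn : nat -> set ('rV[R]_(dimZ M) -> 'rV[R]_(dimG M)).
Variable Theta : forall n, set 'rV[R]_(dimP M n).
Variables (Cmin Bmin U : R).
Hypothesis Hreg : regular_model M.
Hypothesis Hmom : moment_condition M.
Hypothesis Hloss : loss_primitive M.
Hypothesis HQ : Q_well_defined M Gn.
Hypothesis Hmono : monotone_moment M.
Hypothesis Hid : identification M Cmin.
Hypothesis Hcurv : restricted_curvature M Bmin.
Hypothesis Hbd : bounded_design M Gn Theta U.
Hypothesis Gn0 : Gn 0%N (g0 M).
Hypothesis mg0 : measurable_fun setT (g0 M : bvec R (dimZ M) -> bvec R (dimG M)).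
Local Notation zp := (@zpart _ _ _ _ M).
Local Notation bW := (bvec R (dimW M)).
Local Notation bZ := (bvec R (dimZ M)).
Local Notation bG := (bvec R (dimG M)).
Local Notation t n z := (lin_index (theta0 M n) (g0 M) z).
Local Notation gap g z := (norm1 (g z - g0 M z)).

Lemma measurable_Wv : measurable_fun setT (W M : Omega -> bvec R (dimW M)).
Proof. exact: measurable_funP. Qed.

Lemma measurable_zpart : measurable_fun setT (zp : bvec R (dimW M) -> bvec R (dimZ M)).
Proof.
apply: bvec_measurableP => // j.
rewrite (_ : (fun x => _) = (fun x : bvec R (dimW M) => (x : 'rV[R]_(dimW M)) ord0 (zsel M j))).
  exact: coord_measurable.
by apply/funext => w; rewrite /zpart mxE.
Qed.

Lemma measurable_Z : measurable_fun setT (Z M : Omega -> bvec R (dimZ M)).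
Proof. exact: (measurableT_comp measurable_zpart measurable_Wv). Qed.

Lemma measurable_Lam d1 (T : measurableType d1) n (z : T -> bvec R (dimZ M)) (g : T -> bvec R (dimG M)) j :
  measurable_fun setT z -> measurable_fun setT g ->
  measurable_fun setT (fun x => Lam M n (z x) (g x) ord0 j).
Proof.
move=> mz mg; have [_ _ _ _ mL] := Hreg.
have h := measurableT_comp (mL n) (measurable_fun_pair mz mg).
exact: (measurableT_comp (coord_measurable (n := dimP M n) j) h).
Qed.

Lemma measurable_index d1 (T : measurableType d1) n (theta : 'rV[R]_(dimP M n))
    (z : T -> bvec R (dimZ M)) (g : T -> bvec R (dimG M)) :
  measurable_fun setT z -> measurable_fun setT g ->
  measurable_fun setT (fun x => dotv (Lam M n (z x) (g x)) theta).
Proof.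
by move=> mz mg; apply: measurable_sum => j; apply: measurable_funM => //; exact: measurable_Lam.
Qed.

(** The moment function is only assumed to be measurable for w in domW; setting it to 0
    outside makes it measurable everywhere and changes nothing almost surely. *)
Definition mom_ext (w : bvec R (dimW M)) t (g : bvec R (dimG M)) : R :=
  if w \in (domW M : set (bvec R (dimW M))) then mom M w t g else 0.

Lemma mom_extE w t g : domW M w -> mom_ext w t g = mom M w t g.
Proof. by move=> wD; rewrite /mom_ext mem_set. Qed.

Lemma measurable_mom_ext d1 (T : measurableType d1) (w : T -> bvec R (dimW M)) (t : T -> R)
   (g : T -> bvec R (dimG M)) :
  measurable_fun setT w -> measurable_fun setT t -> measurable_fun setT g ->
  measurable_fun setT (fun x => mom_ext (w x) (t x) (g x)).
Proof.
move=> mw mt mg; have [_ _ mm _ _] := Hreg; have [[oW _ _ _] _ _ _] := Hbd.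
pose D := [set x : bvec R (dimW M) * R * bvec R (dimG M) | domW M x.1.1].
have mD : measurable D.
  rewrite -[D]setTI; apply: (measurableT_comp (f := fst) (g := fst)) => //.
  exact: measurable_open_bvec.
have m1 := (measurable_restrict (fun x : bvec R (dimW M) * R * bvec R (dimG M) => mom M x.1.1 x.1.2 x.2) mD measurableT).1.
rewrite setTI in m1; have {}m1 := m1 mm.
apply: (eq_measurable_fun (fun x => ((fun x : bvec R (dimW M) * R * bvec R (dimG M) => mom M x.1.1 x.1.2 x.2) \_ D) (w x, t x, g x))).
  by move=> x _; rewrite patchE /mom_ext /D.
apply: (measurableT_comp m1); apply: measurable_fun_pair => //.
exact: measurable_fun_pair.
Qed.

Lemma ae_domW : {ae P, forall o, domW M (Wv M o)}.
Proof.
have [[_ _ sub _] _ _ _] := Hbd.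
have [D hD] := rV_dense_seq R (dimW M).
have := @law_support_ae _ _ _ P _ D (Wv M) _ hD.
move=> /(_ _) H; apply: filterS (H _) => [x /sub //|V oV].
by rewrite -[_ @^-1` _]setTI; apply: measurable_Wv => //; exact: measurable_open_bvec.
Qed.

Lemma preimage_open_bvec d1 (T : measurableType d1) n (f : T -> bvec R n) (V : set 'rV[R]_n) :
  measurable_fun setT f -> open V -> measurable (f @^-1` V).
Proof.
by move=> mf oV; rewrite -[_ @^-1` _]setTI; apply: mf => //; exact: measurable_open_bvec.
Qed.

Lemma ae_suppZ : {ae P, forall o, @suppZ _ _ _ _ M (Z M o)}.
Proof.
have [D hD] := rV_dense_seq R (dimZ M).
apply: (@law_support_ae _ _ _ P _ D (Z M) _ hD) => V oV; exact: (preimage_open_bvec measurable_Z oV).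
Qed.

Lemma ae_law_G (g : 'rV[R]_(dimZ M) -> 'rV[R]_(dimG M)) :
  measurable_fun setT (g : bvec R (dimZ M) -> bvec R (dimG M)) ->
  {ae P, forall o, law_support P (fun o => g (Z M o)) (g (Z M o))}.
Proof.
move=> mg; have [D hD] := rV_dense_seq R (dimG M).
apply: (@law_support_ae _ _ _ P _ D (fun o => g (Z M o)) _ hD) => V oV.
exact: (preimage_open_bvec (measurableT_comp mg measurable_Z) oV).
Qed.

Lemma ae_domG n g : Gn n g ->
  measurable_fun setT (g : bvec R (dimZ M) -> bvec R (dimG M)) ->
  {ae P, forall o, domG M (g (Z M o))}.
Proof.
move=> Gg mg; have [[_ _ _ [_ _ _ _ sub]] _ _ _] := Hbd.
by apply: filterS (ae_law_G mg) => x /(sub n g Gg).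
Qed.

Definition fibre (z : 'rV[R]_(dimZ M)) : set (bvec R (dimW M)) :=
  [set w | domW M w /\ zp w = z].

Lemma measurable_fibre z : measurable (fibre z).
Proof.
have [[oW _ _ _] _ _ _] := Hbd.
apply: measurableI; first exact: measurable_open_bvec.
rewrite [X in measurable X](_ : _ = \bigcap_j ((fun w : bvec R (dimW M) => zp w ord0 j) @^-1` [set z ord0 j])).
  apply: fin_bigcap_measurable => // j _.
  rewrite -[X in measurable X]setTI.
  by apply: (measurableT_comp (coord_measurable (n := dimZ M) j) measurable_zpart).
apply/seteqP; split => w /=; first by move=> h j _ /=; rewrite h.
by move=> h; apply/rowP => j; exact: (h j I).
Qed.

(** The conditional law of W given Z lives on the set of w in domW with that
    subvector, so that integrals against it only involve m at the given z. *)
Lemma ae_kernel_fibre : {ae P, forall o, kappa M (Z M o) (~` fibre (Z M o)) = 0%E}.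
Proof.
have [_ HC _ _ _] := Hreg; have [[oW _ _ _] _ _ _] := Hbd.
have mD : measurable (domW M : set (bvec R (dimW M))) by exact: measurable_open_bvec.
have N1 := @kernel_concentrated _ Omega R P _ _ (dimZ M) (W M) (zp) (kappa M) measurable_Wv measurable_zpart HC.
have N2 : {ae P, forall o, [set: bvec R (dimZ M)] (Z M o) -> kappa M (Z M o) (~` (domW M : set (bvec R (dimW M)))) = 0%E}.
  apply: (kernel_ae_null measurable_Z HC) => //; first exact: measurableC.
  rewrite preimage_setT setIT; have [N [mN PN sub]] := ae_domW.
  apply/eqP; rewrite eq_le measure_ge0 andbT -PN; apply: le_measure; rewrite ?inE //.
  by rewrite -[X in measurable X]setTI; apply: measurable_Wv => //; exact: measurableC.
apply: filterS2 N1 N2 => o h1 h2.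
have {}h2 := h2 I.
rewrite /fibre -/((domW M : set (bvec R (dimW M))) `&` [set w | zp w = Z M o]) setCI.
apply/eqP; rewrite eq_le measure_ge0 andbT.
have mE : measurable [set w : bvec R (dimW M) | zp w = Z M o].
  rewrite [X in measurable X](_ : _ = \bigcap_j ((fun w : bvec R (dimW M) => zp w ord0 j) @^-1` [set Z M o ord0 j])).
    apply: fin_bigcap_measurable => // j _.
    rewrite -[X in measurable X]setTI.
    by apply: (measurableT_comp (coord_measurable (n := dimZ M) j) measurable_zpart).
  apply/seteqP; split => w /=; first by move=> h j _ /=; rewrite h.
  by move=> h; apply/rowP => j; exact: (h j I).
apply: le_trans (measureU2 _ _ _) _; [exact: measurableC|exact: measurableC|].
apply: (@le_trans _ _ (0 + 0)%E); last by rewrite adde0.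
by apply: leeD; rewrite le_eqVlt; apply/orP; left; apply/eqP; [exact: h2|exact: h1].
Qed.

(** The multiples of theta0 belong to the restricted set: theta0 and its negative
    vanish off the support. *)
Lemma cone_line n (c : R) : cone_segments (theta0 M n) (c *: theta0 M n).
Proof.
exists 2^-1, ((2 * (c - 1)) *: theta0 M n); split.
- by apply/andP; split; lra.
- rewrite /cone /= [X in X <= _](_ : _ = 0).
    by rewrite mulr_ge0 // norm1_ge0.
  rewrite /norm1 big1 // => j _; rewrite !mxE !inE negbK.
  by case: eqP => [->|_]; rewrite ?mulr0 normr0.
by rewrite scalerA mulrA mulVf ?mul1r ?pnatr_eq0 // scalerBl scale1r addrC subrK.
Qed.

Lemma index_scale n (c : R) z : lin_index (c *: theta0 M n) (g0 M) z = c * t n z.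
Proof. by rewrite /lin_index dotvZr. Qed.

Lemma curvature_lower n z (c : R) : suppZ (M:=M) z ->
  (Bmin%:E <= \int[kappa M z]_w (mom_t w (c * t n z) (g0 M z))%:E)%E.
Proof.
move=> zs; have [_ _ /(_ n z zs)] := Hcurv => /le_trans; apply.
apply: ereal_inf_lbound; exists (c *: theta0 M n); first exact: cone_line.
by rewrite index_scale.
Qed.

(** If both indices solve the conditional moment equation, m is almost surely constant
    in t between them by monotonicity, so its slope at the midpoint vanishes.  The midpoint
    is the index of some multiple of theta0, hence belongs to the restricted set, where the
    slope has conditional mean at least Bmin > 0. *)
Lemma index_unique_lt z n n' : suppZ (M:=M) z -> domG M (g0 M z) ->
  kappa M z (~` fibre z) = 0%E -> t n z < t n' z -> False.
Proof.
move=> zs zG zf tn.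
pose K : {measure set (bvec R (dimW M)) -> \bar R} := kappa M z.
have [B0 _ _] := Hcurv.
have mF : measurable (fibre z) by exact: measurable_fibre.
have mm (s : R) : measurable_fun (fibre z) (fun w => (mom M w s (g0 M z))%:E).
  apply/measurable_EFinP.
  apply: (@eq_measurable_fun _ _ _ _ _ (fun w => mom_ext w s (g0 M z))).
    by move=> w; rewrite inE => -[wD _]; rewrite mom_extE.
  by apply: measurable_funTS; apply: measurable_mom_ext => //.
have z0 k : (\int[K]_(w in fibre z) (mom M w (t k z) (g0 M z))%:E = 0)%E.
  by rewrite -integral_full_set //; exact: Hmom.
have ik k : K.-integrable (fibre z) (fun w => (mom M w (t k z) (g0 M z))%:E).
  exact: integral0_integrable.
have dz : (\int[K]_(w in fibre z) ((mom M w (t n' z) (g0 M z))%:E - (mom M w (t n z) (g0 M z))%:E) = 0)%E.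
  by rewrite integralB // !z0 sube0.
have md : measurable_fun (fibre z) (fun w => ((mom M w (t n' z) (g0 M z))%:E - (mom M w (t n z) (g0 M z))%:E)%E).
  by apply: emeasurable_funB.
have [/(_ _) dae _] := @ae_eq_integral_abs _ _ _ K _ mF _ md.
have {dae} dae : ae_eq K (fibre z) (fun w => ((mom M w (t n' z) (g0 M z))%:E - (mom M w (t n z) (g0 M z))%:E)%E) (cst 0%E).
  apply: dae; rewrite -[RHS]dz; apply: eq_integral => w; rewrite inE => -[wD _].
  by rewrite gee0_abs // sube_ge0 // lee_fin Hmono // ltW.
pose A := [set w | fibre z w /\ mom M w (t n' z) (g0 M z) = mom M w (t n z) (g0 M z)].
have mA : measurable A.
  rewrite (_ : A = fibre z `&` (fun w => ((mom M w (t n' z) (g0 M z))%:E - (mom M w (t n z) (g0 M z))%:E)%E) @^-1` [set 0%E]).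
    exact: md.
  apply/seteqP; split => w /= [wf h]; split => //; first by rewrite h -EFinB subrr.
  by move: h; rewrite -EFinB => -[/eqP]; rewrite subr_eq0 => /eqP.
have A0 : K (~` A) = 0%E.
  have [N [mN KN sub]] := dae.
  apply/eqP; rewrite eq_le measure_ge0 andbT.
  apply: (@le_trans _ _ (K (~` fibre z `|` N))).
    apply: le_measure; rewrite ?inE.
    - exact: measurableC.
    - by apply: measurableU => //; exact: measurableC.
    move=> w /= nA; have [wf|] := pselect (fibre z w); last by left.
    right; apply: sub => /= h; apply: nA; split => //.
    by move: (h wf); rewrite -EFinB => -[/eqP]; rewrite subr_eq0 => /eqP.
  apply: le_trans (measureU2 _ _ mN) _; first exact: measurableC.
  apply: (@le_trans _ _ (0 + 0)%E); last by rewrite adde0.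
  by apply: leeD; rewrite le_eqVlt; apply/orP; left; apply/eqP; [exact: zf|exact: KN].
(* At the midpoint the constancy of m holds on a neighbourhood, so that the derivative is 0. *)
pose s := (t n z + t n' z) / 2.
have sn : t n z < s by rewrite /s; lra.
have sn' : s < t n' z by rewrite /s; lra.
have d0 w : A w -> mom_t w s (g0 M z) = 0.
  move=> [[wD _] weq].
  have cst_ : \forall x \near s, mom M w x (g0 M z) = cst (mom M w (t n z) (g0 M z)) x.
    near=> x.
    have x1 : t n z <= x by near: x; exact: lt_le_nbhsr.
    have x2 : x <= t n' z by near: x; exact: lt_le_nbhsl.
    apply/eqP; rewrite eq_le /= -{1}weq; apply/andP; split; exact: Hmono.
  by rewrite /mom_t derive1E (near_eq_derive _ cst_) derive_cst.
have int0 : (\int[K]_w (mom_t w s (g0 M z))%:E = 0)%E.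
  rewrite (integral_full_set _ mA A0) (eq_integral (cst 0%E)) ?integral0 //.
  by move=> x; rewrite inE => /d0 ->.
have [k tk] : exists k, t k z != 0.
  have [t0|] := eqVneq (t n z) 0; last by exists n.
  by exists n'; rewrite gt_eqF // -t0.
(* At least one of the two indices is nonzero, so that s is a multiple of it. *)
have := @curvature_lower k z (s / t k z) zs; rewrite divfK // -/K int0 lee_fin leNgt B0 //.
Unshelve. all: by end_near.
Qed.

(** The sets domT and domW do not vary with n, but the index does; this makes the
    support of the index independent of n, whence the margin in [good_margin] is uniform. *)
Lemma ae_index_const : {ae P, forall o, forall n, t n (Z M o) = t 0%N (Z M o)}.
Proof.
apply: filterS3 ae_suppZ (ae_domG Gn0 mg0) ae_kernel_fibre => o h1 h2 h3 n.
apply/eqP; rewrite eq_le !leNgt; apply/andP; split; apply/negP => h.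
  exact: (index_unique_lt h1 h2 h3 h).
exact: (index_unique_lt h1 h2 h3 h).
Qed.

(** * Typical values and the margin *)

Definition suppG : set 'rV[R]_(dimG M) := law_support P (fun o => g0 M (Z M o)).
Definition suppT : set R := law_support P (fun o => t 0%N (Z M o)).

(** Membership in the supports, rather than in domG and domT, since the supports are
    compact. *)
Definition goodZ (z : 'rV[R]_(dimZ M)) : Prop :=
  [/\ suppZ (M:=M) z, suppG (g0 M z), suppT (t 0%N z) & forall n, t n z = t 0%N z].

Definition goodW : set bW := [set w | domW M w /\ goodZ (zp w)].

Lemma measurable_t n : measurable_fun setT (fun z : bZ => t n z).
Proof. exact: measurable_index. Qed.

Lemma measurable_tZ n : measurable_fun setT (fun o => t n (Z M o)).
Proof. exact: (measurableT_comp (measurable_t n) measurable_Z). Qed.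

Lemma measurable_goodZ : measurable (goodZ : set bZ).
Proof.
have [[_ _ _ [_ _ _ _ _]] _ _ _] := Hbd.
have cl n (K : set 'rV[R]_n) : closed K -> measurable (K : set (bvec R n)).
  by move=> cK; rewrite -(setCK K); apply: measurableC; apply: measurable_open_bvec; exact: closed_openC.
rewrite (_ : (goodZ : set bZ) = suppZ (M:=M) `&` (g0 M : bZ -> bG) @^-1` suppG `&`
   (fun z : bZ => t 0%N z) @^-1` suppT `&` \bigcap_n ((fun z : bZ => t n z - t 0%N z) @^-1` [set 0])).
  apply: measurableI; [apply: measurableI; [apply: measurableI|]|].
  - by apply: cl; exact: law_support_closed.
  - rewrite -[X in measurable X]setTI; apply: mg0 => //; apply: cl; exact: law_support_closed.
  - rewrite -[X in measurable X]setTI; apply: measurable_t => //.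
    apply: measurable_realfun.closed_measurable; exact: law_support_closed.
  - apply: bigcap_measurable => // n _; rewrite -[X in measurable X]setTI.
    by apply: (measurable_funB (measurable_t n) (measurable_t 0%N)).
apply/seteqP; split => z.
  move=> [h1 h2 h3 h4]; (split; [split; [split|]|]) => // n _; by rewrite /preimage /= h4 subrr.
move=> [[[h1 h2] h3] h4]; split => // n; have /eqP := h4 n I; by rewrite subr_eq0 => /eqP.
Qed.

Lemma measurable_goodW : measurable goodW.
Proof.
have [[oW _ _ _] _ _ _] := Hbd.
apply: measurableI; first exact: measurable_open_bvec.
rewrite -[X in measurable X]setTI; apply: measurable_zpart => //; exact: measurable_goodZ.
Qed.

Lemma U_ge0 : 0 <= U.
Proof.
by have [_ /(_ 0%N)[h1 /(_ _ h1)] h _ _] := Hbd; apply: le_trans h; exact: norm1_ge0.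
Qed.

Lemma theta0_le n : norm1 (theta0 M n) <= U.
Proof. by have [_ /(_ n)[h1 /(_ _ h1)] h _ _] := Hbd. Qed.

Lemma suppG_domG : suppG `<=` domG M.
Proof.
by have [[_ _ _ [_ _ _ _ sub]] _ _ _] := Hbd; exact: sub Gn0.
Qed.

Lemma suppT_domT : suppT `<=` domT M.
Proof. by have [[_ _ _ [_ sub _ _ _]] _ _ _] := Hbd; exact: (sub 0%N). Qed.

Lemma ae_goodZ : {ae P, forall o, goodZ (Z M o)}.
Proof.
have [D hD] := R_dense_seq R.
have hT : {ae P, forall o, suppT (t 0%N (Z M o))}.
  apply: (@law_support_ae _ _ _ P _ D (fun o => t 0%N (Z M o)) _ hD) => V oV.
  rewrite -[X in measurable X]setTI; apply: (measurable_tZ 0%N) => //.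
  exact: measurable_realfun.open_measurable.
apply: filterS2 (filterI ae_suppZ (ae_law_G mg0)) (filterI hT ae_index_const).
by move=> o [h1 h2] [h3 h4]; split.
Qed.

Lemma ae_goodW : {ae P, forall o, goodW (Wv M o)}.
Proof. by apply: filterS2 ae_domW ae_goodZ => o h1 h2; split. Qed.

(** The support of g0(Z) is compact because domG is bounded, that of the index because
    it is bounded by U^2; compact subsets of open sets have a margin. *)
Lemma good_margin : exists2 eta : R, 0 < eta & forall z, goodZ z ->
  ball (g0 M z) eta `<=` domG M /\ forall n, ball (t n z) eta `<=` domT M.
Proof.
have [[_ _ _ [oT _ oG bG' _]] _ _ HL] := Hbd.
have cG : compact suppG.
  apply: bounded_closed_compact; last exact: law_support_closed.
  case: bG' => m [mr H]; exists m; split => // x mx y /suppG_domG; exact: H.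
have [e1 e10 H1] := compact_margin cG oG suppG_domG.
have sub : suppT `<=` `[- (U ^+ 2), U ^+ 2].
  have tb : {ae P, forall o, `|t 0%N (Z M o)| <= U ^+ 2}.
    apply: filterS2 ae_suppZ (ae_domG Gn0 mg0) => o hz hG.
    apply: le_trans (dotv_bound _ (c := U) _) _.
      by move=> j; have [_ _ []] := HL 0%N _ _ j hz hG.
    by rewrite expr2 ler_wpM2l ?U_ge0 // theta0_le.
  have [N [mN PN subN]] := tb.
  move=> x xS; apply: contrapT => /= xn.
  pose V := ~` `[- (U ^+ 2), U ^+ 2].
  have oV : open V by apply: closed_openC; exact: interval_closed.
  have := xS V oV xn; apply/negP; rewrite -leNgt -PN; apply: le_measure; rewrite ?inE //.
    rewrite -[X in measurable X]setTI; apply: (measurable_tZ 0%N) => //.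
    exact: measurable_realfun.open_measurable.
  move=> o; rewrite /V /= in_itv /= => no; apply: subN => /=; by rewrite ler_norml.
have cT : compact suppT.
  apply: subclosed_compact sub; [exact: law_support_closed|exact: segment_compact].
have [e2 e20 H2] := compact_margin cT oT suppT_domT.
exists (Num.min e1 e2); first by rewrite lt_min e10.
move=> z [h1 h2 h3 h4]; split.
  apply: subset_trans (H1 _ h2); apply: le_ball; by rewrite ge_min lexx.
move=> n; rewrite h4; apply: subset_trans (H2 _ h3); apply: le_ball; by rewrite ge_min lexx orbT.
Qed.

Lemma good_domG z : goodZ z -> domG M (g0 M z).
Proof. by move=> [_ h _ _]; exact: suppG_domG. Qed.

Lemma good_domT z n : goodZ z -> domT M (t n z).
Proof. by move=> [_ _ h ->]; exact: suppT_domT. Qed.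

(** The j-th coordinate of the gradient in theta, at theta0, of the loss at one
    observation. *)
Definition score_at n (g : 'rV[R]_(dimZ M) -> 'rV[R]_(dimG M)) (j : 'I_(dimP M n)) (w : bW) : R :=
  Lam M n (zp w) (g (zp w)) ord0 j * mom_ext w (lin_index (theta0 M n) g (zp w)) (g (zp w)).

Lemma measurable_score_at n g j : measurable_fun setT (g : bZ -> bG) -> measurable_fun setT (score_at (n:=n) g j).
Proof.
move=> mg.
have measurable_nuisance : measurable_fun setT (fun w : bW => g (zp w) : bG) by exact: (measurableT_comp mg measurable_zpart).
apply: measurable_funM; first exact: (measurable_Lam _ measurable_zpart measurable_nuisance).
apply: measurable_mom_ext => //.
exact: (measurable_index _ measurable_zpart measurable_nuisance).
Qed.

Lemma score0_bound n j w : goodW w -> `|score_at (n:=n) (g0 M) j w| <= U ^+ 2.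
Proof.
move=> [wD zg]; have [_ _ Hm HL] := Hbd; have [zs _ _ _] := zg.
rewrite /score_at mom_extE // normrM expr2; apply: ler_pM => //.
  by have [_ _ []] := HL n _ _ j zs (good_domG zg).
by have [_ _ _ _ []] := Hm _ _ _ wD (good_domT n zg) (good_domG zg).
Qed.

(** Conditionally on Z the factor Lambda_j is constant and the moment condition
    applies. *)
Lemma score0_mean n (j : 'I_(dimP M n)) : (\int[P]_o (score_at (n:=n) (g0 M) j (Wv M o))%:E = 0)%E.
Proof.
have [_ HC _ _ _] := Hreg; have [_ _ Hm HL] := Hbd.
(* Clipping makes the score bounded, as disintegration requires, without changing it almost surely. *)
pose F w := clip (U ^+ 2) (score_at (n:=n) (g0 M) j w).
have mF : measurable_fun setT F by apply: measurable_clip; exact: measurable_score_at.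
have FC w : `|F w| <= U ^+ 2 by apply: clip_le; exact: sqr_ge0.
have [E1 mk] := @disintegration_bounded _ _ _ P _ _ bW bZ (W M) (Z M) (kappa M) measurable_Wv measurable_Z HC F _ mF FC.
transitivity (\int[P]_o (F (Wv M o))%:E)%E.
  apply: ae_eq_integral => //.
  - apply/measurable_EFinP; exact: (measurableT_comp (measurable_score_at (n:=n) j mg0) measurable_Wv).
  - apply/measurable_EFinP; exact: (measurableT_comp mF measurable_Wv).
  apply: filterS ae_goodW => o go _; congr (_%:E).
  by rewrite /F clip_id //; exact: score0_bound.
rewrite E1 -[RHS](integral0 P setT); apply: ae_eq_integral => //.
apply: filterS2 ae_goodZ ae_kernel_fibre => o zg h _ /=.
set z := Z M o in zg h *.
have mf : measurable (fibre z) by exact: measurable_fibre.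
(* On the fibre of z the integrand is Lambda_j(z, g0(z)) times m at the index of z. *)
pose K : {measure set bW -> \bar R} := kappa M z.
rewrite -/K (@integral_full_set _ _ _ K _ (fibre z)) //.
rewrite (eq_integral (fun w : bW => (Lam M n z (g0 M z) ord0 j)%:E * (mom M w (t n z) (g0 M z))%:E)%E).
  have mm : measurable_fun (fibre z) (fun w : bW => (mom M w (t n z) (g0 M z))%:E).
    apply/measurable_EFinP.
    apply: (@eq_measurable_fun _ _ _ _ _ (fun w => mom_ext w (t n z) (g0 M z))).
      by move=> w; rewrite inE => -[wD _]; rewrite mom_extE.
    by apply: measurable_funTS; apply: measurable_mom_ext.
  have z0 : (\int[K]_(w in fibre z) (mom M w (t n z) (g0 M z))%:E = 0)%E.
    by rewrite -integral_full_set //; apply: Hmom; case: zg.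
  rewrite integralZl // ?z0 ?mule0 //.
  exact: integral0_integrable.
move=> w; rewrite inE => -[wD wz]; rewrite -EFinM; congr (_%:E).
rewrite /F clip_id; first by rewrite /score_at wz mom_extE.
by apply: score0_bound; split => //; rewrite wz.
Qed.

Definition mom_quotient (k : nat) (w : bW) : R :=
  k.+1%:R * (mom_ext w (t 0%N (zp w) + k.+1%:R^-1) (g0 M (zp w)) - mom_ext w (t 0%N (zp w)) (g0 M (zp w))).

(** The slope m_t at the truth, which has no reason to be measurable as a derivative:
    it is obtained as a limit of difference quotients, clipped to [0, U], and agrees with
    mom_t at typical points. *)
Definition slope0 (w : bW) : R := Num.max 0 (Num.min U (fine (limn_esup (fun k => (mom_quotient k w)%:E)))).

Lemma slope0_ge0 w : 0 <= slope0 w. Proof. by rewrite /slope0 le_max lexx. Qed.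
Lemma slope0_le w : slope0 w <= U. Proof. by rewrite /slope0 ge_max ge_min lexx U_ge0. Qed.

Lemma measurable_slope0 : measurable_fun setT slope0.
Proof.
apply: measurable_maxr => //; apply: measurable_minr => //.
apply: (measurableT_comp (f := fine)) => //.
apply: measurable_fun_limn_esup => k; apply/measurable_EFinP.
have mz := measurable_zpart.
have mt0 : measurable_fun setT (fun w : bW => t 0%N (zp w)) by exact: (measurableT_comp (measurable_t 0%N) mz).
have measurable_nuisance : measurable_fun setT (fun w : bW => g0 M (zp w) : bG) by exact: (measurableT_comp mg0 mz).
apply: measurable_funM => //; apply: measurable_funB; apply: measurable_mom_ext => //.
exact: measurable_funD.
Qed.

Lemma slope0_good w n : goodW w -> slope0 w = mom_t (M:=M) w (t n (zp w)) (g0 M (zp w)).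
Proof.
move=> [wD zg]; have [_ _ Hm _] := Hbd; have [_ _ _ ->] := zg.
set s := t 0%N (zp w); set g := g0 M (zp w).
have gG : domG M g by exact: good_domG.
have sT : domT M s by exact: good_domT.
have [dm _ _ _ [_ _ bt _ _]] := Hm _ _ _ wD sT gG.
have cq : mom_quotient k w @[k --> \oo] --> mom_t (M:=M) w s g.
  have dfc : h^-1 *: (((fun x => mom M w x g) \o shift s) (h *: 1) - mom M w s g) @[h --> 0^'] --> mom_t (M:=M) w s g.
    by rewrite /mom_t derive1E; exact: dm.
  have /cvgr_dnbhsP := dfc.
  move=> /(_ (fun k => k.+1%:R^-1)) H.
  rewrite (_ : (fun k => mom_quotient k w) = (fun k => (fun h : R => h^-1 *: (((fun x => mom M w x g) \o shift s) (h *: 1) - mom M w s g)) k.+1%:R^-1)).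
    apply: H; split; first by move=> k; rewrite invr_neq0.
    exact: cvg_harmonic.
  apply/funext => k; rewrite /mom_quotient !mom_extE // invrK /= -[_ *: 1]/(_ * 1) mulr1 [s + _]addrC //.
have ge0 : 0 <= mom_t (M:=M) w s g.
  rewrite -(cvg_lim _ cq) //; apply: limr_ge; first by apply/cvg_ex; eexists; exact: cq.
  apply: nearW => k; rewrite /mom_quotient mulr_ge0 // subr_ge0 !mom_extE //.
  by apply: Hmono => //; rewrite lerDl invr_ge0.
have cqE : (mom_quotient k w)%:E @[k --> \oo] --> (mom_t (M:=M) w s g)%:E by apply: cvg_EFin => //; exact: nearW.
rewrite /slope0 is_cvg_limn_esupE; last by apply/cvg_ex; eexists; exact: cqE.
rewrite (cvg_lim _ cqE) //= (min_idPr _); first exact/max_idPr.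
exact: le_trans (ler_norm _) bt.
Qed.

(** Integrate the restricted curvature at theta0 against the square of h(Z), using
    disintegration along Z. *)
Lemma curvature_mean (h : bZ -> R) : measurable_fun setT h ->
  ((Bmin)%:E * \int[P]_o ((h (Z M o)) ^+ 2)%:E <= \int[P]_o ((h (Z M o)) ^+ 2 * slope0 (Wv M o))%:E)%E.
Proof.
move=> mh; have [_ HC _ _ _] := Hreg; have [B0 _ _] := Hcurv.
have mh2 : measurable_fun setT (fun z => h z ^+ 2) by apply: measurable_funX.
pose F (w : bW) : \bar R := (h (zp w) ^+ 2 * slope0 w)%:E.
have mF : measurable_fun setT F.
  apply/measurable_EFinP; apply: measurable_funM; last exact: measurable_slope0.
  exact: (measurableT_comp mh2 measurable_zpart).
have F0 w : (0 <= F w)%E by rewrite lee_fin mulr_ge0 ?sqr_ge0 ?slope0_ge0.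
have E1 := @disintegration _ _ _ P _ _ bW bZ (W M) (Z M) (kappa M) measurable_Wv measurable_Z HC F mF F0.
have mk : measurable_fun setT (fun o => \int[kappa M (Z M o)]_w F w)%E.
  exact: (@kernel_integral_measurable _ _ _ _ _ bW bZ (Z M) (kappa M) measurable_Z F mF F0).
rewrite [leRHS](_ : _ = \int[P]_o \int[kappa M (Z M o)]_w F w)%E; last exact: E1.
have mhZ : measurable_fun setT (fun o => (h (Z M o) ^+ 2)%:E).
  by apply/measurable_EFinP; exact: (measurableT_comp mh2 measurable_Z).
rewrite -ge0_integralZl //; last 2 first.
- by move=> o _; rewrite lee_fin sqr_ge0.
- by rewrite lee_fin ltW.
apply: ae_ge0_le_integral => //.
- by move=> o _; rewrite mule_ge0 // lee_fin ?sqr_ge0 // ltW.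
- exact: measurable_funeM.
- by move=> o _; apply: integral_ge0.
apply: filterS2 ae_goodZ ae_kernel_fibre => o zg hf _ /=.
set z := Z M o in zg hf *.
have mf : measurable (fibre z) by exact: measurable_fibre.
pose K : {measure set bW -> \bar R} := kappa M z.
have -> : (\int[K]_w F w = (h z ^+ 2)%:E * \int[K]_(w in fibre z) (slope0 w)%:E)%E.
  rewrite -ge0_integralZl //; last 3 first.
  - by apply: measurable_funTS; apply/measurable_EFinP; exact: measurable_slope0.
  - by move=> w _; rewrite lee_fin slope0_ge0.
  - by rewrite lee_fin sqr_ge0.
  rewrite (@integral_full_set _ _ _ K _ (fibre z)) //.
  by apply: eq_integral => w; rewrite inE => -[_ wz]; rewrite /F wz EFinM.
rewrite muleC lee_wpmul2l // ?lee_fin ?sqr_ge0 //.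
have zs : suppZ (M:=M) z by case: zg.
have := curvature_lower 0%N 1 zs; rewrite mul1r => /le_trans; apply.
rewrite -/K (@integral_full_set _ _ _ K _ (fibre z)) //.
rewrite le_eqVlt; apply/orP; left; apply/eqP; apply: eq_integral => w; rewrite inE => -[wD wz].
by rewrite (slope0_good 0%N) ?wz //; split => //; rewrite wz.
Qed.

(** Take h = 1 in [curvature_mean]. *)
Lemma Bmin_le_U : Bmin <= U.
Proof.
have := curvature_mean (h := cst 1) (measurable_cst _).
under [X in (_ * X <= _)%E]eq_integral do rewrite /= expr1n.
under [X in (_ <= X)%E]eq_integral do rewrite /= expr1n mul1r.
rewrite (prob_integral_cst P 1%E) mule1 => /le_trans h.
rewrite -lee_fin; apply: h.
rewrite -[leRHS](prob_integral_cst P); apply: ge0_le_integral => //.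
- by move=> o _; rewrite lee_fin slope0_ge0.
- by apply/measurable_EFinP; exact: (measurableT_comp measurable_slope0 measurable_Wv).
- by move=> o _; rewrite lee_fin slope0_le.
Qed.

(** * The gradient of the population criterion is the expected score *)

Lemma measurable_gpath g r : measurable_fun setT (g : bZ -> bG) ->
  measurable_fun setT (gpath (M:=M) g r : bZ -> bG).
Proof.
move=> mg; apply: bvec_measurableP => // j.
rewrite (_ : (fun x => _) = (fun z : bZ => r * (g z ord0 j - g0 M z ord0 j) + g0 M z ord0 j)).
  have m1 := measurableT_comp (coord_measurable (R:=R) j) mg.
  have m2 := measurableT_comp (coord_measurable (R:=R) j) mg0.
  by apply: measurable_funD => //; apply: measurable_funM => //; apply: measurable_funB.
by apply/funext => z; rewrite /gpath !mxE.
Qed.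

Lemma lossat_line n (theta v : 'rV[R]_(dimP M n)) (g : 'rV[R]_(dimZ M) -> 'rV[R]_(dimG M)) (s : R) w :
  lossat (theta + s *: v) g w =
  loss M w (lin_index theta g (zp w) + s * dotv (Lam M n (zp w) (g (zp w))) v) (g (zp w)).
Proof. by rewrite /lossat /lin_index dotvDr dotvZr. Qed.

Lemma is_derive_loss_line w t0 x gam s : domW M w ->
  is_derive (s : R) (1 : R) (fun s : R => loss M w (t0 + s * x) gam) (x * mom M w (t0 + s * x) gam).
Proof.
move=> wD.
have d1 : is_derive s 1 (fun s : R => t0 + s * x) x.
  have -> : (fun s : R => t0 + s * x) = cst t0 + x \*: (id : R -> R).
    by apply/funext => u /=; rewrite mulrC.
  have E : 0 + x *: (1 : R) = x by rewrite add0r -[_ *: _]/(x * 1) mulr1.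
  have d0 : is_derive s (1:R) (cst t0 : R -> R) 0 by exact: is_derive_cst.
  have dZ : is_derive s (1:R) (x \*: (id : R -> R)) (x *: (1:R)) by exact: is_deriveZ.
  by have := is_deriveD d0 dZ; rewrite E.
have d2 := Hloss (t0 + s * x) gam wD.
have := @is_derive1_comp R (fun u => loss M w u gam) (fun s => t0 + s * x) s _ _ d2 d1.
by rewrite mulrC.
Qed.

(** Differentiation under the expectation, along sequences, by dominated
    convergence.  Convexity of the loss in the direction of the j-th coordinate dominates the
    difference quotients by those at steps 1 and -1, which are integrable because the
    criterion is well defined at the neighbouring parameters. *)
Lemma gradient_is_score n (g : 'rV[R]_(dimZ M) -> 'rV[R]_(dimG M)) r (j : 'I_(dimP M n)) :
  Gn n g -> measurable_fun setT (g : bZ -> bG) -> 0 <= r <= 1 ->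
  {ae P, forall o, domG M (gpath (M:=M) g r (Z M o))} ->
  P.-integrable setT (fun o => (score_at (n:=n) (gpath (M:=M) g r) j (Wv M o))%:E) /\
  gradQ_path (M:=M) (n:=n) g j r = fine (\int[P]_o (score_at (n:=n) (gpath (M:=M) g r) j (Wv M o))%:E)%E.
Proof.
move=> Gg mg r01 aeG.
set gr := gpath (M:=M) g r in aeG *.
have mgr : measurable_fun setT (gr : bZ -> bG) by exact: measurable_gpath.
set e : 'rV[R]_(dimP M n) := delta_mx ord0 j.
pose L (s : R) o := lossat (theta0 M n + s *: e) gr (Wv M o).
have iL s : P.-integrable setT (EFin \o L s) by exact: HQ.
pose q (h : R) o := h^-1 * (L h o - L 0 o).
have iq h : P.-integrable setT (fun o => (q h o)%:E).
  under eq_fun do rewrite /q EFinM EFinB.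
  by apply: integrableZl => //; apply: integrableB => //; exact: iL.
have mpsi : measurable_fun setT (fun o => (score_at (n:=n) gr j (Wv M o))%:E).
  apply/measurable_EFinP; exact: (measurableT_comp (measurable_score_at (n:=n) j mgr) measurable_Wv).
have LE o s : L s o = loss M (Wv M o) (lin_index (theta0 M n) gr (Z M o) + s * Lam M n (Z M o) (gr (Z M o)) ord0 j) (gr (Z M o)).
  by rewrite /L lossat_line dotv_delta.
have dL o : domW M (Wv M o) -> forall s : R, is_derive s (1:R) (L^~ o)
   (Lam M n (Z M o) (gr (Z M o)) ord0 j * mom M (Wv M o) (lin_index (theta0 M n) gr (Z M o) + s * Lam M n (Z M o) (gr (Z M o)) ord0 j) (gr (Z M o))).
  move=> wD s; rewrite (_ : L^~ o = (fun s => loss M (Wv M o) (lin_index (theta0 M n) gr (Z M o) + s * Lam M n (Z M o) (gr (Z M o)) ord0 j) (gr (Z M o)))).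
    exact: is_derive_loss_line.
  by apply/funext => u; rewrite LE.
(* The dominating function, independent of the step. *)
pose bnd o := `|q 1 o| + `|q (-1) o|.
have ib : P.-integrable setT (fun o => (bnd o)%:E).
  under eq_fun do rewrite /bnd EFinD.
  by apply: integrableD => //; apply: integrable_norm; exact: iq.
have qb o h : domW M (Wv M o) -> domG M (gr (Z M o)) -> h != 0 -> `|h| <= 1 -> `|q h o| <= bnd o.
  move=> wD gD h0 h1.
  have [|A B] := andP (convex_quotient (dL o wD) _ h0 h1).
    move=> x y xy.
    have [l0|l0] := leP 0 (Lam M n (Z M o) (gr (Z M o)) ord0 j).
      by rewrite ler_wpM2l //; apply: Hmono => //; rewrite lerD2l ler_wpM2r.
    by rewrite ler_wnM2l ?(ltW l0) //; apply: Hmono => //; rewrite lerD2l ler_wnM2r // ltW.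
  have E1 : q 1 o = L 1 o - L 0 o by rewrite /q invr1 mul1r.
  have E2 : q (-1) o = L 0 o - L (-1) o by rewrite /q invrN invr1 mulN1r opprB.
  rewrite -/(q h o) -E1 -E2 in A B.
  rewrite /bnd ler_norml; apply/andP; split.
    have := ler_norm (- q (-1) o); rewrite normrN; have := normr_ge0 (q 1 o); lra.
  have := ler_norm (q 1 o); have := normr_ge0 (q (-1) o); lra.
have ql o : domW M (Wv M o) -> q h o @[h --> 0^'] --> score_at (n:=n) gr j (Wv M o).
  move=> wD; have [d1 d2] := dL o wD 0.
  rewrite mul0r addr0 in d2.
  have dfc : h^-1 *: (((L^~ o) \o shift 0) (h *: 1) - L 0 o) @[h --> 0^'] --> score_at (n:=n) gr j (Wv M o).
    rewrite /score_at mom_extE // -d2; exact: d1.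
  apply: cvg_trans dfc; apply: near_eq_cvg; apply: nearW => h.
  by rewrite /q /= addr0 -[h *: 1]/(h * 1) mulr1.
have key (u : nat -> R) : (forall k, u k != 0) -> (forall k, `|u k| <= 1) -> u k @[k --> \oo] --> 0 ->
  P.-integrable setT (fun o => (score_at (n:=n) gr j (Wv M o))%:E) /\
  fine (\int[P]_o (q (u k) o)%:E)%E @[k --> \oo] --> fine (\int[P]_o (score_at (n:=n) gr j (Wv M o))%:E)%E.
  move=> u0 u1 ul.
  have [] := @dominated_convergence _ _ _ P setT measurableT (fun k o => (q (u k) o)%:E)
    (fun o => (score_at (n:=n) gr j (Wv M o))%:E) (fun o => (bnd o)%:E).
  - by move=> k; exact: measurable_int (iq (u k)).
  - exact: mpsi.
  - apply: filterS ae_domW => o wD _; apply: cvg_EFin; first exact: nearW.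
    by have /cvgr_dnbhsP := ql o wD; apply; split.
  - exact: ib.
  - apply: filterS2 ae_domW aeG => o wD gD k _.
    by rewrite lee_fin; exact: qb.
  move=> ipsi _ cv; split => //.
  by apply: fine_cvg; rewrite fineK ?integrable_fin_num.
have ipsi : P.-integrable setT (fun o => (score_at (n:=n) gr j (Wv M o))%:E).
  have [] // := key (fun k => k.+1%:R^-1).
  - by move=> k; rewrite /= ger0_norm // invf_le1 // ler1n.
  - exact: cvg_harmonic.
split => //.
have QE s : Q (theta0 M n + s *: e) gr = fine (\int[P]_o (L s o)%:E)%E.
  by rewrite /Q unlock.
rewrite /gradQ_path /pderiv -/e -/gr; apply/cvg_lim => //.
have qE h : fine (\int[P]_o (q h o)%:E)%E = h^-1 *: (((fun theta => Q theta gr) \o shift (theta0 M n)) (h *: e) - Q (theta0 M n) gr).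
  rewrite /= [h *: e + _]addrC QE.
  have -> : Q (theta0 M n) gr = fine (\int[P]_o (L 0 o)%:E)%E by rewrite -QE scale0r addr0.
  under eq_integral do rewrite /q EFinM EFinB.
  rewrite integralZl //; last by apply: integrableB => //; exact: iL.
  rewrite integralB //; [|exact: iL|exact: iL].
  have fL s : (\int[P]_o (L s o)%:E)%E \is a fin_num by exact: integrable_fin_num (iL s).
  move: (fL h) (fL 0); move: (\int[P]_o (L h o)%:E)%E (\int[P]_o (L 0 o)%:E)%E.
  by move=> [a| |] [b| |] //.
under eq_fun do rewrite -qE.
apply/cvgr_dnbhsP => u [u0 ul].
have [K _ HK] : \forall k \near \oo, `|u k| <= 1.
  have /cvgrPdist_le /(_ 1 ltr01) := ul.
  by apply: filterS => k; rewrite sub0r normrN.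
rewrite -(cvg_shiftn K).
have [] // := key (fun k => u (k + K)%N).
- by move=> k; apply: HK => /=; rewrite leq_addl.
- by rewrite (cvg_shiftn K).
Qed.

(** * The expected score at an estimated nuisance *)

Lemma measurable_gap g : measurable_fun setT (g : bZ -> bG) -> measurable_fun setT (fun z : bZ => gap g z).
Proof.
move=> mg; apply: measurable_sum => j; apply: measurableT_comp => //.
have m1 := measurableT_comp (coord_measurable (R:=R) j) mg.
have m2 := measurableT_comp (coord_measurable (R:=R) j) mg0.
apply: (eq_measurable_fun (fun z : bZ => g z ord0 j - g0 M z ord0 j)).
  by move=> z _; rewrite !mxE.
exact: measurable_funB.
Qed.

Lemma suppZ_nonempty : exists z, suppZ (M:=M) z.
Proof.
apply: contrapT => H.
have [N [mN PN sub]] := ae_suppZ.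
have : P setT = 0%E.
  rewrite -PN; congr (P _); apply/seteqP; split => // o _; apply: sub => /= h; apply: H.
  by exists (Z M o).
by rewrite probability_setT => /eqP; rewrite onee_eq0.
Qed.

(** The distance enters the second-order remainder through its second moment, which
    both norms control. *)
Lemma fnorm_moment N (g : 'rV[R]_(dimZ M) -> 'rV[R]_(dimG M)) (b : R) :
  measurable_fun setT (g : bZ -> bG) ->
  (fnorm (M:=M) N (g \- g0 M)%R <= b%:E)%E ->
  let D := fine (fnorm (M:=M) N (g \- g0 M)%R) in
  [/\ 0 <= D, D <= b & (\int[P]_o (gap g (Z M o) ^+ 2)%:E <= (D ^+ 2)%:E)%E].
Proof.
move=> mg hb /=; case: N hb => hb.
- have [z0 z0s] := suppZ_nonempty.
  have ub z : suppZ (M:=M) z -> ((gap g z)%:E <= fnorm (M:=M) SupNorm (g \- g0 M)%R)%E.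
    by move=> zs; apply: ereal_sup_ubound; exists z.
  have f0 : (0 <= fnorm (M:=M) SupNorm (g \- g0 M)%R)%E.
    by apply: le_trans (ub z0 z0s); rewrite lee_fin norm1_ge0.
  have ff : fnorm (M:=M) SupNorm (g \- g0 M)%R \is a fin_num.
    by rewrite ge0_fin_numE // (le_lt_trans hb) ?ltry.
  split; first exact: fine_ge0.
    by rewrite -lee_fin fineK.
  rewrite -[leRHS](prob_integral_cst P); apply: ae_ge0_le_integral => //.
  + by move=> o _; rewrite lee_fin sqr_ge0.
  + apply/measurable_EFinP; apply: measurable_funX; exact: (measurableT_comp (measurable_gap mg) measurable_Z).
  + by move=> o _; rewrite lee_fin sqr_ge0.
  apply: filterS ae_suppZ => o zs _; rewrite lee_fin ler_sqr ?nnegrE ?norm1_ge0 ?fine_ge0 //.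
  by rewrite -lee_fin fineK //; exact: ub.
- set X := fnorm _ _ in hb *.
  have f0 : (0 <= X)%E by exact: Lnorm_ge0.
  have ff : X \is a fin_num by rewrite ge0_fin_numE // (le_lt_trans hb) ?ltry.
  split; first exact: fine_ge0.
    by rewrite -lee_fin fineK.
  have := @powR_Lnorm _ _ _ P (fun o => (norm1 ((g \- g0 M)%R (Z M o)))%:E) 2 ltac:(by []).
  rewrite -/X => E.
  rewrite EFin_expe fineK //.
  have -> : (X ^+ 2 = X `^ 2)%E by rewrite -(fineK ff) poweR_EFin powR_mulrn ?fine_ge0 // EFin_expe.
  rewrite E le_eqVlt; apply/orP; left; apply/eqP; apply: eq_integral => o _.
  rewrite gee0_abs ?lee_fin ?norm1_ge0 // poweR_EFin powR_mulrn ?norm1_ge0 //.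
Qed.

(** The inequality a <= a^2 / (2 s) + s / 2 with s close to the norm replaces
    Cauchy-Schwarz; the slack e covers a vanishing norm. *)
Lemma first_moment N g (b : R) :
  measurable_fun setT (g : bZ -> bG) ->
  (fnorm (M:=M) N (g \- g0 M)%R <= b%:E)%E ->
  (\int[P]_o (gap g (Z M o))%:E <= b%:E)%E.
Proof.
move=> mg hb; have [D0 Db ED] := fnorm_moment mg hb.
set D := fine _ in D0 Db ED.
apply/lee_addgt0Pr => e e0.
have s0 : 0 < D + e by lra.
have md : measurable_fun setT (fun o => gap g (Z M o)) by exact: (measurableT_comp (measurable_gap mg) measurable_Z).
apply: (@le_trans _ _ (\int[P]_o ((2 * (D + e))^-1%:E * (gap g (Z M o) ^+ 2)%:E + ((D + e) / 2)%:E))%E).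
  apply: ge0_le_integral => //.
  - by move=> o _; rewrite lee_fin norm1_ge0.
  - exact/measurable_EFinP.
  - apply: emeasurable_funD => //; apply: measurable_funeM; apply/measurable_EFinP; exact: measurable_funX.
  move=> o _; rewrite -EFinM -EFinD lee_fin.
  set a := norm1 _; set s := D + e in s0 *.
  have -> : (2 * s)^-1 * a ^+ 2 + s / 2 = a + (a - s) ^+ 2 / (2 * s) by field; rewrite gt_eqF.
  by rewrite lerDl divr_ge0 ?sqr_ge0 // mulr_ge0 // ltW.
have mA : measurable_fun setT (fun o => (gap g (Z M o) ^+ 2)%:E).
  by apply/measurable_EFinP; exact: measurable_funX.
have mcA : measurable_fun setT (fun o => (2 * (D + e))^-1%:E * (gap g (Z M o) ^+ 2)%:E)%E.
  exact: measurable_funeM.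
have nc : (0 <= (2 * (D + e))^-1%:E)%E by rewrite lee_fin invr_ge0 mulr_ge0 // ltW.
have nA o : (0 <= (gap g (Z M o) ^+ 2)%:E)%E by rewrite lee_fin sqr_ge0.
have ncA o : (0 <= (2 * (D + e))^-1%:E * (gap g (Z M o) ^+ 2)%:E)%E by rewrite mule_ge0.
have nB : (0 <= ((D + e) / 2)%:E)%E by rewrite lee_fin divr_ge0 // ltW.
rewrite ge0_integralD // ge0_integralZl //.
rewrite (prob_integral_cst P ((D + e) / 2)%:E).
apply: (@le_trans _ _ ((2 * (D + e))^-1%:E * (D ^+ 2)%:E + ((D + e) / 2)%:E)%E).
  by apply: leeD => //; apply: lee_wpmul2l => //; rewrite lee_fin invr_ge0 mulr_ge0 // ltW.
rewrite -EFinM -!EFinD lee_fin.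
have : (2 * (D + e))^-1 * D ^+ 2 <= (D + e) / 2.
  rewrite ler_pdivrMl ?mulr_gt0 //.
  have -> : 2 * (D + e) * ((D + e) / 2) = (D + e) ^+ 2 by field.
  by rewrite ler_sqr ?nnegrE; lra.
lra.
Qed.

Definition path_in_domain n (g : 'rV[R]_(dimZ M) -> 'rV[R]_(dimG M)) : Prop :=
  {ae P, forall o, forall r, 0 <= r <= 1 -> domG M (gpath (M:=M) g r (Z M o)) /\
       domT M (lin_index (theta0 M n) (gpath (M:=M) g r) (Z M o))}.

(** A uniformly small deviation moves the index by at most U^2 times its size, so that
    both stay within the margin. *)
Lemma sup_path_in_domain (eta : R) n g b : 0 < eta ->
  (forall z, goodZ z -> ball (g0 M z) eta `<=` domG M /\ forall n, ball (t n z) eta `<=` domT M) ->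
  (fnorm (M:=M) SupNorm (g \- g0 M)%R <= b%:E)%E -> b < eta -> U ^+ 2 * b < eta ->
  path_in_domain n g.
Proof.
move=> eta0 Heta hb b1 b2.
have [_ _ _ HL] := Hbd.
apply: filterS ae_goodZ => o zg r r01.
set z := Z M o in zg *; have [HG HT] := Heta z zg.
have [zs _ _ _] := zg.
have dz : gap g z <= b.
  rewrite -lee_fin; apply: le_trans hb; apply: ereal_sup_ubound; by exists z.
have nr s : 0 <= s <= 1 -> norm1 (gpath (M:=M) g s z - g0 M z) <= b.
  move=> /andP[s0 s1]; rewrite /gpath addrK norm1Z ger0_norm //; apply: le_trans dz.
  by rewrite ler_piMl // norm1_ge0.
have inG s : 0 <= s <= 1 -> domG M (gpath (M:=M) g s z).
  move=> s01; apply: HG; apply: (@hull_ball _ _ _ (gpath (M:=M) g s z)) => //; last exact: hull_r.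
  exact: le_lt_trans (nr s s01) b1.
split; first exact: inG.
apply: (HT n).
have := @path_index_lip R (dimG M) (dimP M n) (Lam M n z) (theta0 M n) U (domG M) U_ge0 (theta0_le n)
  (fun gam hG j => HL n z gam j zs hG) (g0 M z) (gpath (M:=M) g r z) ltac:(by have [[_ _ _ [_ _ ? _ _]] _ _ _] := Hbd).
move=> /(_ _) h; rewrite /ball /= distrC; apply: le_lt_trans (h _) _.
  move=> s /andP[s0 s1]; rewrite {1}/gpath addrK scalerA; apply: inG.
  by case/andP: r01 => r0 r1; rewrite mulr_ge0 //= mulr_ile1.
apply: le_lt_trans b2; rewrite ler_wpM2l ?sqr_ge0 //; exact: nr.
Qed.

(** [path_second_difference] for the sub-path that ends at h, whose length is h times
    that of the full path. *)
Lemma score_second_difference n g j w h x : domW M w -> suppZ (M:=M) (zp w) ->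
  (forall r, 0 <= r <= 1 -> domG M (gpath (M:=M) g r (zp w)) /\
       domT M (lin_index (theta0 M n) (gpath (M:=M) g r) (zp w))) ->
  0 <= h <= 1 -> 0 <= x <= 1 ->
  `|score_at (n:=n) (gpath (M:=M) g (x * h)) j w - (1 - x) * score_at (n:=n) (g0 M) j w
    - x * score_at (n:=n) (gpath (M:=M) g h) j w| <= path_const U * (h * gap g (zp w)) ^+ 2 * (x * (1 - x)).
Proof.
move=> wD zs Hp h01 x01; have [[_ _ _ [oT _ oG _ _]] _ Hm HL] := Hbd.
set z := zp w in zs Hp *; case/andP: (h01) => h0 h1.
have E s : s *: (gpath (M:=M) g h z - g0 M z) + g0 M z = gpath (M:=M) g (s * h) z.
  by rewrite /gpath addrK scalerA.
have in01 s : 0 <= s <= 1 -> 0 <= s * h <= 1.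
  by case/andP => s0 s1; rewrite mulr_ge0 //= mulr_ile1.
have pG s : 0 <= s <= 1 -> domG M (s *: (gpath (M:=M) g h z - g0 M z) + g0 M z).
  by move=> s01; rewrite E; apply: (Hp _ (in01 s s01)).1.
have pT s : 0 <= s <= 1 -> domT M (dotv (Lam M n z (s *: (gpath (M:=M) g h z - g0 M z) + g0 M z)) (theta0 M n)).
  by move=> s01; rewrite E; apply: (Hp _ (in01 s s01)).2.
have := @path_second_difference R (dimG M) (dimP M n) (Lam M n z) (mom M w) (theta0 M n) U (domG M) (domT M)
  U_ge0 (theta0_le n) (fun gam hG j => HL n z gam j zs hG) (fun s gam => @Hm w s gam wD)
  (g0 M z) (gpath (M:=M) g h z) oG oT pG pT j x x01.
have nE : norm1 (gpath (M:=M) g h z - g0 M z) = h * gap g z by rewrite /gpath addrK norm1Z ger0_norm.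
have PE g' : score_at (n:=n) g' j w = Lam M n z (g' z) ord0 j * mom M w (dotv (Lam M n z (g' z)) (theta0 M n)) (g' z).
  by rewrite /score_at mom_extE.
by rewrite E nE !PE.
Qed.

(** The second-difference bound for the score integrates to the hypotheses of
    [endpoint_bound] for f = gradQ_path: intermediate points of the full path give the first
    one, midpoints of short paths the second one. *)
Lemma score_mean N B0 B n g (j : 'I_(dimP M n)) (b : R) :
  Gn n g -> measurable_fun setT (g : bZ -> bG) ->
  (fnorm (M:=M) N (g \- g0 M)%R <= b%:E)%E -> path_in_domain n g ->
  0 <= B0 ->
  (forall r, 0 <= r < 1 ->
    let f := gradQ_path (M:=M) (n:=n) g j in
    let D := fine (fnorm (M:=M) N (g \- g0 M)) in
    [/\ derivable f r 1, derivable (derive1 f) r 1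
      & `|derive1 f 0 + derive1n 2 f r| <= B0 * D + B * D ^+ 2]) ->
  P.-integrable setT (fun o => (score_at (n:=n) g j (Wv M o))%:E) /\
  `|fine (\int[P]_o (score_at (n:=n) g j (Wv M o))%:E)%E| <= B0 * b + (`|B| + 3 * path_const U) * b ^+ 2.
Proof.
move=> Gg mg hb hp B00 HB.
have [D0 Db ED] := fnorm_moment mg hb; set D := fine _ in D0 Db ED.
set f := gradQ_path (M:=M) g j in HB.
have K0 : 0 <= path_const U.
  by rewrite /path_const !(addr_ge0, mulr_ge0, exprn_ge0, sqr_ge0, U_ge0).
have gs r : 0 <= r <= 1 -> P.-integrable setT (fun o => (score_at (n:=n) (gpath (M:=M) g r) j (Wv M o))%:E) /\
  f r = fine (\int[P]_o (score_at (n:=n) (gpath (M:=M) g r) j (Wv M o))%:E)%E.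
  move=> r01; apply: gradient_is_score => //.
  by apply: filterS hp => o /(_ r r01)[].
have g1 : gpath (M:=M) g 1 = g by apply/funext => z; rewrite /gpath scale1r subrK.
have g00 : gpath (M:=M) g 0 = g0 M by apply/funext => z; rewrite /gpath scale0r add0r.
have [ig cE] := gs 1 ltac:(by rewrite ler01 lexx); rewrite g1 in ig cE.
have [ig0 f0E] := gs 0 ltac:(by rewrite ler01 lexx); rewrite g00 in ig0 f0E.
have f0 : f 0 = 0 by rewrite f0E score0_mean.
split => //; rewrite -cE.
have md : measurable_fun setT (fun o => gap g (Z M o)) by exact: (measurableT_comp (measurable_gap mg) measurable_Z).
(* The second-difference bound, integrated, on the sub-path that ends at h. *)
have main h x : 0 <= h <= 1 -> 0 <= x <= 1 -> `|f (x * h) - x * f h| <= path_const U * D ^+ 2 * h ^+ 2 * (x * (1 - x)).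
  move=> h01 x01; case/andP: (h01) => h0 h1; case/andP: (x01) => x0 x1.
  have xh01 : 0 <= x * h <= 1 by rewrite mulr_ge0 //= mulr_ile1.
  have [i1 E1] := gs _ h01; have [i2 E2] := gs _ xh01.
  pose dif o := score_at (n:=n) (gpath (M:=M) g (x * h)) j (Wv M o) - (1 - x) * score_at (n:=n) (g0 M) j (Wv M o)
    - x * score_at (n:=n) (gpath (M:=M) g h) j (Wv M o).
  have iz1 : P.-integrable setT (fun o => ((1 - x)%:E * (score_at (n:=n) (g0 M) j (Wv M o))%:E)%E) by exact: integrableZl.
  have iz2 : P.-integrable setT (fun o => (x%:E * (score_at (n:=n) (gpath (M:=M) g h) j (Wv M o))%:E)%E) by exact: integrableZl.
  have id1 := integrableB measurableT i2 iz1.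
  have id2 := integrableB measurableT id1 iz2.
  have difE : (\int[P]_o (dif o)%:E = (f (x * h) - x * f h)%:E)%E.
    transitivity (\int[P]_o ((score_at (n:=n) (gpath (M:=M) g (x * h)) j (Wv M o))%:E - (1 - x)%:E * (score_at (n:=n) (g0 M) j (Wv M o))%:E
    - x%:E * (score_at (n:=n) (gpath (M:=M) g h) j (Wv M o))%:E))%E.
      by apply: eq_integral => o _; rewrite /dif !EFinB !EFinM.
    rewrite (integralB measurableT id1 iz2) (integralB measurableT i2 iz1) !integralZl //.
    rewrite score0_mean mule0 sube0 E1 E2.
    by rewrite EFinB EFinM !fineK ?integrable_fin_num.
  have mdif : measurable_fun setT dif.
    have mp g' : P.-integrable setT (fun o => (score_at (n:=n) g' j (Wv M o))%:E) -> measurable_fun setT (fun o => score_at (n:=n) g' j (Wv M o)).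
      by move=> i; apply/measurable_EFinP; exact: measurable_int i.
    apply: measurable_funB; last by apply: measurable_funM => //; exact: mp.
    by apply: measurable_funB; [exact: mp|apply: measurable_funM => //; exact: mp].
  rewrite -lee_fin -[(`|_|%:E)]/(`|(f (x * h) - x * f h)%:E|)%E -difE.
  apply: le_trans (le_abse_integral _ _ _) _ => //; first exact/measurable_EFinP.
  have c0 : 0 <= path_const U * h ^+ 2 * (x * (1 - x)).
    by rewrite !mulr_ge0 ?sqr_ge0 // subr_ge0.
  apply: (@le_trans _ _ (\int[P]_o ((path_const U * h ^+ 2 * (x * (1 - x)))%:E * (gap g (Z M o) ^+ 2)%:E))%E).
    apply: ae_ge0_le_integral => //.
    - by apply: measurableT_comp => //; exact/measurable_EFinP.
    - by move=> o _; rewrite mule_ge0 // lee_fin sqr_ge0.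
    - by apply: measurable_funeM; apply/measurable_EFinP; exact: measurable_funX.
    apply: filterS2 (filterI ae_domW ae_suppZ) hp => o [wD zs] Hp _.
    rewrite -EFinM lee_fin /dif; apply: le_trans (score_second_difference j wD zs Hp h01 x01) _.
    rewrite exprMn le_eqVlt; apply/orP; left; apply/eqP; rewrite -/(Z M o); ring.
  have mA : measurable_fun setT (fun o => (gap g (Z M o) ^+ 2)%:E).
    by apply/measurable_EFinP; exact: measurable_funX.
  have nA o : (0 <= (gap g (Z M o) ^+ 2)%:E)%E by rewrite lee_fin sqr_ge0.
  rewrite ge0_integralZl //.
  have -> : path_const U * D ^+ 2 * h ^+ 2 * (x * (1 - x)) = path_const U * h ^+ 2 * (x * (1 - x)) * D ^+ 2 by ring.
  by rewrite [leRHS]EFinM lee_wpmul2l ?lee_fin.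
have KD0 : 0 <= path_const U * D ^+ 2 by rewrite mulr_ge0 ?sqr_ge0.
(* The first hypothesis uses h = 1 and all x, the second one x = 1/2 and all h. *)
have := @endpoint_bound R f (f 1) (path_const U * D ^+ 2) (B0 * D + B * D ^+ 2).
move=> /(_ _ _ f0) h.
apply: le_trans (h _ _ _ _ _) _.
- by move=> r r01; have [] := HB r r01.
- by have [] := HB 0 ltac:(by rewrite lexx ltr01).
- move=> x /andP[x0 x1].
  have := main 1 x ltac:(by rewrite ler01 lexx) ltac:(by rewrite !ltW).
  rewrite mulr1 expr1n mulr1 => /le_trans; apply.
  by apply: ler_wpM2l => //; nra.
- move=> h' /andP[h0 h1].
  have := main h' 2^-1 ltac:(by rewrite !ltW) ltac:(lra).
  rewrite [2^-1 * h']mulrC [2^-1 * f h']mulrC => /le_trans; apply.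
  by rewrite le_eqVlt; apply/orP; left; apply/eqP; field.
- by have [_ _] := HB 0 ltac:(by rewrite lexx ltr01).
have a1 : B0 * D <= B0 * b by rewrite ler_wpM2l.
have a2 : D ^+ 2 <= b ^+ 2 by rewrite ler_sqr ?nnegrE // (le_trans D0).
have a3 : B * D ^+ 2 <= `|B| * b ^+ 2.
  apply: (@le_trans _ _ (`|B| * D ^+ 2)); first by rewrite ler_wpM2r ?sqr_ge0 // ler_norm.
  by rewrite ler_wpM2l.
have a4 : path_const U * D ^+ 2 <= path_const U * b ^+ 2 by rewrite ler_wpM2l.
rewrite mulrDl; lra.
Qed.

(** * Curvature of the empirical criterion *)

(** U dominates Bmin. *)
Lemma U_gt0 : 0 < U.
Proof.
have [B0 _ _] := Hcurv; apply: lt_le_trans B0 _.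
exact: Bmin_le_U.
Qed.

Lemma loss_convex n (theta v : 'rV[R]_(dimP M n)) g w : domW M w -> domG M (g (zp w)) ->
  0 <= lossat (theta + v) g w - lossat theta g w
    - mom M w (lin_index theta g (zp w)) (g (zp w)) * dotv (Lam M n (zp w) (g (zp w))) v.
Proof.
move=> wD gD; rewrite /lossat /lin_index dotvDr.
apply: (@first_order_convex _ (fun s => loss M w s (g (zp w))) (fun s => mom M w s (g (zp w)))).
  by move=> s; exact: Hloss.
exact: Hmono.
Qed.

(** If g is close to g0 at the observation, the index segment from t1 to t1 + x stays
    within the margin, the slope there is within Bmin/2 of the slope at the truth, and
    replacing x by x0 costs a multiple of |v|_1^2 |g - g0|.  If g is not close, the right-hand
    side is nonnegative by convexity and the correction term dominates the left-hand side. *)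
Lemma loss_curvature : exists eta C : R, [/\ 0 < eta, 0 <= C &
  forall n g w (v : 'rV[R]_(dimP M n)), goodW w -> domG M (g (zp w)) -> norm1 v <= eta ->
  2^-1 * ((slope0 w - Bmin / 2) * dotv (Lam M n (zp w) (g0 M (zp w))) v ^+ 2)
    - C * norm1 v ^+ 2 * Num.min 1 (gap g (zp w))
  <= lossat (theta0 M n + v) g w - lossat (theta0 M n) g w
    - mom M w (lin_index (theta0 M n) g (zp w)) (g (zp w)) * dotv (Lam M n (zp w) (g (zp w))) v].
Proof.
have U0 := U_gt0; have [B0 _ _] := Hcurv.
have BU : Bmin <= U by exact: Bmin_le_U.
have [_ _ Hm HL] := Hbd.
have [eta e0 Heta] := good_margin.
have U20 : 0 < U ^+ 2 by rewrite exprn_gt0.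
(* Thresholds for |g - g0| and |v|_1: each may use up a quarter of the margin and half of Bmin/2. *)
pose e2 := Num.min 1 (Num.min (eta / (4 * (U ^+ 2 + 1))) (Bmin / (4 * U * (U ^+ 2 + 1)))).
pose e3 := Num.min (eta / (4 * (U + 1))) (Bmin / (4 * U ^+ 2)).
have d1 : 0 < 4 * (U ^+ 2 + 1) by lra.
have d2 : 0 < 4 * U * (U ^+ 2 + 1) by rewrite mulr_gt0 // ?mulr_gt0 // addr_gt0.
have d3 : 0 < 4 * (U + 1) by lra.
have d4 : 0 < 4 * U ^+ 2 by lra.
have e20 : 0 < e2 by rewrite !lt_min ltr01 !divr_gt0.
have e30 : 0 < e3 by rewrite !lt_min !divr_gt0.
exists e3, (U ^+ 3 / e2); split => //; first by rewrite divr_ge0 ?exprn_ge0 // ltW.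
move=> n g w v gw gD ve; have [wD zg] := gw; have [zs _ _ _] := zg.
have gD0 := good_domG zg.
set z := zp w in gD gD0 zg zs *.
set Dl := norm1 (g z - g0 M z).
have Dl0 : 0 <= Dl by exact: norm1_ge0.
set nv := norm1 v in ve *.
have nv0 : 0 <= nv by exact: norm1_ge0.
set x := dotv (Lam M n z (g z)) v; set x0 := dotv (Lam M n z (g0 M z)) v.
have xb : `|x| <= U * nv.
  by apply: dotv_bound => j; have [_ _ []] := HL n z _ j zs gD.
have x0b : `|x0| <= U * nv.
  by apply: dotv_bound => j; have [_ _ []] := HL n z _ j zs gD0.
have a0 : 0 <= slope0 w by exact: slope0_ge0.
have a1 : slope0 w <= U by exact: slope0_le.
set c := slope0 w - Bmin / 2.
have cb : `|c| <= U by rewrite ler_norml /c; apply/andP; split; lra.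
have x0s : x0 ^+ 2 <= U ^+ 2 * nv ^+ 2.
  by rewrite -exprMn -[x0 ^+ 2]real_normK ?num_real // ler_sqr ?nnegrE ?mulr_ge0 // ltW.
(* Where g is far from g0, the correction term is at least U^3 |v|_1^2, more than the quadratic term. *)
have [Db|Db] := leP Dl e2; last first.
  apply: le_trans (loss_convex (theta0 M n) v wD gD).
  rewrite subr_le0.
  have mn : e2 <= Num.min 1 Dl by rewrite le_min (ltW Db) andbT /e2 ge_min lexx.
  apply: (@le_trans _ _ (U ^+ 3 * nv ^+ 2)).
    apply: (@le_trans _ _ (U * (U ^+ 2 * nv ^+ 2))); last by rewrite mulrA -exprS.
    apply: (@le_trans _ _ (`|c| * x0 ^+ 2)).
      have : c * x0 ^+ 2 <= `|c| * x0 ^+ 2 by rewrite ler_wpM2r ?sqr_ge0 // ler_norm.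
      have : 0 <= `|c| * x0 ^+ 2 by rewrite mulr_ge0 // sqr_ge0.
      lra.
    by apply: ler_pM => //; exact: sqr_ge0.
  have -> : U ^+ 3 / e2 * nv ^+ 2 * Num.min 1 Dl = U ^+ 3 * nv ^+ 2 * (Num.min 1 Dl / e2) by ring.
  rewrite ler_peMr //; first by rewrite mulr_ge0 ?sqr_ge0 // exprn_ge0 // ltW.
  by rewrite ler_pdivlMr // mul1r.
have D1 : Dl <= 1 by apply: le_trans Db _; rewrite /e2 ge_min lexx.
have D2 : (U ^+ 2 + 1) * Dl <= eta / 4.
  have : Dl <= eta / (4 * (U ^+ 2 + 1)) by apply: le_trans Db _; rewrite /e2 ge_min [X in _ || X]ge_min lexx orbT.
  rewrite ler_pdivlMr // ; lra.
have D3 : U * ((U ^+ 2 + 1) * Dl) <= Bmin / 4.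
  have : Dl <= Bmin / (4 * U * (U ^+ 2 + 1)) by apply: le_trans Db _; rewrite /e2 ge_min [X in _ || X]ge_min lexx !orbT.
  rewrite ler_pdivlMr // ; lra.
have V1 : U * nv <= eta / 4.
  have : nv <= eta / (4 * (U + 1)) by apply: le_trans ve _; rewrite /e3 ge_min lexx.
  rewrite ler_pdivlMr // ; lra.
have V2 : U * (U * nv) <= Bmin / 4.
  have : nv <= Bmin / (4 * U ^+ 2) by apply: le_trans ve _; rewrite /e3 ge_min lexx orbT.
  rewrite ler_pdivlMr // ; lra.
have UD0 : 0 <= U ^+ 2 * Dl by rewrite mulr_ge0 // ltW.
have [HG HT] := Heta z zg.
have hG : hull (g0 M z) (g z) `<=` domG M.
  by move=> y hy; apply: HG; apply: hull_ball hy => //; rewrite -/Dl; lra.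
pose HLz := fun gam hG j => HL n z gam j zs hG.
pose Hmw := fun s gam => @Hm w s gam wD.
have tl := index_lip U_ge0 (theta0_le n) HLz hG; rewrite -/Dl in tl.
set t1 := dotv (Lam M n z (g z)) (theta0 M n) in tl.
set ts := dotv (Lam M n z (g0 M z)) (theta0 M n) in tl.
(* The index segment stays close to the index at the truth. *)
have near_ts s : Num.min t1 (t1 + x) <= s <= Num.max t1 (t1 + x) -> `|s - ts| <= U ^+ 2 * Dl + U * nv.
  move=> sI; have -> : s - ts = (s - t1) + (t1 - ts) by ring.
  apply: le_trans (ler_normD _ _) _; rewrite addrC; apply: lerD => //.
  by apply: le_trans (inI_le sI) _; rewrite addrAC subrr add0r.
have inT s : Num.min t1 (t1 + x) <= s <= Num.max t1 (t1 + x) -> inseg ts s `<=` domT M.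
  move=> sI y yI; apply: (HT n); rewrite /ball /= distrC.
  apply: le_lt_trans (inI_le yI) _; apply: le_lt_trans (near_ts s sI) _.
  have : U ^+ 2 * Dl <= (U ^+ 2 + 1) * Dl by rewrite mulrDl mul1r lerDl.
  lra.
have dT s : Num.min t1 (t1 + x) <= s <= Num.max t1 (t1 + x) -> domT M s.
  by move=> sI; apply: (inT s sI); rewrite /inseg /= ge_min le_max lexx !orbT.
have := @taylor_lower R (fun s => loss M w s (g z)) (fun s => mom M w s (g z)) (fun s => mom_t (M:=M) w s (g z)) c
  (fun s => Hloss s (g z) wD) t1 x.
rewrite -/(lin_index _ _ _) => TL.
have {}TL : c * x ^+ 2 / 2 <= loss M w (t1 + x) (g z) - loss M w t1 (g z) - mom M w t1 (g z) * x.
  apply: TL => s sI; split.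
    by rewrite /mom_t derive1E; apply: derivableP; have [] := Hm w s (g z) wD (dT s sI) gD.
  have := mt_lip Hmw (inT s sI) hG.
  rewrite -/(mom_t w s (g z)) -/(mom_t w ts (g0 M z)) -/Dl -(slope0_good n gw) => h.
  have h2 : U * (`|s - ts| + Dl) <= Bmin / 2.
    apply: (@le_trans _ _ (U * (U ^+ 2 * Dl + U * nv + Dl))).
      by rewrite ler_wpM2l ?(ltW U0) // lerD2r; exact: near_ts.
    lra.
  have := le_trans h h2; rewrite ler_norml /c => /andP[h3 _]; lra.
rewrite /lossat /lin_index dotvDr -/t1 -/x; apply: le_trans TL.
have mE : Num.min 1 Dl = Dl by exact/min_idPr.
rewrite mE.
have xx0 : `|x - x0| <= U * Dl * nv.
  by rewrite /x /x0 -dotvBl; apply: dotv_bound => j; rewrite !mxE; exact: (L_lip HLz j hG).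
have diff : `|x0 ^+ 2 - x ^+ 2| <= 2 * U ^+ 2 * Dl * nv ^+ 2.
  have -> : x0 ^+ 2 - x ^+ 2 = - ((x - x0) * (x + x0)) by ring.
  rewrite normrN normrM.
  have -> : 2 * U ^+ 2 * Dl * nv ^+ 2 = (U * Dl * nv) * (U * nv + U * nv) by ring.
  by apply: ler_pM => //; apply: le_trans (ler_normD _ _) _; exact: lerD.
have cd : `|c * (x0 ^+ 2 - x ^+ 2)| <= U * (2 * U ^+ 2 * Dl * nv ^+ 2) by rewrite normrM; apply: ler_pM.
have cd' : c * (x0 ^+ 2 - x ^+ 2) <= U * (2 * U ^+ 2 * Dl * nv ^+ 2) by apply: le_trans (ler_norm _) cd.
have ce : U ^+ 3 * nv ^+ 2 * Dl <= U ^+ 3 / e2 * nv ^+ 2 * Dl.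
  have -> : U ^+ 3 / e2 * nv ^+ 2 * Dl = U ^+ 3 * nv ^+ 2 * Dl / e2 by ring.
  rewrite ler_peMr //; first by rewrite mulr_ge0 // mulr_ge0 ?sqr_ge0 // exprn_ge0 // ltW.
  by rewrite invf_ge1 // /e2 ge_min lexx.
lra.
Qed.

Local Notation L0 n w j := (Lam M n (zp w) (g0 M (zp w)) ord0 j).

(** The entries of the matrix of the quadratic form v |-> (a - Bmin/2) (Lambda(Z, g0)'v)^2,
    clipped so that Hoeffding's bound applies. *)
Definition gram_entry n (jl : 'I_(dimP M n) * 'I_(dimP M n)) (w : bW) : R :=
  clip (U ^+ 3) (L0 n w jl.1 * L0 n w jl.2 * (slope0 w - Bmin / 2)).

Lemma measurable_L0 n j : measurable_fun setT (fun w : bW => L0 n w j).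
Proof. exact: (measurable_Lam _ measurable_zpart (measurableT_comp mg0 measurable_zpart)). Qed.

Lemma measurable_gram_entry n jl : measurable_fun setT (gram_entry (n:=n) jl).
Proof.
apply: measurable_clip; apply: measurable_funM; first by apply: measurable_funM; exact: measurable_L0.
by apply: measurable_funB => //; exact: measurable_slope0.
Qed.

Lemma gram_entry_bound n jl w : `|gram_entry (n:=n) jl w| <= U ^+ 3.
Proof. by apply: clip_le; rewrite exprn_ge0 // U_ge0. Qed.

Lemma L0_bound n w j : goodZ (zp w) -> `|L0 n w j| <= U.
Proof.
move=> zg; have [_ _ _ HL] := Hbd; have [zs _ _ _] := zg.
by have [_ _ []] := HL n _ _ j zs (good_domG zg).
Qed.

Lemma gram_entry_good n jl w : goodW w ->
  gram_entry (n:=n) jl w = L0 n w jl.1 * L0 n w jl.2 * (slope0 w - Bmin / 2).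
Proof.
move=> [_ zg]; apply: clip_id.
have U0 := U_ge0; have [B0 _ _] := Hcurv.
have BU := Bmin_le_U.
have a0 : 0 <= slope0 w by exact: slope0_ge0.
have a1 : slope0 w <= U by exact: slope0_le.
have cb : `|slope0 w - Bmin / 2| <= U by rewrite ler_norml; apply/andP; split; lra.
have -> : U ^+ 3 = U * U * U by ring.
rewrite !normrM; apply: ler_pM => //.
by apply: ler_pM => //; exact: L0_bound.
Qed.

Definition gram_mean n (jl : 'I_(dimP M n) * 'I_(dimP M n)) : R :=
  Rintegral P setT (fun o => gram_entry jl (Wv M o)).

Lemma dotv_sq n (u v : 'rV[R]_n) : dotv u v ^+ 2 = \sum_(jl : 'I_n * 'I_n) (v ord0 jl.1 * v ord0 jl.2) * (u ord0 jl.1 * u ord0 jl.2).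
Proof.
rewrite -(pair_bigA _ (fun j l => (v ord0 j * v ord0 l) * (u ord0 j * u ord0 l))) /=.
rewrite expr2 {1}/dotv mulr_suml; apply: eq_bigr => j _.
rewrite /dotv mulr_sumr; apply: eq_bigr => l _; ring.
Qed.

(** By [curvature_mean] the weight a may be replaced by Bmin on average, which leaves
    Bmin/2 times the quadratic form of Sigma. *)
Lemma gram_mean_lower n (v : 'rV[R]_(dimP M n)) :
  Bmin / 2 * Cmin * (\sum_j v ord0 j ^+ 2) <= \sum_jl (v ord0 jl.1 * v ord0 jl.2) * gram_mean jl.
Proof.
have [B0 _ _] := Hcurv; have [C0 Hei] := Hid.
have aeg := ae_goodW.
pose x0 (z : bZ) : R := dotv (Lam M n z (g0 M z)) v.
have mx0 : measurable_fun setT x0 by exact: measurable_index.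
have mx0Z : measurable_fun setT (fun o => x0 (Z M o)) by exact: (measurableT_comp mx0 measurable_Z).
have maT : measurable_fun setT (fun o => slope0 (Wv M o)) by exact: (measurableT_comp measurable_slope0 measurable_Wv).
have U0 := U_ge0.
have x0b : {ae P, forall o, x0 (Z M o) ^+ 2 <= (U * norm1 v) ^+ 2}.
  apply: filterS aeg => o [_ zg]; rewrite -real_normK ?num_real // ler_sqr ?nnegrE ?mulr_ge0 ?norm1_ge0 //.
  by apply: dotv_bound => j; exact: L0_bound.
have i1 : P.-integrable setT (EFin \o (fun o => x0 (Z M o) ^+ 2)).
  apply: (ae_bounded_int (c := (U * norm1 v) ^+ 2)); first exact: measurable_funX.
  by apply: filterS x0b => o h; rewrite ger0_norm ?sqr_ge0.
have i2 : P.-integrable setT (EFin \o (fun o => x0 (Z M o) ^+ 2 * slope0 (Wv M o))).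
  apply: (ae_bounded_int (c := (U * norm1 v) ^+ 2 * U)); first by apply: measurable_funM => //; exact: measurable_funX.
  apply: filterS x0b => o h; have a0 := slope0_ge0 (Wv M o); rewrite ger0_norm; last by rewrite mulr_ge0 ?sqr_ge0.
  by apply: ler_pM; rewrite ?sqr_ge0 //; exact: slope0_le.
have ic jl : P.-integrable setT (EFin \o (fun o => gram_entry (n:=n) jl (Wv M o))).
  apply: (ae_bounded_int (c := U ^+ 3)); first exact: (measurableT_comp (measurable_gram_entry jl) measurable_Wv).
  by apply: nearW => o; exact: gram_entry_bound.
have E1 : \sum_jl (v ord0 jl.1 * v ord0 jl.2) * gram_mean jl =
  Rintegral P setT (fun o => x0 (Z M o) ^+ 2 * slope0 (Wv M o)) - Bmin / 2 * Rintegral P setT (fun o => x0 (Z M o) ^+ 2).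
  have [is_ Es] := Rintegral_lincomb (index_enum _) (fun jl => v ord0 jl.1 * v ord0 jl.2) ic.
  rewrite -Es -RintegralZl // -RintegralB //; last first.
    apply: (eq_integrable _ (fun o => (Bmin / 2)%:E * (x0 (Z M o) ^+ 2)%:E)%E) => //; exact: integrableZl.
  rewrite /Rintegral; congr fine; apply: ae_eq_integral => //.
  - exact: measurable_int is_.
  - apply/measurable_EFinP; apply: measurable_funB; first by apply: measurable_funM => //; exact: measurable_funX.
    by apply: measurable_funM => //; exact: measurable_funX.
  apply: filterS aeg => o go _; congr (_%:E).
  transitivity (x0 (Z M o) ^+ 2 * (slope0 (Wv M o) - Bmin / 2)); last by ring.
  rewrite /x0 dotv_sq mulr_suml; apply: eq_bigr => jl _.
  by rewrite gram_entry_good //= mulrA.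
have E2 : Rintegral P setT (fun o => x0 (Z M o) ^+ 2) = bilin (Sigma M n) v v.
  have iL (jl : 'I_(dimP M n) * 'I_(dimP M n)) : P.-integrable setT (EFin \o (fun o => L0 n (Wv M o) jl.1 * L0 n (Wv M o) jl.2)).
    apply: (ae_bounded_int (c := U * U)).
      by apply: measurable_funM; exact: (measurableT_comp (measurable_L0 _) measurable_Wv).
    by apply: filterS aeg => o [_ zg]; rewrite normrM; apply: ler_pM => //; exact: L0_bound.
  have [_ Es] := Rintegral_lincomb (index_enum _) (fun jl => v ord0 jl.1 * v ord0 jl.2) iL.
  transitivity (Rintegral P setT (fun o => \sum_jl (v ord0 jl.1 * v ord0 jl.2) * (L0 n (Wv M o) jl.1 * L0 n (Wv M o) jl.2))).
    by rewrite /Rintegral; congr fine; apply: eq_integral => o _; rewrite /x0 dotv_sq.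
  rewrite Es /bilin (pair_bigA _ (fun i j => v ord0 i * Sigma M n i j * v ord0 j)) /=; apply: eq_bigr => jl _.
  by rewrite mulrAC; congr (_ * _); rewrite mxE unlock.
have E3 : Bmin * Rintegral P setT (fun o => x0 (Z M o) ^+ 2) <= Rintegral P setT (fun o => x0 (Z M o) ^+ 2 * slope0 (Wv M o)).
  have := curvature_mean mx0.
  rewrite -lee_fin EFinM /Rintegral !fineK //; exact: integrable_fin_num.
have sS : (Sigma M n)^T = Sigma M n.
  by apply/matrixP => i j; rewrite !mxE; congr fine; congr expectation; apply/funext => o; rewrite mulrC.
have E4 := min_eigenvalue_quadratic sS (Hei n) v.
rewrite E1; rewrite E2 in E3 *.
have : 0 <= Bmin / 2 by lra.
set b := bilin _ _ _ in E3 E4 *; set q := \sum_j _ in E4 *; set i := Rintegral _ _ _ in E3 *.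
move=> B20; have : Bmin / 2 * (Cmin * q) <= Bmin / 2 * b by rewrite ler_wpM2l.
lra.
Qed.

(** Averages [loss_curvature] over the sample.  The quadratic form of a matrix with
    entries at most tau1 is bounded by tau1 |v|_1^2, which gives the first correction. *)
Lemma empirical_loss_bounds : exists eta C : R, [/\ 0 < eta, 0 <= C &
  forall n (ws : nat -> 'rV[R]_(dimW M)) g (tau1 tau2 : R), (0 < n)%N ->
  (forall i, (i < n)%N -> goodW (ws i) /\ domG M (g (zp (ws i)))) ->
  let Qf (v : 'rV[R]_(dimP M n)) := Qhat ws (theta0 M n + v) g - Qhat ws (theta0 M n) g in
  let s j := n%:R^-1 * \sum_(i < n) score_at (n:=n) g j (ws i) in
  [/\ forall v : 'rV[R]_(dimP M n), \sum_j s j * v ord0 j <= Qf v,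
     forall (v : 'rV[R]_(dimP M n)) a, 0 <= a <= 1 -> Qf (a *: v) <= a * Qf v
   & (forall jl, `|n%:R^-1 * \sum_(i < n) gram_entry (n:=n) jl (ws i) - gram_mean jl| <= tau1) ->
  n%:R^-1 * \sum_(i < n) Num.min 1 (gap g (zp (ws i))) <= tau2 ->
     forall v : 'rV[R]_(dimP M n), norm1 v <= eta ->
     \sum_j s j * v ord0 j + Bmin * Cmin / 4 * (\sum_j v ord0 j ^+ 2)
        - (tau1 / 2 + C * tau2) * norm1 v ^+ 2 <= Qf v]].
Proof.
have [eta [C [e0 C0 HR]]] := loss_curvature.
exists eta, C; split => // n ws g tau1 tau2 n0 Hgood Qf s.
have nR : 0 < n%:R^-1 :> R by rewrite invr_gt0 ltr0n.
pose G (v : 'rV[R]_(dimP M n)) (i : 'I_n) := lossat (theta0 M n + v) g (ws i) - lossat (theta0 M n) g (ws i).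
pose x v (i : 'I_n) := dotv (Lam M n (zp (ws i)) (g (zp (ws i)))) v.
pose mi (i : 'I_n) := mom M (ws i) (lin_index (theta0 M n) g (zp (ws i))) (g (zp (ws i))).
have QE (v : 'rV[R]_(dimP M n)) : Qf v = n%:R^-1 * \sum_(i < n) G v i by rewrite /Qf /Qhat -mulrBr -sumrB.
have sE (v : 'rV[R]_(dimP M n)) : \sum_j s j * v ord0 j = n%:R^-1 * \sum_(i < n) mi i * x v i.
  under eq_bigr do rewrite /s -mulrA mulr_suml.
  rewrite -mulr_sumr exchange_big; congr (_ * _); apply: eq_bigr => i _ /=.
  rewrite /x /dotv mulr_sumr; apply: eq_bigr => j _.
  have [[wD _] _] := Hgood i (ltn_ord i).
  by rewrite /score_at mom_extE //; rewrite /mi; ring.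
have gi (i : 'I_n) : goodW (ws i) /\ domG M (g (zp (ws i))) by exact: Hgood.
split.
- move=> v; rewrite QE sE; apply: ler_wpM2l; first exact: ltW.
  apply: ler_sum => i _; have [[wD _] gD] := gi i.
  by rewrite -subr_ge0; exact: loss_convex.
- move=> v a /andP[a0 a1]; rewrite !QE mulrCA; apply: ler_wpM2l; first exact: ltW.
  rewrite mulr_sumr; apply: ler_sum => i _; have [[wD _] gD] := gi i.
  pose th := theta0 M n + a *: v.
  have h1 := loss_convex th ((- a) *: v) wD gD.
  have h2 := loss_convex th ((1 - a) *: v) wD gD.
  have E0 : theta0 M n + a *: v + (- a) *: v = theta0 M n by rewrite -addrA -scalerDl subrr scale0r addr0.
  rewrite /th E0 in h1.
  have E : theta0 M n + a *: v + (1 - a) *: v = theta0 M n + v by rewrite -addrA -scalerDl addrCA subrr addr0 scale1r.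
  rewrite /th E in h2; rewrite dotvZr in h1; rewrite dotvZr in h2.
  have h3 := mulr_ge0 (_ : 0 <= 1 - a) h1; have h4 := mulr_ge0 a0 h2.
  have {}h3 := h3 ltac:(by rewrite subr_ge0).
  move: h3 h4; rewrite /G; set A := lossat _ _ _; set A0 := lossat (theta0 M n + a *: v) _ _.
  set A1 := lossat (theta0 M n + v) _ _; set m := mom _ _ _ _; set y := dotv _ _; lra.
- move=> Hc Hd v ve; rewrite QE sE.
  have E1 : 2^-1 * (n%:R^-1 * \sum_(i < n) (slope0 (ws i) - Bmin / 2) * dotv (Lam M n (zp (ws i)) (g0 M (zp (ws i)))) v ^+ 2)
     - C * norm1 v ^+ 2 * (n%:R^-1 * \sum_(i < n) Num.min 1 (gap g (zp (ws i)))) <=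
     n%:R^-1 * \sum_(i < n) G v i - n%:R^-1 * \sum_(i < n) mi i * x v i.
    rewrite -mulrBr -sumrB mulrCA [C * norm1 v ^+ 2 * _]mulrCA -mulrBr; apply: ler_wpM2l; first exact: ltW.
    rewrite !mulr_sumr -sumrB; apply: ler_sum => i _; have [gw gD] := gi i.
    exact: (HR n g (ws i) v gw gD ve).
  have E2 : n%:R^-1 * \sum_(i < n) (slope0 (ws i) - Bmin / 2) * dotv (Lam M n (zp (ws i)) (g0 M (zp (ws i)))) v ^+ 2 =
     \sum_jl (v ord0 jl.1 * v ord0 jl.2) * (n%:R^-1 * \sum_(i < n) gram_entry (n:=n) jl (ws i)).
    under [RHS]eq_bigr do rewrite mulrCA mulr_sumr.
    rewrite -mulr_sumr exchange_big; congr (_ * _); apply: eq_bigr => i _ /=.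
    rewrite dotv_sq mulr_sumr; apply: eq_bigr => jl _.
    have [gw _] := gi i; rewrite gram_entry_good //; ring.
  have E3 : \sum_jl (v ord0 jl.1 * v ord0 jl.2) * gram_mean jl - tau1 * norm1 v ^+ 2 <=
     \sum_jl (v ord0 jl.1 * v ord0 jl.2) * (n%:R^-1 * \sum_(i < n) gram_entry (n:=n) jl (ws i)).
    rewrite lerBlDr -lerBlDl -sumrB.
    have -> : norm1 v ^+ 2 = \sum_(jl : 'I_(dimP M n) * 'I_(dimP M n)) `|v ord0 jl.1| * `|v ord0 jl.2|.
      rewrite -(pair_bigA _ (fun j l => `|v ord0 j| * `|v ord0 l|)) /= expr2 {1}/norm1 mulr_suml.
      by apply: eq_bigr => j _; rewrite /norm1 mulr_sumr.
    rewrite mulr_sumr; apply: ler_sum => jl _; rewrite -mulrBr; apply: le_trans (ler_norm _) _.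
    rewrite normrM mulrC; apply: ler_pM => //; last by rewrite normrM.
    by rewrite distrC.
  have E4 := gram_mean_lower v.
  have E5 : C * norm1 v ^+ 2 * (n%:R^-1 * \sum_(i < n) Num.min 1 (gap g (zp (ws i)))) <= C * norm1 v ^+ 2 * tau2.
    by rewrite ler_wpM2l // mulr_ge0 // sqr_ge0.
  rewrite E2 in E1; lra.
Qed.

(** * Probability of the good events *)

Section Sample.
Variable Ws : nat -> {RV P >-> bvec R (dimW M)}.
Hypothesis Hiid : iid_copies P (W M) Ws.
Variables (d' : measure_display) (S : measurableType d') (V : {RV P >-> S}).
Variable gh : S -> 'rV[R]_(dimZ M) -> 'rV[R]_(dimG M).
Hypothesis mgh : measurable_fun [set: S * bZ] (fun x => gh x.1 x.2 : bG).
Variable n : nat.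
Hypothesis n0 : (0 < n)%N.
Hypothesis Hind : independent P V (fun o => [tuple Ws i o | i < n] : n.-tuple bW).
Variable E : set S.
Hypothesis mE : measurable E.
Hypothesis Hpath : forall v, E v -> path_in_domain n (gh v).

Lemma sample_measurable : measurable_fun setT (fun o => [tuple Ws i o | i < n] : n.-tuple bW).
Proof.
apply/measurable_fun_tnthP => i.
rewrite (_ : _ \o _ = Ws i); first exact: measurable_funP.
by apply/funext => o /=; rewrite tnth_mktuple.
Qed.

(** The nuisance estimate depends on V only, so that for the sample it may be treated
    as a fixed function: this is the use made of the auxiliary sample. *)
Lemma conditional_bound (B : set (S * n.-tuple bW)) (e : R) : measurable B -> 0 <= e ->
  (forall v, E v -> (P [set o | B (v, [tuple Ws i o | i < n])] <= e%:E)%E) ->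
  measurable [set o | E (V o) /\ B (V o, [tuple Ws i o | i < n])] /\
  (P [set o | E (V o) /\ B (V o, [tuple Ws i o | i < n])] <= e%:E)%E.
Proof.
move=> mB e0 H.
pose Y : {RV P >-> n.-tuple bW} := [the {RV P >-> n.-tuple bW} of mfun_Sub (mem_set sample_measurable)].
split.
  have m1 : measurable_fun setT (fun o => (V o, [tuple Ws i o | i < n] : n.-tuple bW)).
    by apply: measurable_fun_pair => //; exact: sample_measurable.
  apply: measurableI; first by rewrite -[X in measurable X]setTI; exact: measurable_funP.
  by rewrite -[X in measurable X]setTI; exact: m1.
apply: (@independent_section_bound _ Omega R P _ S _ (n.-tuple bW) V Y E B e) => // v Ev.
apply: le_trans (H v Ev); rewrite le_eqVlt; apply/orP; left; apply/eqP; congr (P _).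
by apply/seteqP; split => o; rewrite /xsection /= inE.
Qed.

Lemma measurable_nuisance v : measurable_fun setT (gh v : bZ -> bG).
Proof. exact: (measurableT_comp mgh (measurable_pair1 v)). Qed.

Definition nuisance_at (x : S * bW) : bG := gh x.1 (zp x.2).

Lemma measurable_nuisance_at : measurable_fun setT nuisance_at.
Proof.
have m2 : measurable_fun setT (fun x : S * bW => (x.1, zp x.2 : bZ)).
  by apply: measurable_fun_pair; [exact: measurable_fst|exact: (measurableT_comp measurable_zpart measurable_snd)].
exact: (measurableT_comp mgh m2).
Qed.

Lemma measurable_score_joint j : measurable_fun setT (fun x : S * bW => score_at (n:=n) (gh x.1) j x.2).
Proof.
have mz : measurable_fun setT (fun x : S * bW => zp x.2 : bZ) by exact: (measurableT_comp measurable_zpart measurable_snd).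
apply: measurable_funM; first exact: (measurable_Lam _ mz measurable_nuisance_at).
apply: (measurable_mom_ext measurable_snd _ measurable_nuisance_at).
exact: (measurable_index _ mz measurable_nuisance_at).
Qed.

Lemma measurable_pick d1 (T : measurableType d1) (i : 'I_n) (h : S * bW -> T) :
  measurable_fun setT h -> measurable_fun setT (fun x : S * n.-tuple bW => h (x.1, tnth x.2 i)).
Proof.
move=> mh; have m2 : measurable_fun setT (fun x : S * n.-tuple bW => (x.1, tnth x.2 i)).
  apply: measurable_fun_pair; first exact: measurable_fst.
  exact: (measurableT_comp (measurable_tnth i) measurable_snd).
exact: (measurableT_comp mh m2).
Qed.

(** The third condition says that clipping at U^2 leaves the score unchanged. *)
Definition regular_point (v : S) (w : bW) : Prop :=
  [/\ goodW w, domG M (gh v (zp w)) & forall j, `|score_at (n:=n) (gh v) j w| <= U ^+ 2].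

Lemma measurable_regular_point : measurable [set x : S * bW | regular_point x.1 x.2].
Proof.
have [[_ _ _ [_ _ oG _ _]] _ _ _] := Hbd.
rewrite (_ : [set x | _] = (snd @^-1` goodW) `&` (nuisance_at @^-1` domG M) `&`
  \bigcap_(j in [set: 'I_(dimP M n)]) [set x | `|score_at (n:=n) (gh x.1) j x.2| <= U ^+ 2]); last first.
  apply/seteqP; split => x /=; first by move=> [h1 h2 h3]; split => // j _; exact: h3.
  by move=> [[h1 h2] h3]; split => // j; exact: h3.
apply: measurableI; first apply: measurableI.
- rewrite -[X in measurable X]setTI; apply: (measurable_snd) => //; exact: measurable_goodW.
- exact: (preimage_open_bvec measurable_nuisance_at oG).
apply: fin_bigcap_measurable => // j _.
rewrite [X in measurable X](_ : _ = (fun x : S * bW => `|score_at (n:=n) (gh x.1) j x.2|) @^-1` `]-oo, U ^+ 2]%classic).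
  rewrite -[X in measurable X]setTI; apply: (measurableT_comp _ (measurable_score_joint j)) => //.
by apply/seteqP; split => x /=; rewrite in_itv.
Qed.

Lemma ae_regular_point v : E v -> {ae P, forall o, regular_point v (Wv M o)}.
Proof.
move=> Ev; have [_ _ Hm HL] := Hbd.
apply: filterS2 ae_goodW (Hpath Ev) => o go /(_ 1 ltac:(by rewrite ler01 lexx)).
have -> : gpath (M:=M) (gh v) 1 = gh v by apply/funext => z; rewrite /gpath scale1r subrK.
move=> [hG hT]; have [wD [zs _ _ _]] := go; split => // j.
rewrite /score_at mom_extE // normrM expr2; apply: ler_pM => //.
  by have [_ _ []] := HL n _ _ j zs hG.
by have [_ _ _ _ []] := Hm _ _ _ wD hT hG.
Qed.

Lemma prob_regular_sample :
  measurable [set o | exists i : 'I_n, E (V o) /\ ~ regular_point (V o) (Ws i o)] /\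
  (P [set o | exists i : 'I_n, E (V o) /\ ~ regular_point (V o) (Ws i o)] <= 0)%E.
Proof.
have law0 v (i : 'I_n) : E v -> P [set o | ~ regular_point v (Ws i o)] = 0%E.
  move=> Ev; have mr : measurable [set w : bW | ~ regular_point v w].
    apply: (@measurableC _ _ [set w : bW | regular_point v w]); have := @measurable_pair1 _ _ S bW v measurableT _ measurable_regular_point.
    by rewrite setTI.
  have -> : P [set o | ~ regular_point v (Ws i o)] = P [set o | ~ regular_point v (Wv M o)].
    exact: (Hiid.1 i _ mr).
  apply: measure_negligible; last exact: (ae_regular_point Ev).
  by have := measurable_Wv measurableT mr; rewrite setTI.
have Hi (i : 'I_n) : measurable [set o | E (V o) /\ ~ regular_point (V o) (Ws i o)] /\
  (P [set o | E (V o) /\ ~ regular_point (V o) (Ws i o)] <= 0%:E)%E.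
  pose B := [set x : S * n.-tuple bW | ~ regular_point x.1 (tnth x.2 i)].
  have mB : measurable B.
    apply: (@measurableC _ _ [set x : S * n.-tuple bW | regular_point x.1 (tnth x.2 i)]); have := measurable_pick i (h := id) (@measurable_id _ _ _).
    by move=> /(_ measurableT _ measurable_regular_point); rewrite setTI.
  have := conditional_bound mB (lexx 0).
  have -> : [set o | E (V o) /\ B (V o, [tuple Ws i0 o | i0 < n])] = [set o | E (V o) /\ ~ regular_point (V o) (Ws i o)].
    by rewrite /B /=; apply/seteqP; split => o /=; rewrite tnth_mktuple.
  apply => v Ev; rewrite /B /=.
  under eq_set do rewrite tnth_mktuple.
  by rewrite law0.
have := finite_union_bound (fun i => (Hi i).1) (fun i => (Hi i).2).
by rewrite mulr0.
Qed.

Lemma measurable_sample_average (h : S * bW -> R) : measurable_fun setT h ->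
  measurable_fun setT (fun x : S * n.-tuple bW => n%:R^-1 * \sum_(i < n) h (x.1, tnth x.2 i)).
Proof. by move=> mh; apply: measurable_funM => //; apply: measurable_sum => i; exact: measurable_pick. Qed.

(** The score is clipped so that its bound holds everywhere; t1 is the deviation of the
    average from its mean, and mbar bounds the mean. *)
Lemma prob_score (mbar t1 : R) : 0 < t1 ->
  (forall v j, E v -> P.-integrable setT (fun o => (score_at (n:=n) (gh v) j (Wv M o))%:E) /\
     `|fine (\int[P]_o (score_at (n:=n) (gh v) j (Wv M o))%:E)%E| <= mbar) ->
  let A := [set o | exists j, E (V o) /\
     mbar + t1 <= `|n%:R^-1 * \sum_(i < n) clip (U ^+ 2) (score_at (n:=n) (gh (V o)) j (Ws i o))|] in
  measurable A /\
  (P A <= ((dimP M n)%:R * (2 * expR (- (n%:R * t1 ^+ 2 / (32 * (U ^+ 2) ^+ 2)))))%:E)%E.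
Proof.
move=> t10 Hmean A.
have U0 := U_gt0.
set e := 2 * expR _; have e0 : 0 <= e by rewrite mulr_ge0 // expR_ge0.
have Hj j : measurable [set o | E (V o) /\
     mbar + t1 <= `|n%:R^-1 * \sum_(i < n) clip (U ^+ 2) (score_at (n:=n) (gh (V o)) j (Ws i o))|] /\
   (P [set o | E (V o) /\
     (mbar + t1 <= `|n%:R^-1 * \sum_(i < n) clip (U ^+ 2) (score_at (n:=n) (gh (V o)) j (Ws i o))|)%R] <= e%:E)%E.
  pose B := [set x : S * n.-tuple bW | mbar + t1 <= `|n%:R^-1 * \sum_(i < n) clip (U ^+ 2) (score_at (n:=n) (gh x.1) j (tnth x.2 i))|].
  have mB : measurable B.
    apply: measurable_level; apply: measurableT_comp => //.
    apply: (measurable_sample_average (h := fun x => clip (U ^+ 2) (score_at (n:=n) (gh x.1) j x.2))).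
    by apply: measurable_clip; exact: measurable_score_joint.
  have := conditional_bound mB e0.
  have BE v o : B (v, [tuple Ws i o | i < n]) = (mbar + t1 <= `|n%:R^-1 * \sum_(i < n) clip (U ^+ 2) (score_at (n:=n) (gh v) j (Ws i o))|) :> Prop.
    by rewrite /B /=; under eq_bigr do rewrite tnth_mktuple.
  under eq_set do rewrite BE.
  apply => v Ev; under eq_set do rewrite BE.
  have [ip bp] := Hmean v j Ev.
  pose h (w : bW) := clip (U ^+ 2) (score_at (n:=n) (gh v) j w).
  have mh : measurable_fun setT h by apply: measurable_clip; exact: (measurable_score_at j (measurable_nuisance v)).
  have hb w : `|h w| <= U ^+ 2 by apply: clip_le; exact: sqr_ge0.
  set mu := fine _ in bp.
  have hmu : (\int[P]_o (h (Wv M o))%:E = mu%:E)%E.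
    rewrite /mu fineK; last exact: integrable_fin_num.
    apply: ae_eq_integral => //.
    - by apply/measurable_EFinP; exact: (measurableT_comp mh measurable_Wv).
    - exact: measurable_int ip.
    apply: filterS (ae_regular_point Ev) => o [_ _ H] _; congr (_%:E); exact: clip_id.
  apply: le_trans (hoeffding measurable_Wv (fun i => measurable_funP _) Hiid n0 _ t10 mh hb hmu); last by rewrite exprn_gt0.
  have mav : measurable_fun setT (fun o => n%:R^-1 * \sum_(i < n) h (Ws i o)).
    by apply: measurable_funM => //; apply: (measurable_sumXs (fun i => measurable_funP _)).
  apply: le_measure; rewrite ?inE.
  - by apply: measurable_level; apply: measurableT_comp.
  - by apply: measurable_level; apply: measurableT_comp => //; exact: measurable_funB.
  move=> o /= h1; rewrite -/(h _) in h1.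
  have := ler_normD (n%:R^-1 * \sum_(i < n) h (Ws i o) - mu) mu; rewrite subrK; move: h1 bp; rewrite /h; lra.
have [mA PA] := finite_union_bound (fun j => (Hj j).1) (fun j => (Hj j).2).
by rewrite card_ord in PA.
Qed.

(** Truncation at 1 matches the correction term of [loss_curvature]. *)
Lemma prob_nuisance (b tau : R) : 0 < tau -> 0 <= b ->
  (forall v, E v -> (\int[P]_o (gap (gh v) (Z M o))%:E <= b%:E)%E) ->
  let A := [set o | E (V o) /\ tau <= n%:R^-1 * \sum_(i < n) Num.min 1 (gap (gh (V o)) (zp (Ws i o)))] in
  measurable A /\ (P A <= (b / tau)%:E)%E.
Proof.
move=> tau0 b0 Hm A.
have mz : measurable_fun setT (fun x : S * bW => zp x.2 : bZ) by exact: (measurableT_comp measurable_zpart measurable_snd).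
pose h (x : S * bW) : R := Num.min 1 (gap (gh x.1) (zp x.2)).
have mh : measurable_fun setT h.
  apply: measurable_minr => //; apply: measurable_sum => j; apply: measurableT_comp => //.
  have m1 := measurableT_comp (coord_measurable (R:=R) j) measurable_nuisance_at.
  have m2 := measurableT_comp (coord_measurable (R:=R) j) (measurableT_comp mg0 mz).
  apply: (eq_measurable_fun (fun x : S * bW => gh x.1 (zp x.2) ord0 j - g0 M (zp x.2) ord0 j)).
    by move=> z _; rewrite !mxE.
  exact: measurable_funB.
pose B := [set x : S * n.-tuple bW | tau <= n%:R^-1 * \sum_(i < n) h (x.1, tnth x.2 i)].
have mB : measurable B by apply: measurable_level; exact: measurable_sample_average.
have e0 : 0 <= b / tau by rewrite divr_ge0 // ltW.
have := conditional_bound mB e0.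
have BE v o : B (v, [tuple Ws i o | i < n]) = (tau <= n%:R^-1 * \sum_(i < n) h (v, Ws i o)) :> Prop.
  by rewrite /B /=; under eq_bigr do rewrite tnth_mktuple.
under eq_set do rewrite BE.
apply => v Ev; under eq_set do rewrite BE.
apply: (markov_average measurable_Wv (fun i => measurable_funP _) Hiid (h := fun w => h (v, w))) => //.
- exact: (measurableT_comp mh (measurable_pair1 v)).
- by move=> w; rewrite /h /= le_min ler01 norm1_ge0.
apply: le_trans (Hm v Ev); apply: ge0_le_integral => //.
- by move=> o _; rewrite lee_fin /h le_min ler01 norm1_ge0.
- apply/measurable_EFinP; exact: (measurableT_comp (measurableT_comp mh (measurable_pair1 v)) measurable_Wv).
- by apply/measurable_EFinP; exact: (measurableT_comp (measurable_gap (measurable_nuisance v)) measurable_Z).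
by move=> o _; rewrite lee_fin /h /= ge_min lexx orbT.
Qed.

Lemma prob_curvature (tau : R) : 0 < tau ->
  let A := [set o | exists jl, tau <= `|n%:R^-1 * \sum_(i < n) gram_entry (n:=n) jl (Ws i o) - gram_mean jl|] in
  measurable A /\
  (P A <= ((dimP M n)%:R ^+ 2 * (2 * expR (- (n%:R * tau ^+ 2 / (32 * (U ^+ 3) ^+ 2)))))%:E)%E.
Proof.
move=> tau0 A.
have U0 := U_gt0.
have mc jl := measurable_gram_entry (n := n) jl.
have mcW jl : measurable_fun setT (fun o => gram_entry (n:=n) jl (Wv M o)) by exact: (measurableT_comp (mc jl) measurable_Wv).
have cb jl (w : bW) : `|gram_entry (n:=n) jl w| <= U ^+ 3 by exact: gram_entry_bound.
have mAj jl : measurable [set o | tau <= `|n%:R^-1 * \sum_(i < n) gram_entry (n:=n) jl (Ws i o) - gram_mean jl|].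
  apply: measurable_level; apply: measurableT_comp => //; apply: measurable_funB => //.
  by apply: measurable_funM => //; apply: (measurable_sumXs (fun i => measurable_funP _)).
have ic jl : P.-integrable setT (EFin \o (fun o => gram_entry (n:=n) jl (Wv M o))).
  by apply: (ae_bounded_int (c := U ^+ 3)) => //; apply: nearW => o; exact: cb.
have Pj jl := hoeffding measurable_Wv (fun i => measurable_funP _) Hiid n0 (exprn_gt0 3 U0) tau0 (mc jl) (cb jl)
   (esym (fineK (integrable_fin_num measurableT (ic jl)))).
have [mA PA] := finite_union_bound mAj Pj.
by rewrite card_prod card_ord natrM -expr2 in PA.
Qed.

Lemma score_sample (mbar t1 : R) : 0 < t1 ->
  (forall v j, E v -> P.-integrable setT (fun o => (score_at (n:=n) (gh v) j (Wv M o))%:E) /\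
     `|fine (\int[P]_o (score_at (n:=n) (gh v) j (Wv M o))%:E)%E| <= mbar) ->
  exists A, [/\ measurable A,
    (P A <= ((dimP M n)%:R * (2 * expR (- (n%:R * t1 ^+ 2 / (32 * (U ^+ 2) ^+ 2)))))%:E)%E &
    forall o, E (V o) -> ~ A o ->
    (forall i, (i < n)%N -> goodW (Ws i o) /\ domG M (gh (V o) (zp (Ws i o)))) /\
    (forall j, `|n%:R^-1 * \sum_(i < n) score_at (n:=n) (gh (V o)) j (Ws i o)| <= mbar + t1)].
Proof.
move=> t10 Hmean.
have [m1 P1] := prob_score t10 Hmean.
have [m4 P4] := prob_regular_sample.
set A1 := [set o | _] in m1 P1; set A4 := [set o | _] in m4 P4.
exists (A1 `|` A4); split; first exact: measurableU.
  by apply: le_trans (measureU2 P m1 m4) _; rewrite -[leRHS]adde0; exact: leeD.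
move=> o Eo /not_orP[n1 n4].
have rp i : (i < n)%N -> regular_point (V o) (Ws i o).
  by move=> i_n; apply: contrapT => nr; apply: n4; exists (Ordinal i_n).
split; first by move=> i /rp[].
move=> j; rewrite leNgt; apply/negP => h; apply: n1; exists j; split => //.
apply: le_trans (ltW h) _; rewrite le_eqVlt; apply/orP; left; apply/eqP; congr (`|_ * _|).
by apply: eq_bigr => i _; rewrite clip_id //; have [] := rp i (ltn_ord i).
Qed.

Lemma curvature_sample (tau1 tau2 b : R) : 0 < tau1 -> 0 < tau2 -> 0 <= b ->
  (forall v, E v -> (\int[P]_o (gap (gh v) (Z M o))%:E <= b%:E)%E) ->
  exists A, [/\ measurable A,
    (P A <= (b / tau2 +
       (dimP M n)%:R ^+ 2 * (2 * expR (- (n%:R * tau1 ^+ 2 / (32 * (U ^+ 3) ^+ 2)))))%:E)%E &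
    forall o, E (V o) -> ~ A o ->
    (forall jl, `|n%:R^-1 * \sum_(i < n) gram_entry (n:=n) jl (Ws i o) - gram_mean jl| <= tau1) /\
    n%:R^-1 * \sum_(i < n) Num.min 1 (gap (gh (V o)) (zp (Ws i o))) <= tau2].
Proof.
move=> tau10 tau20 b0 Hnu.
have [m2 P2] := prob_nuisance tau20 b0 Hnu.
have [m3 P3] := prob_curvature tau10.
set A2 := [set o | _] in m2 P2; set A3 := [set o | _] in m3 P3.
exists (A2 `|` A3); split; first exact: measurableU.
  by apply: le_trans (measureU2 P m2 m3) _; rewrite EFinD; exact: leeD.
move=> o Eo /not_orP[n2 n3]; split.
  by move=> jl; rewrite leNgt; apply/negP => h; apply: n3; exists jl; exact: ltW.
by rewrite leNgt; apply/negP => h; apply: n2; split => //; exact: ltW.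
Qed.

End Sample.

End Model.

(** * Rates *)

Section Asymptotics.
Context d {Omega : measurableType d} {R : realType} {P : probability Omega R}.
Variable M : model P.
Local Notation zp := (@zpart _ _ _ _ M).
Local Notation t n z := (lin_index (theta0 M n) (g0 M) z).
Local Notation bW := (bvec R (dimW M)).
Local Notation bZ := (bvec R (dimZ M)).
Local Notation bG := (bvec R (dimG M)).
Variable Ws : nat -> {RV P >-> bvec R (dimW M)}.
Variables (d' : measure_display) (S : nat -> measurableType d').
Variable V : forall n, {RV P >-> S n}.
Variable ghat : forall n, S n -> 'rV[R]_(dimZ M) -> 'rV[R]_(dimG M).
Variable N : fun_norm.
Variable G : set ('rV[R]_(dimZ M) -> 'rV[R]_(dimG M)).
Variable Gn : nat -> set ('rV[R]_(dimZ M) -> 'rV[R]_(dimG M)).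
Variable Theta : forall n, set 'rV[R]_(dimP M n).
Variables (Cmin Bmin U B0 : R) (delta gn : nat -> R).
Hypothesis Hreg : regular_model M.
Hypothesis Hnd : nondegenerate_rates M.
Hypothesis Hiid : iid_copies P (W M) Ws.
Hypothesis Hind : forall n, independent P (V n) (fun o => [tuple Ws i o | i < n] : n.-tuple (bvec R (dimW M))).
Hypothesis Hgh : forall n, measurable_fun [set: S n * bvec R (dimZ M)] (fun x => ghat x.1 x.2 : bvec R (dimG M)).
Hypothesis HGm : forall g, G g -> measurable_fun [set: bvec R (dimZ M)] (g : bvec R (dimZ M) -> bvec R (dimG M)).
Hypothesis Hmom : moment_condition M.
Hypothesis Hloss : loss_primitive M.
Hypothesis HQ : Q_well_defined M Gn.
Hypothesis Hmono : monotone_moment M.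
Hypothesis Hid : identification M Cmin.
Hypothesis Hcurv : restricted_curvature M Bmin.
Hypothesis Hbd : bounded_design M Gn Theta U.
Hypothesis HL2 : N = L2Norm -> L2_paths_in_domain M Gn.
Hypothesis Hfs : first_stage_rate M N G Gn V ghat delta gn.
Hypothesis HB0 : B0_condition M N Gn B0.
Hypothesis Hgr : growth M U gn.

Local Notation p n := (dimP M n).
Local Notation kR n := ((sparsity M n)%:R : R).
Definition rate n : R := Num.sqrt (ln (p n)%:R / n%:R) + B0 * gn n + gn n ^+ 2.

Lemma Gn_g0 n : Gn n (g0 M). Proof. by have [_ _ H _ _] := Hfs; have [] := H n. Qed.

Lemma measurable_Gn n g : Gn n g -> measurable_fun setT (g : bZ -> bG).
Proof. by have [_ _ H _ _] := Hfs => /(H n).2 /HGm. Qed.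

Let mg0 : measurable_fun setT (g0 M : bZ -> bG) := measurable_Gn (Gn_g0 0%N).
Let Gn0 := Gn_g0 0%N.

Lemma gn_ge0 n : 0 <= gn n.
Proof.
have [_ _ _ _ H] := Hfs.
have [h1 h2 _] := fnorm_moment mg0 mg0 (H n _ (Gn_g0 n)).
exact: le_trans h1 h2.
Qed.

Lemma B0_ge0 : 0 <= B0. Proof. by have [] := HB0. Qed.

Let U0 : 0 < U := U_gt0 Hreg Hmom Hmono Hcurv Hbd Gn0 mg0.

(** For the sup norm the margin of [good_margin] absorbs the deviation as soon as g_n
    is small; for the L2 norm this is a hypothesis. *)
Lemma paths_eventually : \forall n \near \oo, forall g, Gn n g -> path_in_domain (M:=M) n g.
Proof.
case: (pselect (N = L2Norm)) => [NL|NS]; first by apply: HL2.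
have NE : N = SupNorm by move: NS; case: N.
have [_ cg _ _ H] := Hfs.
have [eta eta0 He] := good_margin Hreg Hbd Gn0 mg0.
(* Both g and the index have to stay within eta. *)
pose e := Num.min eta (eta / U ^+ 2).
have e0 : 0 < e by rewrite lt_min eta0 divr_gt0 // exprn_gt0.
have /cvgrPdist_lt/(_ e e0) := cg.
apply: filterS => n; rewrite sub0r normrN ger0_norm ?gn_ge0 // lt_min => /andP[h1 h2] g Gg.
have hg := H n g Gg; rewrite NE in hg.
apply: (sup_path_in_domain Hreg Hmom Hmono Hcurv Hbd Gn0 mg0 n eta0 He hg h1).
by rewrite mulrC -ltr_pdivlMr // exprn_gt0.
Qed.

Lemma score_mean_bound : exists2 Kb : R, 0 <= Kb & forall n g (j : 'I_(p n)), Gn n g -> path_in_domain (M:=M) n g ->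
  P.-integrable setT (fun o => (score_at (n:=n) g j (Wv M o))%:E) /\
  `|fine (\int[P]_o (score_at (n:=n) g j (Wv M o))%:E)%E| <= B0 * gn n + Kb * gn n ^+ 2.
Proof.
have [B00 [B HB]] := HB0; have [_ _ _ _ H] := Hfs.
exists (`|B| + 3 * path_const U).
  by rewrite /path_const !(addr_ge0, mulr_ge0, exprn_ge0, sqr_ge0) // ltW.
move=> n g j Gg hp.
apply: (score_mean Hreg Hmom Hloss HQ Hmono Hcurv Hbd Gn0 mg0 Gg (measurable_Gn Gg) (H n g Gg) hp B00).
by move=> r r01; exact: HB.
Qed.

(** All summands of the growth condition are nonnegative, so each of them tends to 0;
    U^5 is a positive constant. *)
Lemma growth_small (e : R) : 0 < e -> \forall n \near \oo,
  kR n * gn n <= e /\ kR n ^+ 2 * Num.sqrt (2 * ln (2 * (p n)%:R) / n%:R) <= e.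
Proof.
move=> e0; pose e1 := Num.min e (e * U ^+ 5).
have e10 : 0 < e1 by rewrite lt_min e0 mulr_gt0 // exprn_gt0.
have /cvgrPdist_lt/(_ e1 e10) := Hgr.
apply: filterS => n; rewrite sub0r normrN => /(le_lt_trans (ler_norm _)).
have s0 (x : R) : 0 <= Num.sqrt x by exact: sqrtr_ge0.
have k0 : 0 <= kR n by []. have g00 := gn_ge0 n.
set s := Num.sqrt (2 * _ / _); set s' := Num.sqrt (_ / _); rewrite lt_min => /andP[h1 h2].
have U50 : 0 < U ^+ 5 by rewrite exprn_gt0.
have ss : 0 <= s by exact: s0.
have ss' : 0 <= s' by exact: s0.
have U30 : 0 <= U ^+ 3 by rewrite exprn_ge0 // ltW.
have U5 := ltW U50.
have a1 := mulr_ge0 k0 (mulr_ge0 (mulr_ge0 U5 k0) ss).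
have a2 := mulr_ge0 k0 (mulr_ge0 (mulr_ge0 (mulr_ge0 (ler0n R 3) (ler0n R (dimG M))) U30) ss').
have a3 : 0 <= kR n * gn n by rewrite mulr_ge0.
split; first by move: h1; rewrite !mulrDr; lra.
rewrite -(ler_pM2r U50); move: h2; rewrite !mulrDr.
have -> : kR n ^+ 2 * s * U ^+ 5 = kR n * (U ^+ 5 * kR n * s) by ring.
lra.
Qed.

Lemma ln_dim_bounds n : (1 < p n)%N -> [/\ 0 <= ln (p n)%:R :> R, ln (p n)%:R <= ln (2 * (p n)%:R) :> R, 1 <= ln (2 * (p n)%:R) :> R & 0 < ln (p n)%:R :> R].
Proof.
move=> p1; have p0 : 0 < (p n)%:R :> R by rewrite ltr0n (ltn_trans _ p1).
have p1R : 1 < (p n)%:R :> R by rewrite ltr1n.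
have l0 : 0 < ln (p n)%:R :> R by rewrite ln_gt0.
split => //; first exact: ltW.
  by rewrite ler_ln ?posrE ?mulr_gt0 //; lra.
rewrite -[leLHS]expRK ler_ln ?posrE ?expR_gt0 ?mulr_gt0 //.
have p2 : 2 <= (p n)%:R :> R by rewrite ler_nat.
have : expR 1 <= (4:R); last by lra.
have := @expR_ge1Dx R (- 2^-1); have := expRxMexpNx_1 (2^-1 : R); have := expR_gt0 (2^-1 : R).
have -> : expR 1 = expR 2^-1 * expR 2^-1 :> R by rewrite -expRD; congr expR; lra.
set x := expR 2^-1; set y := expR _; move=> x0 xy y2.
have : x <= 2 by nra.
nra.
Qed.

Lemma rate_gt0 n : (0 < n)%N -> (1 < p n)%N -> 0 < rate n.
Proof.
move=> n0 p1; have [_ _ _ l0] := ln_dim_bounds p1.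
have : 0 < Num.sqrt (ln (p n)%:R / n%:R) :> R by rewrite sqrtr_gt0 divr_gt0 // ltr0n.
have := sqr_ge0 (gn n); have := mulr_ge0 B0_ge0 (gn_ge0 n); rewrite /rate; lra.
Qed.

(** Since k is an integer, k <= k^2, and the second summand of the growth condition
    dominates k sqrt(log p / n). *)
Lemma sparse_rate_small (e : R) : 0 < e -> \forall n \near \oo, kR n * rate n <= e.
Proof.
move=> e0; have [_ cg _ _ _] := Hfs.
have B00 := B0_ge0.
pose e1 := e / (B0 + 2); have e10 : 0 < e1 by rewrite divr_gt0 //; lra.
have /cvgrPdist_lt/(_ 1 ltr01) := cg.
move=> H; near=> n.
have gn1 : gn n <= 1.
  have : `|0 - gn n| < 1 by near: n; exact: H.
  by rewrite sub0r normrN ger0_norm ?gn_ge0 // => /ltW.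
have [h1 h2] : kR n * gn n <= e1 /\ kR n ^+ 2 * Num.sqrt (2 * ln (2 * (p n)%:R) / n%:R) <= e1 by near: n; exact: growth_small.
have p1 : (1 < p n)%N by near: n; exact: Hnd.1.
have [l0 l1 l2 _] := ln_dim_bounds p1.
have g00 := gn_ge0 n.
have ss : Num.sqrt (ln (p n)%:R / n%:R) <= Num.sqrt (2 * ln (2 * (p n)%:R) / n%:R) :> R.
  by rewrite ler_wsqrtr // ler_wpM2r ?invr_ge0 //; lra.
have kk : kR n * Num.sqrt (2 * ln (2 * (p n)%:R) / n%:R) <= e1.
  apply: le_trans h2; rewrite ler_wpM2r ?sqrtr_ge0 // -natrX ler_nat.
  by case: (sparsity M n) => // m; rewrite expnS expn1 leq_pmulr.
have e1E : e1 * (B0 + 2) = e by rewrite mulfVK // gt_eqF //; lra.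
rewrite /rate !mulrDr -e1E.
have k0 : 0 <= kR n by [].
have a1 := ler_wpM2l k0 ss.
have a2 : kR n * gn n ^+ 2 <= e1.
  by apply: le_trans h1; rewrite ler_wpM2l // expr2; apply: ler_piMr.
have a3 : kR n * (B0 * gn n) <= B0 * e1 by rewrite mulrCA ler_wpM2l.
lra.
Unshelve. all: by end_near.
Qed.

(** The deviation t1 = 8 U^2 s sqrt(log p / n) turns the Hoeffding exponent into
    2 s^2 log p. *)
Lemma score_event : exists2 Kb : R, 0 <= Kb & forall n (E : set (S n)) (s : R),
  (0 < n)%N -> (1 < p n)%N -> (forall g, Gn n g -> path_in_domain (M:=M) n g) ->
  measurable E -> E `<=` [set v | Gn n (ghat v)] -> 0 < s ->
  exists A, [/\ measurable A,
    (P A <= ((p n)%:R * (2 * expR (- (2 * s ^+ 2 * ln (p n)%:R))))%:E)%E &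
    forall o, E (V n o) -> ~ A o ->
    (forall i, (i < n)%N -> goodW (M:=M) (Ws i o) /\ domG M (ghat (V n o) (zp (Ws i o)))) /\
    (forall j, `|n%:R^-1 * \sum_(i < n) score_at (n:=n) (ghat (V n o)) j (Ws i o)| <= (8 * U ^+ 2 * s + Kb) * rate n)].
Proof.
have [Kb Kb0 HK] := score_mean_bound.
exists (Kb + 1); first by lra.
move=> n E s n0 p1 Hp mE EG s0.
have nR : 0 < n%:R :> R by rewrite ltr0n.
have [l0 _ _ lp] := ln_dim_bounds p1.
have U20 : 0 < U ^+ 2 by rewrite exprn_gt0.
pose a := Num.sqrt (ln (p n)%:R / n%:R) : R.
have a0 : 0 < a by rewrite sqrtr_gt0 divr_gt0.
pose t1 := 8 * U ^+ 2 * s * a.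
have t10 : 0 < t1 by rewrite !mulr_gt0.
have Hm v j : E v -> P.-integrable setT (fun o => (score_at (n:=n) (ghat v) j (Wv M o))%:E) /\
     `|fine (\int[P]_o (score_at (n:=n) (ghat v) j (Wv M o))%:E)%E| <= B0 * gn n + Kb * gn n ^+ 2.
  by move=> Ev; apply: HK; [exact: EG|apply: Hp; exact: EG].
have [A [mA PA HA]] := score_sample Hreg Hmom Hmono Hcurv Hbd Gn0 mg0 Hiid (@Hgh n) n0 (@Hind n) mE
   (fun v Ev => Hp _ (EG v Ev)) t10 Hm.
exists A; split => //.
  apply: le_trans PA _; rewrite lee_fin; apply: ler_wpM2l => //; apply: ler_wpM2l => //.
  rewrite ler_expR lerN2 le_eqVlt; apply/orP; left; apply/eqP.
  rewrite /t1 !exprMn sqr_sqrtr ?divr_ge0 //; field.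
  by rewrite !gt_eqF.
move=> o Eo nA; have [h1 h2] := HA o Eo nA; split => // j; apply: le_trans (h2 j) _.
have g00 := gn_ge0 n; have B00 := B0_ge0.
have a1 : 0 <= 8 * U ^+ 2 * s by rewrite !mulr_ge0 // ltW.
have Bg : 0 <= B0 * gn n by rewrite mulr_ge0.
have g2 : 0 <= gn n ^+ 2 by exact: sqr_ge0.
have x1 := mulr_ge0 a1 Bg; have x2 := mulr_ge0 a1 g2; have x3 := mulr_ge0 Kb0 Bg.
have x4 := mulr_ge0 Kb0 (ltW a0).
rewrite /t1 /rate -/a; move: x1 x2 x3 x4.
set c := 8 * U ^+ 2 * s; lra.
Qed.

(** The only property of the estimator that is used: it does at least as well as
    theta0. *)
Lemma lasso_inequality n (th : 'rV[R]_(p n)) ws g lam : is_lasso M n ws g lam th ->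
  Qhat ws (theta0 M n + (th - theta0 M n)) g - Qhat ws (theta0 M n) g + lam * norm1 (theta0 M n + (th - theta0 M n))
    <= lam * norm1 (theta0 M n).
Proof.
have -> : theta0 M n + (th - theta0 M n) = th by rewrite addrC subrK.
by move=> /(_ (theta0 M n)); lra.
Qed.

(** The number b separates the two regimes for p; s is 1 for p >= b and at most s2
    otherwise.  The three probability bounds eps/4 are those of the score, of the nuisance
    average and of the Gram entries. *)
Lemma error_event : exists2 C0 : R, 0 < C0 & forall C eps : R, C0 <= C -> 0 < eps ->
  exists2 Mb : R, 0 <= Mb & \forall n \near \oo, forall E : set (S n),
  measurable E -> E `<=` [set v | Gn n (ghat v)] ->
  exists A, [/\ measurable A, (P A <= (3 / 4 * eps)%:E)%E &
    forall o (th : 'rV[R]_(p n)), E (V n o) -> ~ A o ->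
    is_lasso M n (fun i => Ws i o) (ghat (V n o)) (penalty M C B0 gn n) th ->
    norm2 (th - theta0 M n) <= Mb * (Num.sqrt (kR n) * penalty M C B0 gn n) /\
    norm1 (th - theta0 M n) <= Mb * (kR n * penalty M C B0 gn n)].
Proof.
have [Kb Kb0 HS] := score_event.
have [eta [Cq [eta0 Cq0 HQa]]] := empirical_loss_bounds Hreg Hmom Hloss Hmono Hid Hcurv Hbd Gn0 mg0.
have [Bm0 _ _] := Hcurv; have [Cm0 _] := Hid.
have U20 : 0 < U ^+ 2 by rewrite exprn_gt0.
exists (2 * (8 * U ^+ 2 + Kb)); first by lra.
move=> C eps CC e0.
have C00 : 0 < C by lra.
(* For p >= b the probability 2/p is at most eps/4. *)
have [b bb] : exists b : nat, 8 / eps <= b%:R.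
  by exists (Num.bound (8 / eps)); rewrite ltW // archi_boundP // divr_ge0 // ltW.
have [s2 s2E] : exists s2 : R, s2 = 1 + 4 * b%:R / (eps * ln 2) by eexists.
have l2 : 0 < ln 2 :> R by rewrite ln_gt0 // ltr1n.
have s20 : 0 <= s2 by rewrite s2E addr_ge0 ?divr_ge0 ?mulr_ge0 // ltW.
have c8 : 0 < 8 * U ^+ 2 by lra.
have [K K0 KE] : exists2 K : R, 0 <= K & forall s x, s <= s2 -> 0 <= x -> (8 * U ^+ 2 * s + Kb) * x <= K * (C * x).
  exists ((8 * U ^+ 2 * s2 + Kb) / C); first by rewrite divr_ge0 ?addr_ge0 // ?mulr_ge0 // ltW.
  by move=> s x ss x0; rewrite mulrA divfK ?gt_eqF // ler_wpM2r // lerD2r ler_wpM2l // ltW.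
have [Q [Q0 Q16 Qb]] : exists Q : R, [/\ 0 < Q, 16 <= Q & b%:R <= Q].
  have : 0 <= b%:R :> R by [].
  by move=> b0; exists (16 + b%:R); rewrite lerDr lerDl; split => //; rewrite ltr_pwDl.
have [kap kapE] : exists kap : R, kap = Bmin * Cmin / 4 by eexists.
have kap0 : 0 < kap by rewrite kapE divr_gt0 // mulr_gt0.
have sQ0 : 0 < Num.sqrt Q by rewrite sqrtr_gt0.
have [r0 r0E] : exists r0, r0 = 2 * (K + 1) * Num.sqrt Q / kap + 1 by eexists.
have r00 : 0 < r0.
  have X : 0 <= 2 * (K + 1) * Num.sqrt Q / kap by rewrite divr_ge0 ?mulr_ge0 ?addr_ge0 // ltW.
  by rewrite r0E ltr_wpDl.
exists (r0 * (1 + Num.sqrt Q)); first by rewrite mulr_ge0 ?addr_ge0 // ltW.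
have [e1 e10 e1E] : exists2 e1, 0 < e1 & e1 = eps / 4 * kap / (4 * Q * (Cq + 1)).
  by eexists; last reflexivity; rewrite divr_gt0 ?mulr_gt0 // ltr_wpDl.
have [c0 c00 c0E] : exists2 c0, 0 < c0 & c0 = kap ^+ 2 / (128 * Q ^+ 2 * (U ^+ 3) ^+ 2).
  by eexists; last reflexivity; rewrite divr_gt0 ?mulr_gt0 ?exprn_gt0.
have e20 : 0 < Num.min 1 (2 * c0 / (2 + 4 / eps)).
  by rewrite lt_min ltr01 divr_gt0 ?addr_gt0 ?divr_gt0 ?mulr_gt0.
(* e1 serves the Markov bound, the other term the Hoeffding bound for the Gram entries. *)
pose e12 := Num.min e1 (Num.min 1 (2 * c0 / (2 + 4 / eps))).
have e120 : 0 < e12 by rewrite lt_min e10.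
(* Keeps the sphere of radius r0 sqrt k lambda inside the region |nu|_1 <= eta. *)
pose e3 := eta / (Num.sqrt Q * r0 * C).
have e30 : 0 < e3 by rewrite divr_gt0 // !mulr_gt0.
near=> n => E mE EG.
have n0 : (0 < n)%N by near: n; exact: nbhs_infty_gt.
have p1 : (1 < p n)%N by near: n; exact: Hnd.1.
have Hp : forall g, Gn n g -> path_in_domain (M:=M) n g by near: n; exact: paths_eventually.
have Hkp : (0 < sparsity M n)%N \/ (b <= p n)%N by near: n; exact: Hnd.2.
have [g1 g2] : kR n * gn n <= e12 /\ kR n ^+ 2 * Num.sqrt (2 * ln (2 * (p n)%:R) / n%:R) <= e12.
  by near: n; exact: growth_small.
have kr : kR n * rate n <= e3 by near: n; exact: sparse_rate_small.
have rt0 := rate_gt0 n0 p1.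
have [lam lamE] : exists lam, lam = penalty M C B0 gn n by eexists.
rewrite -lamE; have {}lamE : lam = C * rate n by [].
have lam0 : 0 < lam by rewrite lamE mulr_gt0.
have scone : (8 * U ^+ 2 * 1 + Kb) * rate n <= lam / 2.
  by rewrite lamE [leRHS]mulrAC; apply: ler_wpM2r; [exact: ltW|rewrite mulr1 ler_pdivlMr // mulrC].
have [k0|kn0] := posnP (sparsity M n).
  have pb : (b <= p n)%N by move: Hkp; rewrite k0 => -[].
  have [A [mA PA HA]] := HS n E 1 n0 p1 Hp mE EG ltr01.
  exists A; split => //.
    apply: le_trans PA _; rewrite lee_fin.
    have pb' : 8 / eps <= (p n)%:R by apply: le_trans bb _; rewrite ler_nat.
    by apply: le_trans (score_tail_large e0 pb') _; rewrite three_quarters lerDl addr_ge0 // divr_ge0 // ltW.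
  move=> o th Eo nA Hl; have [Hg Hs] := HA o Eo nA.
  have [q1 _ _] := HQa n (fun i => Ws i o) (ghat (V n o)) 0 0 n0 Hg.
  have [-> ->] := lasso_zero_error lam0 Hs q1 (lasso_inequality Hl) scone k0.
  by rewrite k0 sqrtr0 !mul0r mulr0.
have kR0 : 0 < kR n by rewrite ltr0n.
have [tau10 tau20 tauQ tauE tauU] := tuning_constants kap0 Q0 kR0 Cq0.
set tau1 := kap / (2 * Q * kR n) in tau10 tauQ tauU; set tau2 := kap / (4 * Q * kR n * (Cq + 1)) in tau20 tauQ tauE.
have [s [s0 ss2 Ps1 Ps2]] := score_tail e0 p1 bb; rewrite -s2E in ss2.
have [A1 [mA1 PA1 HA1]] := HS n E s n0 p1 Hp mE EG s0.
have Hnu v : E v -> (\int[P]_o (norm1 (ghat v (Z M o) - g0 M (Z M o)))%:E <= (gn n)%:E)%E.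
  move=> Ev; have Gv := EG v Ev; have [_ _ _ _ H] := Hfs.
  exact: (first_moment mg0 (measurable_Gn Gv) (H n _ Gv)).
have [A2 [mA2 PA2 HA2]] := curvature_sample Hreg Hmom Hmono Hcurv Hbd Gn0 mg0 Hiid (@Hgh n) n0 (@Hind n) mE
   tau10 tau20 (gn_ge0 n) Hnu.
exists (A1 `|` A2); split; first exact: measurableU.
  apply: le_trans (measureU2 P mA1 mA2) _.
  rewrite three_quarters EFinD; apply: leeD; first by apply: le_trans PA1 _; rewrite lee_fin.
  apply: le_trans PA2 _; rewrite lee_fin; apply: lerD.
    by apply: tauE; rewrite -e1E; apply: le_trans g1 _; rewrite ge_min lexx.
  have [_ _ l1 _] := ln_dim_bounds p1.
  rewrite tauU ?exprn_gt0 // -c0E.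
  apply: curvature_tail => //; first exact: ltnW.
  by apply: le_trans g2 _; rewrite ge_min lexx orbT.
move=> o th Eo /not_orP[nA1 nA2] Hl.
have [Hg Hs] := HA1 o Eo nA1; have [Hc Hd] := HA2 o Eo nA2.
have [q1 q2 q3] := HQa n (fun i => Ws i o) (ghat (V n o)) tau1 tau2 n0 Hg.
have {}q3 := q3 Hc Hd; rewrite -kapE in q3.
have Hv := lasso_inequality Hl.
set v := th - theta0 M n in Hv *.
have vA : norm1 v ^+ 2 <= Q * kR n * norm2 v ^+ 2.
  case: Ps2 => [s1|pb].
    rewrite s1 in Hs; apply: le_trans (lasso_norm_ratio lam0 Hs q1 Hv scone) _.
    by rewrite ler_wpM2r ?sqr_ge0 // ler_wpM2r.
  apply: le_trans (norm1_sq v) _; rewrite -norm2_sqr ler_wpM2r ?sqr_ge0 //.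
  apply: le_trans (_ : b%:R <= _); first by rewrite ler_nat.
  by apply: le_trans Qb _; rewrite ler_peMr ?ler1n // ltW.
have S0 : 0 <= (8 * U ^+ 2 * s + Kb) * rate n.
  by apply: mulr_ge0; [apply: addr_ge0 => //; apply: mulr_ge0; exact: ltW|exact: ltW].
have SK : (8 * U ^+ 2 * s + Kb) * rate n <= K * lam by rewrite lamE; apply: KE => //; exact: ltW.
have tau0 : 0 <= tau1 / 2 + Cq * tau2.
  by apply: addr_ge0; [apply: divr_ge0 => //; exact: ltW|apply: mulr_ge0 => //; exact: ltW].
have /= LE := lasso_error lam0 S0 Hs q2 Hv kap0 Q0 kn0 tau0 K0 q3 tauQ SK vA.
rewrite -r0E in LE.
have [|h2 h1] := LE.
  have -> : Num.sqrt Q * r0 * (kR n * lam) = kR n * rate n * (Num.sqrt Q * r0 * C) by rewrite lamE; ring.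
  by rewrite -ler_pdivlMr // !mulr_gt0.
have sl x : 0 <= x -> 0 <= x * lam by move=> x0; rewrite mulr_ge0 // ltW.
split.
  by apply: le_trans h2 _; rewrite ler_wpM2r ?sl // ler_peMr ?lerDl // ltW.
apply: le_trans h1 _; rewrite ler_wpM2r ?sl // mulrDr mulr1 mulrC lerDr; exact: ltW.
Unshelve. all: by end_near.
Qed.

Lemma rare_event (A NE : set Omega) (L : Omega -> Prop) (X : Omega -> R) (c a b : R) :
  measurable A -> measurable NE -> measurable_fun setT X -> (P A <= a%:E)%E -> (P NE <= b%:E)%E ->
  {ae P, forall o, L o} -> (forall o, L o -> ~ A o -> ~ NE o -> X o <= c) ->
  (P [set o | (c < X o)%R] <= (a + b)%:E)%E.
Proof.
move=> mA mNE mX PA PNE [N0 [mN PN sub]] H.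
have mAN : measurable (A `|` NE) by exact: measurableU.
apply: (@le_trans _ _ (P (A `|` NE `|` N0))).
  apply: le_measure; rewrite ?inE; last first.
  - move=> o /= co; apply: contrapT => /not_orP[/not_orP[nA nN] nN0].
    have Lo : L o by apply: contrapT => nL; apply: nN0; exact: sub.
    by have := H o Lo nA nN; rewrite leNgt co.
  - exact: measurableU.
  rewrite [X in measurable X](_ : _ = X @^-1` `]c, +oo[%classic).
    by rewrite -[X in measurable X]setTI; exact: mX.
  by apply/seteqP; split => o /=; rewrite in_itv /= andbT.
apply: le_trans (measureU2 P mAN mN) _.
rewrite -[leRHS]adde0; apply: leeD; last first.
  by rewrite le_eqVlt; apply/orP; left; apply/eqP; exact: PN.
by apply: le_trans (measureU2 P mA mNE) _; rewrite EFinD; exact: leeD.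
Qed.

Lemma measurable_error n (th : Omega -> 'rV[R]_(p n)) : measurable_fun setT (th : Omega -> bvec R (p n)) ->
  measurable_fun setT (fun o => `|norm2 (th o - theta0 M n)|) /\
  measurable_fun setT (fun o => `|norm1 (th o - theta0 M n)|).
Proof.
move=> mth.
have mc j : measurable_fun setT (fun o => (th o - theta0 M n) ord0 j).
  apply: (eq_measurable_fun (fun o => th o ord0 j - theta0 M n ord0 j)).
    by move=> o _; rewrite !mxE.
  by apply: measurable_funB => //; exact: (measurableT_comp (coord_measurable (n := p n) j) mth).
split; apply: measurableT_comp => //.
  have mS : measurable_fun setT (fun o => \sum_j (th o - theta0 M n) ord0 j ^+ 2).
    by apply: measurable_sum => j; apply: measurable_funX.
  have mq : measurable_fun setT (@Num.sqrt R).
    by apply: continuous_measurable_fun; exact: sqrt_continuous.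
  exact: (measurableT_comp mq mS).
by apply: measurable_sum => j; apply: measurableT_comp.
Qed.

(** Adds the event that the first stage leaves G_n and the null set on which the
    estimator does not minimise the criterion.  A measurable function X is used because the
    errors themselves are compared through two different norms. *)
Lemma error_bound : exists C0 : R, forall C : R, C0 <= C ->
  forall th : forall n, Omega -> 'rV[R]_(p n),
  (\forall n \near \oo, {ae P, forall o,
     is_lasso M n (fun i => Ws i o) (ghat (V n o)) (penalty M C B0 gn n) (th n o)}) ->
  forall eps : R, 0 < eps -> exists2 Mb : R, 0 <= Mb & \forall n \near \oo,
   (forall X : Omega -> R, measurable_fun setT X -> forall c,
     (forall o, norm2 (th n o - theta0 M n) <= Mb * (Num.sqrt (kR n) * penalty M C B0 gn n) ->
       norm1 (th n o - theta0 M n) <= Mb * (kR n * penalty M C B0 gn n) -> X o <= c) ->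
     (P [set o | (c < X o)%R] <= eps%:E)%E).
Proof.
have [C0 C00 HE] := error_event.
exists C0 => C CC th Hl eps.
have [cd _ _ HV _] := Hfs.
move=> e0; have [Mb Mb0 HM] := HE C eps CC e0.
exists Mb => //.
have e4 : 0 < eps / 4 by rewrite divr_gt0.
have /cvgrPdist_lt/(_ _ e4) Hd := cd.
near=> n => X mX c HX.
have dn : delta n <= eps / 4.
  have : `|0 - delta n| < eps / 4 by near: n.
  by rewrite sub0r normrN => /ltW/(le_trans (ler_norm _)).
have [E [mE EG] PE] := HV n.
have [A [mA PA HA]] : exists A, [/\ measurable A, (P A <= (3 / 4 * eps)%:E)%E &
  forall o (th : 'rV[R]_(p n)), E (V n o) -> ~ A o ->
  is_lasso M n (fun i => Ws i o) (ghat (V n o)) (penalty M C B0 gn n) th ->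
  norm2 (th - theta0 M n) <= Mb * (Num.sqrt (kR n) * penalty M C B0 gn n) /\
  norm1 (th - theta0 M n) <= Mb * (kR n * penalty M C B0 gn n)].
  by move: E mE EG {PE}; near: n; exact: HM.
have Hln : {ae P, forall o, is_lasso M n (fun i => Ws i o) (ghat (V n o)) (penalty M C B0 gn n) (th n o)}.
  by near: n; exact: Hl.
have mVE : measurable (V n @^-1` E) by rewrite -[X in measurable X]setTI; exact: measurable_funP.
have PNE : (P (~` (V n @^-1` E)) <= (eps / 4)%:E)%E.
  have Pf : P (V n @^-1` E) \is a fin_num by rewrite fin_num_measure.
  move: PE; rewrite probability_setC // -(fineK Pf) !lee_fin => PE.
  by move: PE dn; lra.
have -> : eps = 3 / 4 * eps + eps / 4 by lra.
apply: (rare_event mA (measurableC mVE) mX PA PNE Hln) => o Lo nA /contrapT Eo.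
by have [h2 h1] := HA o (th n o) Eo nA Lo; exact: HX.
Unshelve. all: by end_near.
Qed.

Lemma lasso_rates : exists C0 : R, forall C : R, C0 <= C ->
    forall thetahat : forall n, Omega -> 'rV[R]_(dimP M n),
      (forall n, measurable_fun [set: Omega]
         (thetahat n : Omega -> bvec R (dimP M n))) ->
      (\forall n \near \oo, {ae P, forall o,
         is_lasso M n (fun i => Ws i o) (ghat (V n o)) (penalty M C B0 gn n)
           (thetahat n o)}) ->
      bigO_in_prob P (fun n o => norm2 (thetahat n o - theta0 M n))
        (fun n => Num.sqrt (sparsity M n)%:R * penalty M C B0 gn n) /\
      bigO_in_prob P (fun n o => norm1 (thetahat n o - theta0 M n))
        (fun n => (sparsity M n)%:R * penalty M C B0 gn n).
Proof.
have [C0 HE] := error_bound.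
exists C0 => C CC th mth Hl; have key := HE C CC th Hl.
have fin (Mb a x : R) : 0 <= Mb -> 0 <= x -> x <= Mb * a -> `|x| <= Mb * `|a|.
  by move=> Mb0 x0 xa; rewrite ger0_norm //; apply: le_trans xa _; rewrite ler_wpM2l // ler_norm.
split => eps e0; have [Mb Mb0 HM] := key eps e0; exists Mb; apply: filterS HM => n HM.
  apply: HM; first by have [] := measurable_error (mth n).
  by move=> o h _; apply: fin => //; exact: sqrtr_ge0.
apply: HM; first by have [] := measurable_error (mth n).
by move=> o _ h; apply: fin => //; exact: norm1_ge0.
Qed.

End Asymptotics.

Theorem theorem3p1
    (R : realType) (d : measure_display) (Omega : measurableType d)
    (P : probability Omega R) (M : model P)
    (Ws : nat -> {RV P >-> bvec R (dimW M)})
    (d' : measure_display) (S : nat -> measurableType d')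
    (V : forall n, {RV P >-> S n})
    (ghat : forall n, S n -> 'rV[R]_(dimZ M) -> 'rV[R]_(dimG M))
    (N : fun_norm)
    (G : set ('rV[R]_(dimZ M) -> 'rV[R]_(dimG M)))
    (Gn : nat -> set ('rV[R]_(dimZ M) -> 'rV[R]_(dimG M)))
    (Theta : forall n, set 'rV[R]_(dimP M n))
    (Cmin Bmin U B0 : R) (delta gn : nat -> R) :
  regular_model M ->
  nondegenerate_rates M ->
  iid_copies P (W M) Ws ->
  (forall n, independent P (V n)
     (fun o => [tuple Ws i o | i < n] : n.-tuple (bvec R (dimW M)))) ->
  (forall n, measurable_fun [set: S n * bvec R (dimZ M)]
     (fun x => ghat n x.1 x.2 : bvec R (dimG M))) ->
  (forall g, G g ->
     measurable_fun [set: bvec R (dimZ M)]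
       (g : bvec R (dimZ M) -> bvec R (dimG M))) ->
  moment_condition M ->
  loss_primitive M ->
  Q_well_defined M Gn ->
  monotone_moment M ->
  identification M Cmin ->
  restricted_curvature M Bmin ->
  bounded_design M Gn Theta U ->
  (N = L2Norm -> L2_paths_in_domain M Gn) ->
  first_stage_rate M N G Gn V ghat delta gn ->
  B0_condition M N Gn B0 ->
  growth M U gn ->
  exists C0 : R, forall C : R, C0 <= C ->
    forall thetahat : forall n, Omega -> 'rV[R]_(dimP M n),
      (forall n, measurable_fun [set: Omega]
         (thetahat n : Omega -> bvec R (dimP M n))) ->
      (\forall n \near \oo, {ae P, forall o,
         is_lasso M n (fun i => Ws i o) (ghat n (V n o)) (penalty M C B0 gn n)
           (thetahat n o)}) ->
      bigO_in_prob P (fun n o => norm2 (thetahat n o - theta0 M n))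
        (fun n => Num.sqrt (sparsity M n)%:R * penalty M C B0 gn n) /\
      bigO_in_prob P (fun n o => norm1 (thetahat n o - theta0 M n))
        (fun n => (sparsity M n)%:R * penalty M C B0 gn n).
Proof.
move=> Hreg Hnd Hiid Hind Hgh HGm Hmom Hloss HQ Hmono Hid Hcurv Hbd HL2 Hfs HB0 Hgr.
exact: (lasso_rates Hreg Hnd Hiid Hind Hgh HGm Hmom Hloss HQ Hmono Hid Hcurv Hbd HL2 Hfs HB0 Hgr).
Qed.
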